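(* Fix $n\in\{0,1,2,\dots\}$, nonnegative integers $M,K$, an initial distribution $\mu(db^{-1})$, and a channel of Class B, i.e. $\mathbf P_{B_i|B^{i-1},A^i}(db_i|b^{i-1},a^i)=Q_i(db_i|b_{i-M}^{i-1},a_i)$, $i=0,\dots,n$. For such a channel $$I(A^n\to B^n)=\sum_{i=0}^n\mathbf E^{P}\Big\{\log\Big(\frac{dQ_i(\cdot|B_{i-M}^{i-1},A_i)}{d\Pi_i^{P}(\cdot|B^{i-1})}(B_i)\Big)\Big\}.$$ **Part A.** The maximization of $I(A^n\to B^n)$ over $\mathcal P_{[0,n]}$ occurs in the subset $$\overset{\circ}{\mathcal P}{}^{B.M}_{[0,n]}=\big\{\{P_i\}\in\mathcal P_{[0,n]}: P_i(da_i|a^{i-1},b^{i-1})=\pi_i^M(da_i|b_{i-M}^{i-1})\text{ for a.a. }(a^{i-1},b^{i-1}),\ i=0,\dots,n\big\}$$ (that is, the supremum may be restricted to this subset without changing its value), and $C^{FB,B.M}_{A^n\to B^n}:=\sup_{\mathcal P_{[0,n]}}I(A^n\to B^n)$ is given by $$C^{FB,B.M}_{A^n\to B^n}=\sup_{\{\pi_i^M(da_i|b_{i-M}^{i-1}):\,i=0,\dots,n\}}\sum_{i=0}^n\mathbf E^{\pi^M}\Big\{\log\Big(\frac{dQ_i(\cdot|B_{i-M}^{i-1},A_i)}{dv_i^{\pi^M}(\cdot|B_{i-M}^{i-1})}(B_i)\Big)\Big\}\equiv\sup_{\{\pi_i^M(da_i|b_{i-M}^{i-1}):\,i=0,\dots,n\}}\sum_{i=0}^n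 I(A_i;B_i|B_{i-M}^{i-1}),$$ where, for $i=0,\dots,n$, $v_i^{\pi^M}(db_i|b_{i-M}^{i-1})=\int_{\mathbb A_i}Q_i(db_i|b_{i-M}^{i-1},a_i)\otimes\pi_i^M(da_i|b_{i-M}^{i-1})$ and $\mathbf P^{\pi^M}(da_i,db_{i-M}^i)=Q_i(db_i|b_{i-M}^{i-1},a_i)\otimes\pi_i^M(da_i|b_{i-M}^{i-1})\otimes\mathbf P^{\pi^M}(db_{i-M}^{i-1})$. **Part B.** Suppose that the transmission cost is $c_{0,n}(a^n,b^{n-1})=\sum_{i=0}^n\gamma_i^{B.K}(a_i,b_{i-K}^{i-1})$ and that $$\sup_{\{P_i\}\in\mathcal P_{[0,n]}(\kappa)}I(A^n\to B^n)=\inf_{s\ge0}\ \sup_{\{P_i\}\in\mathcal P_{[0,n]}}\Big\{I(A^n\to B^n)-s\big\{\mathbf E^{P}(c_{0,n}(A^n,B^{n-1}))-\kappa(n+1)\big\}\Big\}.\qquad( * )$$ Let $J=\max\{M,K\}$. Then the maximization of $I(A^n\to B^n)$ over $\mathcal P_{[0,n]}(\kappa)$ occurs in the subset $$\overset{\circ}{\mathcal P}{}^{B.J}_{[0,n]}(\kappa)=\Big\{\{P_i\}: P_i(da_i|a^{i-1},b^{i-1})=\pi_i^J(da_i|b_{i-J}^{i-1})\text{ for a.a. }(a^{i-1},b^{i-1}),\ i=0,\dots,n,\ \tfrac1{n+1}\mathbf E^{\pi^J}(c_{0,n}(A^n,B^{n-1}))\le\kappa\Big\}\subset\mathcal P_{[0,n]}(\kappa)$$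 (that is, the supremum may be restricted to this subset without changing its value), and $C^{FB,B.J}_{A^n\to B^n}(\kappa):=\sup_{\mathcal P_{[0,n]}(\kappa)}I(A^n\to B^n)$ is given by $$C^{FB,B.J}_{A^n\to B^n}(\kappa)=\sup_{\{\pi_i^J\}\in\overset{\circ}{\mathcal P}{}^{B.J}_{[0,n]}(\kappa)}\ \sum_{i=0}^n\mathbf E^{\pi^J}\Big\{\log\Big(\frac{dQ_i(\cdot|B_{i-M}^{i-1},A_i)}{d\nu_i^{\pi^J}(\cdot|B_{i-J}^{i-1})}(B_i)\Big)\Big\},$$ where, for $i=0,\dots,n$, $\mathbf P^{\pi^J}(db_{i-J}^i,da_i)=Q_i(db_i|b_{i-M}^{i-1},a_i)\otimes\pi_i^J(da_i|b_{i-J}^{i-1})\otimes\mathbf P^{\pi^J}(db_{i-J}^{i-1})$ and $\nu_i^{\pi^J}(db_i|b_{i-J}^{i-1})=\int_{\mathbb A_i}Q_i(db_i|b_{i-M}^{i-1},a_i)\otimes\pi_i^J(da_i|b_{i-J}^{i-1})$. **Part C.** Suppose that the transmission cost is instead $c_{0,n}(a^n,b^{n-1})=\sum_{i=0}^n\gamma_i^{A}(a_i,b^{i-1})$ and that $( * )$ holds for this cost. Then the maximization of $I(A^n\to B^n)$ over $\mathcal P_{[0,n]}(\kappa)$ occurs in $\overline{\mathcal P}^{A}_{[0,n]}\cap\mathcal P_{[0,n]}(\kappa)$, where $\overline{\mathcal P}^{A}_{[0,n]}$ is the set of $\{P_i\}\in\mathcal P_{[0,n]}$ with $P_i(da_i|a^{i-1},b^{i-1})=\pi_i(da_i|b^{i-1})$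 for a.a. $(a^{i-1},b^{i-1})$, $i=0,\dots,n$ (that is, the supremum may be restricted to this subset without changing its value).
   Context: Spaces: the channel input alphabets $\mathbb A_i$ and output alphabets $\mathbb B_i$ are Polish spaces with Borel $\sigma$-algebras. Notation: $b^{i}=(b^{-1},b_0,\dots,b_i)$, where $b^{-1}=(\dots,b_{-2},b_{-1})\in\mathbb B^{-1}$ is the initial data, with fixed distribution $\mu(db^{-1})$; $a^i=(a_0,\dots,a_i)$ ($a^{-1}$ is empty, so $P_0(da_0|a^{-1},b^{-1})=P_0(da_0|b^{-1})$); $b_k^m=(b_k,\dots,b_m)$, which is empty if $k>m$ (so $M=0$ means $Q_i(db_i|a_i)$, and $K=0$ means $\gamma_i^{B.0}(a_i)$). All conditional distributions are stochastic kernels (measurable in the conditioning variable); $\otimes$ denotes composition of kernels/measures. $\mathcal P_{[0,n]}$ is the set of all sequences of channel input kernels with feedback $\{P_i(da_i|a^{i-1},b^{i-1}):i=0,\dots,n\}$. A channel and $\{P_i\}$ induce the joint distribution $\mathbf P^{P}(da^n,db^n)=\mu(db^{-1})\otimes_{j=0}^n\big(Q_j(db_j|b_{j-M}^{j-1},a_j)\otimes P_j(da_j|a^{j-1},b^{j-1})\big)$, with expectation $\mathbf E^{P}$; $\Pi_i^{P}(db_i|b^{i-1})$ denotes the conditional distribution of $B_i$ given $B^{i-1}$ under $\mathbf P^{P}$. When the input kernels are $\pi_i^M(da_i|b_{i-M}^{i-1})$ (resp. $\pi_i^J(da_i|b_{i-J}^{i-1})$) the superscript $P$ is replaced by $\pi^M$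 (resp. $\pi^J$). Directed information is $I(A^n\to B^n)=\sum_{i=0}^n I(A^i;B_i|B^{i-1})$; each expectation of a log Radon–Nikodym derivative is read as an averaged relative entropy (equal to $+\infty$ where absolute continuity fails). Transmission cost: a measurable function $c_{0,n}(a^n,b^{n-1})\in[0,\infty)$, and for $\kappa\in[0,\infty)$, $\mathcal P_{[0,n]}(\kappa)=\{\{P_i\}\in\mathcal P_{[0,n]}:\frac1{n+1}\mathbf E^{P}(c_{0,n}(A^n,B^{n-1}))\le\kappa\}$. *)

(* Defs.v *)
From HB Require Import structures.
From mathcomp Require Import all_boot all_order all_algebra.
From mathcomp Require Import all_classical all_reals all_analysis.
From mathcomp Require Import measurable_realfun.

Set Implicit Arguments.
Unset Strict Implicit.
Unset Printing Implicit Defensive.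

Import Order.TTheory GRing.Theory Num.Theory.
Import numFieldNormedType.Exports.

Local Open Scope classical_set_scope.
Local Open Scope ring_scope.
Local Open Scope ereal_scope.

(* To be used for a [completePseudoMetricType]: a complete pseudometric space
   that is Hausdorff and has a countable dense set is a Polish space, and every
   nonempty Polish space arises in this way. *)
Definition polish (T : topologicalType) : Prop :=
  hausdorff_space T /\ exists2 D : set T, countable D & dense D.

Notation borel T := (g_sigma_algebraType (@open T)).

Section trajectories.
Context {R : realType} {I : eqType}.
Variable X : I -> completePseudoMetricType R.
Implicit Types D : pred I.

Definition family D : Type := forall j : {j | D j}, borel (X (val j)).
HB.instance Definition _ D := Pointed.on (family D).

Definition cylinders D : set (set (family D)) :=
  \bigcup_(j in [set: {j | D j}])
    preimage_set_system setT (fun x : family D => x j) measurable.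

(* The families (x_j)_{j in D}, with the product sigma-algebra. *)
Definition traj D := g_sigma_algebraType (@cylinders D).

Definition coord D (i : I) (Di : D i) (x : traj D) : borel (X i) :=
  x (exist _ i Di).

Definition restr D D' (DD' : forall j, D' j -> D j) (x : traj D) : traj D' :=
  fun j => x (exist _ (val j) (DD' _ (valP j))).

(* Puts y at index i; all other coordinates are those of x. *)
Definition extend D D' (i : I) (DD' : forall j, D' j -> j != i -> D j)
    (x : traj D) (y : borel (X i)) : traj D' := fun j =>
  match eqVneq (val j) i with
  | EqNotNeq e => ecast k (borel (X k)) (esym e) y
  | NeqNotEq ne => x (exist _ (val j) (DD' _ (valP j) ne))
  end.

Lemma measurable_coordj D (j : {j | D j}) :
  measurable_fun [set: traj D] (fun x : traj D => x j).
Proof.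
move=> _ U mU; apply: sub_sigma_algebra; exists j => //; by exists U.
Qed.

Lemma measurable_traj d (T : measurableType d) D (f : T -> traj D) :
  (forall j, measurable_fun [set: T] (fun t => f t j)) ->
  measurable_fun [set: T] f.
Proof.
move=> mf; apply: (measurability _ (erefl (measurable : set (set (traj D))))).
move=> _ [_ [j _ [V mV <-]] <-]; rewrite setTI.
by have := mf j measurableT _ mV; rewrite !setTI.
Qed.

Lemma measurable_coord D i (Di : D i) :
  measurable_fun setT (@coord D i Di).
Proof. exact: (@measurable_coordj D (exist _ i Di)). Qed.

Lemma measurable_restr D D' (DD' : forall j, D' j -> D j) :
  measurable_fun setT (restr DD').
Proof.
apply: measurable_traj => j.
exact: (@measurable_coordj D (exist _ (val j) (DD' _ (valP j)))).
Qed.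

Lemma measurable_extend d (T : measurableType d) D D' i
    (DD' : forall j, D' j -> j != i -> D j) (f : T -> traj D)
    (g : T -> borel (X i)) :
  measurable_fun [set: T] f -> measurable_fun [set: T] g ->
  measurable_fun [set: T] (fun t => extend DD' (f t) (g t)).
Proof.
move=> mf mg; apply: (@measurable_traj _ _ D') => j.
rewrite /extend; case: eqVneq => [e|ne]; last first.
  pose j' : {j | D j} := exist _ (val j) (DD' _ (valP j) ne).
  exact: (measurableT_comp (@measurable_coordj D j') mf).
by case: _ / (esym e).
Qed.

HB.instance Definition _ D i (Di : D i) :=
  isMeasurableFun.Build _ _ _ _ (@coord D i Di) (measurable_coord Di).
HB.instance Definition _ D D' (DD' : forall j, D' j -> D j) :=
  isMeasurableFun.Build _ _ _ _ (restr DD') (measurable_restr DD').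

End trajectories.

Section kernels.
Context d1 d2 d3 (X : measurableType d1) (Y : measurableType d2)
  (Z : measurableType d3) (R : realType).

Section at_point.
Variables (k : R.-pker X ~> Y) (x : X).

Definition kat : set Y -> \bar R := k x.
HB.instance Definition _ := Measure.on kat.
HB.instance Definition _ :=
  Measure_isProbability.Build _ _ _ kat (prob_kernel x).

End at_point.

Section reindex.
Variables (k : R.-pker Y ~> Z) (f : {mfun X >-> Y}).

Definition kreindex (x : X) : {measure set Z -> \bar R} := k (f x).

Let mkreindex U : measurable U -> measurable_fun [set: X] (kreindex ^~ U).
Proof.
move=> mU; rewrite (_ : kreindex ^~ U = (k ^~ U) \o f)//.
by apply: measurableT_comp => //; exact: measurable_kernel.
Qed.

HB.instance Definition _ := isKernel.Build _ _ _ _ _ kreindex mkreindex.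

Let kreindexT x : kreindex x [set: Z] = 1.
Proof. exact: prob_kernel. Qed.

HB.instance Definition _ :=
  Kernel_isProbability.Build _ _ _ _ _ kreindex kreindexT.

End reindex.

Section composition.
Variables (l : R.-pker X ~> Y) (k : R.-pker X * Y ~> Z) (x : X).

Let kcompT : kcomp l k x [set: Z] = 1.
Proof.
rewrite /kcomp (eq_integral (cst 1)); last by move=> y _; rewrite prob_kernel.
by rewrite integral_cst// mul1e prob_kernel.
Qed.

HB.instance Definition _ :=
  Measure_isProbability.Build _ _ _ (kcomp l k x) kcompT.

End composition.

(* The measure mu (x) k on X * Y, i.e. mu(dx) k(dy | x). *)
Section semidirect.
Variables (mu : probability X R) (k : R.-pker X ~> Y).

Definition semidirect (U : set (X * Y)) : \bar R :=
  \int[mu]_x k x (xsection U x).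

Let semidirect0 : semidirect set0 = 0.
Proof.
by apply: integral0_eq => x _; rewrite xsection0 measure0.
Qed.

Let semidirect_ge0 U : 0 <= semidirect U.
Proof. exact: integral_ge0. Qed.

Let semidirect_sigma_additive : semi_sigma_additive semidirect.
Proof.
move=> U mU tU mUU.
rewrite [X in _ --> X](_ : _ =
  \int[mu]_x \sum_(n <oo) k x (xsection (U n) x)); last first.
  apply: eq_integral => x _; rewrite xsection_bigcup.
  apply/esym/cvg_lim => //; apply: measure_semi_sigma_additive.
  - by move=> n; exact: measurable_xsection.
  - exact: trivIset_xsection.
  - by apply: bigcup_measurable => n _; exact: measurable_xsection.
apply/cvg_closeP; split.
  by apply: is_cvg_nneseries => n _ _; exact: integral_ge0.
rewrite closeE// integral_nneseries// => n.
by apply: measurable_fun_xsection_finite_kernel; rewrite inE.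
Qed.

HB.instance Definition _ := isMeasure.Build _ _ _ semidirect
  semidirect0 semidirect_ge0 semidirect_sigma_additive.

Let semidirectT : semidirect setT = 1.
Proof.
rewrite /semidirect (eq_integral (cst 1)); last first.
  by move=> x _; rewrite xsectionE preimage_setT prob_kernel.
by rewrite integral_cst// mul1e; exact: probability_setT.
Qed.

HB.instance Definition _ :=
  Measure_isProbability.Build _ _ _ semidirect semidirectT.

End semidirect.

End kernels.

Section information.
Context {R : realType}.

(* Relative entropy D(P || Q) = E_P log (dP/dQ). *)
Definition kl d (T : measurableType d) (P Q : probability T R) : \bar R :=
  if `[< P `<< Q >] then
    \int[P]_x lne (Radon_Nikodym (charge_of_finite_measure P) Q x)
  else +oo.

Context d (W : measurableType d) (P : probability W R).

(* k is a regular conditional distribution of V given U under P. *)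
Definition is_cond_dist d1 d2 (T1 : measurableType d1) (T2 : measurableType d2)
    (U : W -> T1) (V : W -> T2) (k : R.-pker T1 ~> T2) : Prop :=
  forall E F, measurable E -> measurable F ->
    P (U @^-1` E `&` V @^-1` F) = \int[P]_(w in U @^-1` E) k (U w) F.

(* A version of the conditional distribution of V given U under P; one exists
   when T2 is a Polish space with its Borel sigma-algebra. *)
Definition cond_dist d1 d2 (T1 : measurableType d1) (T2 : measurableType d2)
    (U : W -> T1) (V : W -> T2) : R.-pker T1 ~> T2 :=
  match pselect (exists k, is_cond_dist U V k) with
  | left ex => projT1 (cid ex)
  | right _ => kprobability (measurable_cst (point : pprobability T2 R))
  end.

(* I(U; V | Z) = E log (dP_{V | Z, U} / dP_{V | Z}). *)
Definition cond_mutual_info d1 d2 d3 (T1 : measurableType d1)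
    (T2 : measurableType d2) (T3 : measurableType d3)
    (U : W -> T1) (V : W -> T2) (Z : W -> T3) : \bar R :=
  \int[P]_w kl (kat (cond_dist (fun w => (Z w, U w)) V) (Z w, U w))
               (kat (cond_dist Z V) (Z w)).

End information.

Section channel.
Context {R : realType}.
Variables (A : nat -> completePseudoMetricType R)
          (B : int -> completePseudoMetricType R).

(* a^{i-1}, b^{i-1} and b_{i-m}^{i-1} respectively; [outs 0] is the space of
   the initial data. *)
Definition ins (i : nat) := traj A (fun j => (j < i)%N).
Definition outs (i : nat) := traj B (fun j => (j < i%:Z)%R).
Definition win (i m : nat) := traj B (fun j => (i%:Z - m%:Z <= j < i%:Z)%R).
Definition hist (i : nat) := (ins i * outs i)%type.

Lemma ins_extend_subproof i j : (j < i.+1)%N -> j != i -> (j < i)%N.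
Proof. by rewrite ltnS leq_eqVlt => /orP[/eqP ->|//]; rewrite eqxx. Qed.

Lemma outs_extend_subproof (i : nat) (j : int) :
  (j < i.+1%:Z)%R -> j != i%:Z -> (j < i%:Z)%R.
Proof.
by rewrite intS addrC ltzD1 le_eqVlt => /orP[/eqP ->|//]; rewrite eqxx.
Qed.

Lemma ins_restr_subproof i n (le_in : (i <= n)%N) j : (j < i)%N -> (j < n)%N.
Proof. by move=> ji; exact: leq_trans le_in. Qed.

Lemma outs_restr_subproof i n (le_in : (i <= n)%N) (j : int) :
  (j < i%:Z)%R -> (j < n%:Z)%R.
Proof. by move=> ji; rewrite (lt_le_trans ji)// lez_nat. Qed.

Lemma win_outs_subproof (i m : nat) (j : int) :
  (i%:Z - m%:Z <= j < i%:Z)%R -> (j < i%:Z)%R.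
Proof. by case/andP. Qed.

Lemma win_win_subproof (i m m' : nat) (le_mm' : (m <= m')%N) (j : int) :
  (i%:Z - m%:Z <= j < i%:Z)%R -> (i%:Z - m'%:Z <= j < i%:Z)%R.
Proof.
case/andP => mj ->; rewrite andbT (le_trans _ mj)// lerD2l lerN2.
by rewrite lez_nat.
Qed.

Definition past_outs i n (le_in : (i <= n)%N) : outs n -> outs i :=
  restr (outs_restr_subproof le_in).
Definition window i m : outs i -> win i m := restr (@win_outs_subproof i m).
Definition subwindow i m m' (le_mm' : (m <= m')%N) : win i m' -> win i m :=
  restr (@win_win_subproof i m m' le_mm').
Definition input n i (lt_in : (i < n)%N) : ins n -> borel (A i) :=
  @coord _ _ A (fun j => (j < n)%N) i lt_in.
Definition output n i (lt_in : (i%:Z < n%:Z)%R) : outs n -> borel (B i) :=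
  @coord _ _ B (fun j => (j < n%:Z)%R) i lt_in.
Arguments window {i} m b.
Arguments past_outs {i n} le_in b.
Arguments subwindow {i m m'} le_mm' x.
Arguments input {n i} lt_in a.
Arguments output {n i} lt_in b.

(* [ins 0] has exactly one point. *)
Definition init (b : outs 0) : hist 0 := (point, b).

Definition snoc i (hxy : hist i * borel (A i) * borel (B i)) : hist i.+1 :=
  (extend (@ins_extend_subproof i) hxy.1.1.1 hxy.1.2,
   extend (@outs_extend_subproof i) hxy.1.1.2 hxy.2).

(* The random variables A_i, B_i, B^{i-1} and B_{i-m}^{i-1} as functions of
   (A^i, B^i). *)
Definition lastA i (w : hist i.+1) : borel (A i) := input (ltnSn i) w.1.
Definition lastB i (w : hist i.+1) : borel (B i) := output (ltnSn i) w.2.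
Definition pastB i (w : hist i.+1) : outs i := past_outs (leqnSn i) w.2.
Definition winB i m (w : hist i.+1) : win i m := window m (pastB w).
Arguments winB {i} m w.

Definition hist_window i m (h : hist i) : win i m := window m h.2.
Definition hist_input_window i m (hx : hist i * borel (A i)) :
  win i m * borel (A i) := (window m hx.1.2, hx.2).
Definition subwindow_input i m m' (le_mm' : (m <= m')%N)
  (wx : win i m' * borel (A i)) : win i m * borel (A i) :=
  (subwindow le_mm' wx.1, wx.2).

Lemma measurable_init : measurable_fun [set: outs 0] init.
Proof. exact/measurable_fun_pair. Qed.

Lemma measurable_snoc i :
  measurable_fun [set: hist i * borel (A i) * borel (B i)] (@snoc i).
Proof.
apply/measurable_fun_pair.
- by apply: measurable_extend => /=; do 3 ?apply: measurableT_comp => //.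
- by apply: measurable_extend => /=; do 3 ?apply: measurableT_comp => //.
Qed.

Lemma measurable_lastA i : measurable_fun [set: hist i.+1] (@lastA i).
Proof. by apply: (@measurableT_comp _ _ _ _ _ _ (input (ltnSn i)) _ fst). Qed.

Lemma measurable_lastB i : measurable_fun [set: hist i.+1] (@lastB i).
Proof. by apply: (@measurableT_comp _ _ _ _ _ _ (output (ltnSn i)) _ snd). Qed.

Lemma measurable_pastB i : measurable_fun [set: hist i.+1] (@pastB i).
Proof. by apply: (@measurableT_comp _ _ _ _ _ _ (past_outs (leqnSn i)) _ snd). Qed.

Lemma measurable_winB i m : measurable_fun [set: hist i.+1] (@winB i m).
Proof.
apply: (@measurableT_comp _ _ _ _ _ _ (@window i m) _ (@pastB i)).
  exact: measurable_restr.
exact: measurable_pastB.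
Qed.

Lemma measurable_hist_window i m :
  measurable_fun [set: hist i] (@hist_window i m).
Proof. by apply: (@measurableT_comp _ _ _ _ _ _ (@window i m) _ snd). Qed.

Lemma measurable_hist_input_window i m :
  measurable_fun [set: hist i * borel (A i)] (@hist_input_window i m).
Proof.
apply/measurable_fun_pair => //.
apply: (@measurableT_comp _ _ _ _ _ _ (@hist_window i m) _ fst) => //.
exact: measurable_hist_window.
Qed.

Lemma measurable_subwindow_input i m m' (le_mm' : (m <= m')%N) :
  measurable_fun [set: win i m' * borel (A i)] (@subwindow_input i m m' le_mm').
Proof.
apply/measurable_fun_pair => //.
apply: (@measurableT_comp _ _ _ _ _ _ (@subwindow i m m' le_mm') _ fst) => //.
Qed.

HB.instance Definition _ := isMeasurableFun.Build _ _ _ _ init measurable_init.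
HB.instance Definition _ i :=
  isMeasurableFun.Build _ _ _ _ (@snoc i) (@measurable_snoc i).
HB.instance Definition _ i m :=
  isMeasurableFun.Build _ _ _ _ (@winB i m) (@measurable_winB i m).
HB.instance Definition _ i m :=
  isMeasurableFun.Build _ _ _ _ (@hist_window i m) (@measurable_hist_window i m).
HB.instance Definition _ i m :=
  isMeasurableFun.Build _ _ _ _ (@hist_input_window i m)
    (@measurable_hist_input_window i m).
HB.instance Definition _ i m m' (le_mm' : (m <= m')%N) :=
  isMeasurableFun.Build _ _ _ _ (@subwindow_input i m m' le_mm')
    (@measurable_subwindow_input i m m' le_mm').

(* {P_i(da_i | a^{i-1}, b^{i-1})}_i and {pi_i^m(da_i | b_{i-m}^{i-1})}_i; only
   the kernels of index at most n matter in what follows. *)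
Definition policies := forall i : nat, R.-pker (hist i) ~> borel (A i).
Definition win_policies (m : nat) :=
  forall i : nat, R.-pker (win i m) ~> borel (A i).
Definition out_policies := forall i : nat, R.-pker (outs i) ~> borel (A i).

Definition policy_of m (pi : win_policies m) : policies :=
  fun i => kreindex (pi i) (@hist_window i m).

Variables (M : nat) (mu : probability (outs 0) R).
Variable Q : forall i : nat, R.-pker (win i M * borel (A i)) ~> borel (B i).

Definition channel_law i : R.-pker (hist i * borel (A i)) ~> borel (B i) :=
  kreindex (Q i) (@hist_input_window i M).

(* The law of (A^{i-1}, B^{i-1}); [joint P n.+1] is P^P(da^n, db^n), and
   [joint P i.+1] is its marginal P^P(da^i, db^i) for i <= n. *)
Fixpoint joint (P : policies) (i : nat) : probability (hist i) R :=
  match i with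
  | 0%N => distribution mu init
  | i'.+1 => distribution
      (semidirect (semidirect (joint P i') (P i')) (channel_law i')) (@snoc i')
  end.

(* Pi_i^P(db_i | b^{i-1}) *)
Definition output_law (P : policies) i : R.-pker (outs i) ~> borel (B i) :=
  cond_dist (joint P i.+1) (@pastB i) (@lastB i).

(* v_i^{pi^m}(db_i | b_{i-m}^{i-1}), first for m = M, then for m >= M *)
Definition vlaw (pi : win_policies M) i (x : win i M) :
  probability (borel (B i)) R := kcomp (pi i) (Q i) x.
Definition nulaw m (le_Mm : (M <= m)%N) (pi : win_policies m) i (x : win i m) :
  probability (borel (B i)) R :=
  kcomp (pi i) (kreindex (Q i) (@subwindow_input i M m le_Mm)) x.

Definition directed_info n (P : policies) : \bar R :=
  \sum_(i < n.+1) cond_mutual_info (joint P i.+1) fst (@lastB i) (@pastB i).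

(* sum_{i <= n} E^P log (dQ_i(. | B_{i-M}^{i-1}, A_i) / dV_i (B_i)), where V_i
   is a random probability measure on the i-th output alphabet. *)
Definition log_density_sum n (P : policies)
    (V : forall i, hist i.+1 -> probability (borel (B i)) R) : \bar R :=
  \sum_(i < n.+1) \int[joint P i.+1]_w
    kl (kat (Q i) (winB M w, lastA w)) (V i w).

Definition follows_win n m (P : policies) (pi : win_policies m) : Prop :=
  forall i, (i <= n)%N -> {ae joint P i, forall h,
    forall U, measurable U -> P i h U = pi i (window m h.2) U}.
Definition follows_out n (P : policies) (pi : out_policies) : Prop :=
  forall i, (i <= n)%N -> {ae joint P i, forall h,
    forall U, measurable U -> P i h U = pi i h.2 U}.

Definition expected_cost n (c : ins n.+1 * outs n -> R) (P : policies) :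
  \bar R := \int[joint P n.+1]_w (c (w.1, pastB w))%:E.

Definition admissible n (c : ins n.+1 * outs n -> R) (kappa : R) :
  set policies :=
  [set P | (n.+1%:R^-1)%:E * expected_cost c P <= kappa%:E].

(* When the information and the expected cost are both +oo, the Lagrangian is
   -oo if s > 0, and +oo if s = 0. *)
Definition lagrangian_duality n (c : ins n.+1 * outs n -> R) (kappa : R) :
  Prop :=
  ereal_sup [set directed_info n P | P in admissible c kappa] =
  ereal_inf [set ereal_sup [set directed_info n P -
      s%:E * (expected_cost c P - (kappa * n.+1%:R)%:E) | P in [set: policies]]
    | s in [set s : R | (0 <= s)%R]].

(* P^{pi}(db_{i-m}^i, da_i) is the composition of P^{pi}(db_{i-m}^{i-1}),
   pi_i(da_i | b_{i-m}^{i-1}) and K(db_i | b_{i-m}^{i-1}, a_i). *)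
Definition window_joint_law m (pi : win_policies m) i
    (K : R.-pker (win i m * borel (A i)) ~> borel (B i)) : Prop :=
  let law := joint (policy_of pi) i.+1 in
  forall U, measurable U ->
    pushforward law (fun w => (winB m w, lastA w, lastB w)) U =
    semidirect (semidirect (distribution law (@winB i m)) (pi i)) K U.

End channel.

Arguments lastA {R A B i} w.
Arguments lastB {R A B i} w.
Arguments pastB {R A B i} w.
Arguments winB {R A B i} m w.
Arguments vlaw {R A B M} Q pi i x.
Arguments nulaw {R A B M} Q {m} le_Mm pi i x.
Arguments output_law {R A B M} mu Q P i.
Arguments joint {R A B M} mu Q P i.
Arguments directed_info {R A B M} mu Q n P.
Arguments log_density_sum {R A B M} mu Q n P V.
Arguments subwindow_input {R A B i m m'} le_mm' wx.
Arguments past_outs {R B i n} le_in b.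
Arguments window {R B i} m b.
Arguments subwindow {R B i m m'} le_mm' x.
Arguments input {R A n i} lt_in a.
Arguments output {R B n i} lt_in b.

(* Main.v *)
(* Given a policy P and a statistic S_i of B^{i-1} (the window of length
   M or max(M, K), or B^{i-1} itself) through which both the channel and the cost see
   the past outputs, let pi_i be the conditional distribution of A_i given S_i
   under P. By induction on i, the law of (S_i, A_i, B_i) is the same under pi as
   under P.

   Under pi the law of B_i given B^{i-1} is the function v_i(. | S_i), so the
   information under pi is sum_i E D(Q_i || v_i(. | S_i)), and it takes the same
   value under P. Under P the information is sum_i E D(Q_i || Pi_i), which is at
   most that value because the conditional distribution Pi_i minimizes
   r |-> E D(Q_i || r(. | B^{i-1})).

   The costs of P and pi are equal, hence pi is admissible when P is. As the
   stage costs have no sign and need not be integrable, the equality of the costs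
   is obtained by replacing the kernels of P by those of pi one at a time and
   truncating.

   Conditional distributions are constructed with quantile functions, a Polish
   space being a measurable retract of the real line. *)

Require Import Defs.
From HB Require Import structures.
From mathcomp Require Import all_boot all_order all_algebra.
From mathcomp Require Import all_classical all_reals all_analysis.
From mathcomp Require Import measurable_realfun.
From mathcomp Require Import lra zify.

Set Implicit Arguments.
Unset Strict Implicit.
Unset Printing Implicit Defensive.

Import Order.TTheory GRing.Theory Num.Theory.
Import numFieldNormedType.Exports.

Local Open Scope classical_set_scope.
Local Open Scope ring_scope.
Local Open Scope ereal_scope.

(** The obstacles are measure-theoretic. The relative entropy of two kernels is not shown to be
    measurable in the conditioning variable: it only agrees almost everywhere with a measurable
    function, so averaged entropies are integrals from below and are compared by lemmas that ask for
    no measurability. Identities between kernels hold almost everywhere for each set separately; a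
    countable determining class makes the exceptional set independent of the set.

    No entropy is assumed finite. The minimality of Pi_i is therefore not read off a difference of
    entropies, but off an additive inequality obtained by integrating ln x <= x - 1, with the
    constant 1 moved to the other side.

    For the cost, equal laws of (S_i, A_i, B_i) do not suffice by themselves, since the expectation
    of the total need not be the sum of the expectations of the stage costs. The substitute is a
    theorem of Simons: if X + Y >= 0, then E(X + Y) depends only on the law of X and the law of Y.
    It fails for three summands; exchanging one kernel at a time is what leaves just two blocks of
    stages. *)

Definition has_law d1 d2 (W : measurableType d1) (Y : measurableType d2)
    (R : realType) (P : set W -> \bar R) (f : W -> Y) (nu : set Y -> \bar R) :=
  forall U, measurable U -> P (f @^-1` U) = nu U.

(** * Laws of maps and integration against [semidirect] *)

Section laws.
Context {R : realType}.

Lemma measurable_preimage d1 d2 (W : measurableType d1) (Y : measurableType d2)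
    (f : W -> Y) (U : set Y) :
  measurable_fun [set: W] f -> measurable U -> measurable (f @^-1` U).
Proof. by move=> mf mU; rewrite -[X in measurable X]setTI; exact: mf. Qed.

Lemma integral_law d1 d2 (W : measurableType d1) (Y : measurableType d2)
    (P : {measure set W -> \bar R}) (f : W -> Y) (nu : {measure set Y -> \bar R})
    (g : Y -> \bar R) :
  measurable_fun [set: W] f -> has_law P f nu ->
  measurable_fun [set: Y] g -> (forall y, 0 <= g y) ->
  \int[nu]_y g y = \int[P]_w g (f w).
Proof.
move=> mf law mg g0.
have := ge0_integral_pushforward mf P (@measurableT _ Y) mg (fun y _ => g0 y).
rewrite preimage_setT => <-; apply: eq_measure_integral => U mU _.
by rewrite -law.
Qed.

Lemma eq_integral_measure d (W : measurableType d)
    (m1 m2 : {measure set W -> \bar R}) (f : W -> \bar R) :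
  (forall U, measurable U -> m1 U = m2 U) ->
  \int[m1]_w f w = \int[m2]_w f w.
Proof.
by move=> m12; apply: eq_measure_integral => U mU _; exact: m12.
Qed.

Lemma ae_law d1 d2 (W : measurableType d1) (Y : measurableType d2)
    (P : {measure set W -> \bar R}) (f : W -> Y) (nu : {measure set Y -> \bar R})
    (p : set Y) :
  measurable_fun [set: W] f -> has_law P f nu ->
  {ae nu, forall y, p y} -> {ae P, forall w, p (f w)}.
Proof.
move=> mf law [N [mN nuN pN]]; exists (f @^-1` N); split.
- exact: measurable_preimage.
- by rewrite law.
- by move=> w nw; exact: pN.
Qed.

Lemma rect_generate d1 d2 (X : measurableType d1) (Y : measurableType d2)
    (m1 m2 : {measure set (X * Y) -> \bar R}) :
  m1 setT < +oo ->
  (forall E F, measurable E -> measurable F -> m1 (E `*` F) = m2 (E `*` F)) ->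
  forall U, measurable U -> m1 U = m2 U.
Proof.
move=> m1T m12 U mU.
pose G := [set E `*` F | E in @measurable _ X & F in @measurable _ Y].
apply: (@g_sigma_algebra_measure_unique _ _ _ G _ (fun=> setT)) => //.
- by move=> _ [E mE [F mF <-]]; exact: measurableX.
- by move=> _; exists setT => //; exists setT => //; rewrite setXTT.
- by rewrite bigcup_const//; exists 0%N.
- move=> _ _ [E mE [F mF <-]] [E' mE' [F' mF' <-]].
  exists (E `&` E'); first exact: measurableI.
  by exists (F `&` F'); [exact: measurableI|rewrite setXI].
- by move=> _ [E mE [F mF <-]]; exact: m12.
- by rewrite -measurable_prod_measurableType.
Qed.

End laws.

Section semidirect_integral.
Context d1 d2 (X : measurableType d1) (Y : measurableType d2) (R : realType).
Variables (mu : probability X R) (k : R.-pker X ~> Y).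

Let slice (p : unit * X) (y : Y) : X * Y := (p.2, y).

Let mslice p : measurable_fun [set: Y] (slice p).
Proof. exact/measurable_fun_pair. Qed.

HB.instance Definition _ p :=
  isMeasurableFun.Build _ _ _ _ (slice p) (mslice p).

Let kpair (p : unit * X) : {measure set (X * Y) -> \bar R} :=
  distribution (kat k p.2) (slice p).

Let kpairE p U : kpair p U = k p.2 (xsection U p.2).
Proof. by rewrite xsectionE. Qed.

Let mkpair U : measurable U -> measurable_fun [set: unit * X] (kpair ^~ U).
Proof.
move=> mU; rewrite (_ : kpair ^~ U = (fun x => k x (xsection U x)) \o snd).
  apply: measurableT_comp => //.
  by apply: measurable_fun_xsection_finite_kernel; rewrite inE.
by apply/funext => p; rewrite kpairE.
Qed.

HB.instance Definition _ := isKernel.Build _ _ _ _ _ kpair mkpair.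

Let kpairT p : kpair p setT = 1.
Proof. by rewrite kpairE xsectionE preimage_setT prob_kernel. Qed.

HB.instance Definition _ := Kernel_isProbability.Build _ _ _ _ _ kpair kpairT.

Let kmu : R.-pker unit ~> X :=
  kprobability (measurable_cst (mu : pprobability X R)).

(** [semidirect mu k] is the composition of the constant kernel [kmu] on [unit] with [kpair], which
    sends x to the law of (x, y) for y drawn from [k x]. The formula thus reduces to the one for
    [kcomp], which is why a factor [unit] appears. *)
Lemma integral_semidirect (f : X * Y -> \bar R) :
  (forall z, 0 <= f z) -> measurable_fun setT f ->
  \int[semidirect mu k]_z f z = \int[mu]_x \int[k x]_y f (x, y).
Proof.
move=> f0 mf.
transitivity (\int[kcomp kmu kpair tt]_z f z).
  apply: eq_integral_measure => U mU.
  by apply: eq_integral => x _; rewrite kpairE.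
rewrite (integral_kcomp kmu kpair)//; apply: eq_integral => x _.
by rewrite /kpair ge0_integral_distribution.
Qed.

Lemma semidirect_rect E F : measurable E -> measurable F ->
  semidirect mu k (E `*` F) = \int[mu]_(x in E) k x F.
Proof.
move=> mE mF; rewrite [RHS]integral_mkcond; apply: eq_integral => x _ /=.
rewrite patchE; case: ifPn => xE; first by rewrite in_xsectionX.
by rewrite notin_xsectionX// measure0.
Qed.

End semidirect_integral.

(** * Relative entropy *)

(** The density is real valued and nonnegative everywhere, not just almost everywhere, so that
    logarithms and quotients are computed pointwise in [R]. *)
Definition has_density d (T : measurableType d) (R : realType)
    (P Q : set T -> \bar R) (f : T -> R) :=
  [/\ measurable_fun [set: T] f, forall x, (0 <= f x)%R &
      forall F, measurable F -> P F = \int[Q]_(x in F) (f x)%:E].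

Lemma measurable_fun_lne {R : realType} : measurable_fun [set: \bar R] (@lne R).
Proof.
rewrite (_ : @lne R = fun x => if x <= 0 then -oo else
    if x == +oo then +oo else (ln (fine x))%:E); last first.
  by apply/funext => -[r| |]//=; rewrite ?lee_fin ?leNye ?leye_eq//.
apply: measurable_fun_ifT => //; first exact: measurable_fun_lee.
apply: measurable_fun_ifT => //; first exact: measurable_fun_eqe.
by apply/measurable_EFinP; apply: measurableT_comp => //; exact: measurable_ln.
Qed.

(** Integrability is not assumed: the positive parts compare one way, the negative parts the other
    way, and subtraction of extended reals is monotone even at infinite values. *)
Lemma ae_le_integral d (T : measurableType d) (R : realType)
    (m : {measure set T -> \bar R}) (f g : T -> \bar R) :
  measurable_fun [set: T] f -> measurable_fun [set: T] g ->
  {ae m, forall x, f x <= g x} -> \int[m]_x f x <= \int[m]_x g x.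
Proof.
move=> mf mg fg; rewrite integralE [leRHS]integralE leeB//.
  apply: ae_ge0_le_integral => //; try exact: measurable_funepos.
  apply: filterS fg => x fgx _.
  by rewrite !funeposE ge_max le_max fgx/= le_max lexx orbT.
apply: ae_ge0_le_integral => //; try exact: measurable_funeneg.
apply: filterS fg => x fgx _.
by rewrite !funenegE ge_max le_max leeN2 fgx/= le_max lexx orbT.
Qed.

Section densities.
Context d (T : measurableType d) (R : realType).
Implicit Types (P Q p q r m : probability T R) (f g s t : T -> R).

Lemma has_density_dominates P Q f : has_density P Q f -> P `<< Q.
Proof.
move=> [mf f0 fE]; apply/null_content_dominatesP => F mF QF0.
rewrite fE// null_set_integral//; apply/measurable_EFinP.
exact: measurable_funTS.
Qed.

Lemma dominates_has_density (P : {finite_measure set T -> \bar R}) Q : P `<< Q -> exists f, has_density P Q f.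
Proof.
move=> PQ; pose f := Radon_Nikodym_SigmaFinite.f P Q.
have fE x : (fine (f x))%:E = f x.
  by rewrite fineK// Radon_Nikodym_SigmaFinite.f_fin_num.
exists (fine \o f); split.
- apply: measurableT_comp => //.
  by apply: measurable_int; exact: Radon_Nikodym_SigmaFinite.f_integrable.
- by move=> x; apply: fine_ge0; exact: Radon_Nikodym_SigmaFinite.f_ge0.
- move=> F mF; rewrite (Radon_Nikodym_SigmaFinite.f_integral PQ)//.
  by apply: eq_integral => x _; rewrite /= fE.
Qed.

Lemma has_density_integrable P Q f : has_density P Q f ->
  Q.-integrable setT (EFin \o f).
Proof.
move=> [mf f0 fE]; apply/integrableP; split; first exact/measurable_EFinP.
under eq_integral do rewrite gee0_abs ?lee_fin//.
by rewrite -fE// probability_setT ltry.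
Qed.

Lemma has_density_ae_eq P Q f (h : T -> \bar R) : has_density P Q f ->
  measurable_fun [set: T] h ->
  (forall F, measurable F -> P F = \int[Q]_(x in F) h x) ->
  {ae Q, forall x, (f x)%:E = h x}.
Proof.
move=> fd mh hE.
have : ae_eq Q setT (EFin \o f) h.
  apply: integral_ae_eq => //; first exact: has_density_integrable fd.
  by move=> F _ mF; rewrite -hE//; case: fd => _ _ <-.
by apply: filterS => x /(_ I).
Qed.

Lemma integral_has_density P Q f (g : T -> \bar R) D : has_density P Q f ->
  measurable D -> measurable_fun [set: T] g -> (forall x, 0 <= g x) ->
  \int[P]_(x in D) g x = \int[Q]_(x in D) (g x * (f x)%:E).
Proof.
move=> fd mD mg g0; have PQ := has_density_dominates fd.
pose h := Radon_Nikodym_SigmaFinite.f P Q.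
have mh : measurable_fun setT h.
  by apply: measurable_int; exact: Radon_Nikodym_SigmaFinite.f_integrable.
rewrite -(Radon_Nikodym_SigmaFinite.change_of_variables PQ)//; last first.
  exact: measurable_funTS.
apply: ae_eq_integral => //.
- by apply: measurable_funTS; exact: emeasurable_funM.
- apply: measurable_funTS; apply: emeasurable_funM => //.
  by apply/measurable_EFinP; case: fd.
- have := has_density_ae_eq fd mh (Radon_Nikodym_SigmaFinite.f_integral PQ).
  by apply: filterS => x /= -> _.
Qed.

Lemma has_density_gt0 P Q f : has_density P Q f -> {ae P, forall x, (0 < f x)%R}.
Proof.
move=> [mf f0 fE].
have mN : measurable [set x | (f x <= 0)%R].
  rewrite -[X in measurable X]setTI; exact: measurable_fun_le.
exists [set x | (f x <= 0)%R]; split => //; last first.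
  by move=> x /= /negP; rewrite -leNgt.
rewrite fE//; apply: integral0_eq => x /= fx.
by congr EFin; apply/eqP; rewrite eq_le fx f0.
Qed.

Lemma kl_has_density P Q f : has_density P Q f ->
  kl P Q = \int[P]_x (ln (f x))%:E.
Proof.
move=> fd; have PQ := has_density_dominates fd.
have [mf f0 fE] := fd.
rewrite /kl asboolT//.
set h := Radon_Nikodym _ _.
have mh : measurable_fun setT h.
  by apply: measurable_int; exact: Radon_Nikodym_integrable.
apply: ae_eq_integral => //.
- by apply: measurableT_comp mh; exact: measurable_fun_lne.
- by apply/measurable_EFinP; apply: measurableT_comp => //; exact: measurable_ln.
- have fh := has_density_ae_eq fd mh
    (fun A => @Radon_Nikodym_integral _ _ _ (charge_of_finite_measure P) Q A PQ).
  have {}fh : ae_eq P setT (EFin \o f) h.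
    by apply: (null_dominates_ae_eq _ PQ) => //; apply: filterS fh.
  apply: filterS2 fh (has_density_gt0 fd) => x /= /(_ I) <- fx _.
  by rewrite /= leNgt fx.
Qed.

Lemma kl_not_dominates P Q : ~ P `<< Q -> kl P Q = +oo.
Proof. by move=> PQ; rewrite /kl asboolF. Qed.

(** The bound 1 - 1/x <= ln x. Writing the inverse as [expR (- ln x)] makes its measurability
    immediate. *)
Lemma ln_ge1BV (x : R) : (0 < x)%R -> (1 - expR (- ln x) <= ln x)%R.
Proof.
move=> x0; have := expR_ge1Dx (- ln x)%R; lra.
Qed.

(** Integrate 1 - 1/f <= ln f against [P]; the integral of 1/f is at most 1 because [f] is the
    density of [P] relative to the probability [Q]. *)
Lemma kl_ge0 P Q : 0 <= kl P Q.
Proof.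
have [PQ|PQ] := pselect (P `<< Q); last by rewrite kl_not_dominates.
have [f fd] := dominates_has_density PQ; have [mf f0 fE] := fd.
have mlnf : measurable_fun setT (fun x => ln (f x)).
  by apply: measurableT_comp => //; exact: measurable_ln.
have minv : measurable_fun setT (fun x => expR (- ln (f x))).
  by apply: measurableT_comp => //; exact: measurableT_comp.
rewrite (kl_has_density fd).
have D1 : \int[P]_x (expR (- ln (f x)))%:E <= 1.
  rewrite (integral_has_density fd)//; last exact/measurable_EFinP.
  rewrite -(probability_setT Q) -[leRHS]mul1e -integral_cst//.
  apply: ge0_le_integral => //.
  - by move=> x _; rewrite mule_ge0// lee_fin ?expR_ge0.
  - by apply: emeasurable_funM; exact/measurable_EFinP.
  - move=> x _; rewrite -EFinM lee_fin.
    have := f0 x; rewrite le_eqVlt => /predU1P[<-|fx0]; first by rewrite mulr0.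
    by rewrite expRN lnK// mulVf// gt_eqF.
have intV : P.-integrable setT (fun x => (expR (- ln (f x)))%:E).
  apply/integrableP; split; first exact/measurable_EFinP.
  under eq_integral do rewrite gee0_abs ?lee_fin ?expR_ge0//.
  by rewrite (le_lt_trans D1)// ltry.
apply: (@le_trans _ _ (\int[P]_x (1 - (expR (- ln (f x)))%:E))).
  rewrite integralB//=; last exact: finite_measure_integrable_cst.
  rewrite integral_cst// mul1e [X in X - _](_ : _ = 1) ?sube_ge0//;
    last exact: (probability_setT P).
  by rewrite ge0_fin_numE ?(le_lt_trans D1) ?ltry// integral_ge0// => x _;
    rewrite lee_fin expR_ge0.
apply: ae_le_integral.
- by apply: emeasurable_funB => //; exact/measurable_EFinP.
- exact/measurable_EFinP.
- apply: filterS (has_density_gt0 fd) => x fx.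
  by rewrite -EFinB lee_fin ln_ge1BV.
Qed.

(** [Radon_Nikodym] is a choice that could differ between measures agreeing only on measurable sets.
    Computing [kl] from an arbitrary density removes this dependence. *)
Lemma eq_kl P Q P' Q' :
  (forall U, measurable U -> P U = P' U) ->
  (forall U, measurable U -> Q U = Q' U) -> kl P Q = kl P' Q'.
Proof.
move=> PE QE.
have [PQ|PQ] := pselect (P `<< Q); last first.
  rewrite !kl_not_dominates//; apply: contra_not PQ.
  move/null_content_dominatesP => PQ'; apply/null_content_dominatesP => F mF.
  move=> QF0; apply: (etrans (PE F mF)); apply: PQ' => //.
  exact: (etrans (esym (QE F mF))).
have [f fd] := dominates_has_density PQ; have [mf f0 fE] := fd.
have fd' : has_density P' Q' f.
  split => // F mF; rewrite -PE// fE//.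
  by apply: eq_measure_integral => U mU _; rewrite /= QE.
rewrite (kl_has_density fd) (kl_has_density fd').
exact: eq_integral_measure.
Qed.

End densities.

(* The value [+oo] for [s <= 0] makes the three-point inequality below hold
   without any absolute continuity assumption. *)
Definition eratio {R : realType} (t s : R) : \bar R :=
  if (s <= 0)%R then +oo else (t * expR (- ln s))%:E.

(** Serves as the density of p relative to q when [t] and [s] are their densities relative to a
    common measure; the set where [s] vanishes is null for q, so the value 0 there is harmless. *)
Definition rratio {R : realType} (t s : R) : R :=
  if (s <= 0)%R then 0%R else (t * expR (- ln s))%R.

Section ratios.
Context {R : realType}.

Lemma expRNln (s : R) : (0 < s)%R -> expR (- ln s) = (s^-1)%R.
Proof. by move=> s0; rewrite expRN lnK. Qed.

Lemma rratio_ge0 (t s : R) : (0 <= t)%R -> (0 <= rratio t s)%R.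
Proof. by move=> t0; rewrite /rratio; case: ifP => // _; rewrite mulr_ge0 ?expR_ge0. Qed.

Lemma eratio_ge0 (t s : R) : (0 <= t)%R -> 0 <= eratio t s.
Proof.
by move=> t0; rewrite /eratio; case: ifP => // _; rewrite lee_fin mulr_ge0 ?expR_ge0.
Qed.

Lemma measurable_rratio d (T : measurableType d) (t s : T -> R) :
  measurable_fun [set: T] t -> measurable_fun [set: T] s ->
  measurable_fun [set: T] (fun x => rratio (t x) (s x)).
Proof.
move=> mt ms; apply: measurable_fun_ifT => //; first exact: measurable_fun_ler.
apply: measurable_funM => //; apply: measurableT_comp => //.
by apply: measurableT_comp => //; apply: measurableT_comp => //; exact: measurable_ln.
Qed.

Lemma measurable_eratio d (T : measurableType d) (t s : T -> R) :
  measurable_fun [set: T] t -> measurable_fun [set: T] s ->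
  measurable_fun [set: T] (fun x => eratio (t x) (s x)).
Proof.
move=> mt ms; apply: measurable_fun_ifT => //; first exact: measurable_fun_ler.
apply/measurable_EFinP; apply: measurable_funM => //; apply: measurableT_comp => //.
by apply: measurableT_comp => //; apply: measurableT_comp => //; exact: measurable_ln.
Qed.

End ratios.

Section three_points.
Context d (T : measurableType d) (R : realType).
Implicit Types (p q r m : probability T R) (f g s t : T -> R).

Lemma measurable_le0_set s : measurable_fun [set: T] s ->
  measurable [set x | (s x <= 0)%R].
Proof. by move=> ms; rewrite -[X in measurable X]setTI; exact: measurable_fun_le. Qed.

Lemma has_density_le0 p m s : has_density p m s -> p [set x | (s x <= 0)%R] = 0.
Proof.
move=> [ms s0 sE]; rewrite sE; last exact: measurable_le0_set.
apply: integral0_eq => x /= sx; congr EFin.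
by apply/eqP; rewrite eq_le sx s0.
Qed.

Lemma has_density_rratio p q m f s :
  has_density p m f -> has_density q m s -> p [set x | (s x <= 0)%R] = 0 ->
  has_density p q (fun x => rratio (f x) (s x)).
Proof.
move=> fd sd ps0; have [mf f0 fE] := fd; have [ms s0 sE] := sd.
have mN := measurable_le0_set ms.
have mr := measurable_rratio mf ms.
split => //; first by move=> x; exact: rratio_ge0.
move=> F mF; rewrite (integral_has_density sd mF);
  [|exact/measurable_EFinP|by move=> x; rewrite lee_fin rratio_ge0].
pose N := [set x | (s x <= 0)%R].
have -> : p F = p (F `\` N).
  rewrite measureD// ?ltey_eq ?fin_num_measure//.
  by rewrite [X in _ - X](@subset_measure0 _ _ _ p _ N) ?sube0//; exact: measurableI.
rewrite fE; last exact: measurableD.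
rewrite setDE integral_mkcondr; apply: eq_integral => x _.
rewrite patchE /rratio; case: ifPn => [/set_mem/negP|/negP].
  rewrite /= -ltNge => sx; rewrite leNgt sx/= -EFinM; congr EFin.
  by rewrite expRNln// -mulrA mulVf ?mulr1// gt_eqF.
rewrite inE => /contrapT /= sx.
by rewrite sx mul0e.
Qed.

(** If f = dp/dr, then dp/dq = f t / s, and ln (t / s) <= t / s - 1. Keeping the 1 on the left
    avoids every subtraction of infinities: if dp/dr or dp/dq fails to exist, the right-hand side is
    infinite. *)
Lemma kl_three_points p q r m s t : has_density q m s -> has_density r m t ->
  kl p q + 1 <= kl p r + \int[p]_x eratio (t x) (s x).
Proof.
move=> sd td; have [ms s0 sE] := sd; have [mt t0 tE] := td.
have mts := measurable_eratio mt ms.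
have ts0 : 0 <= \int[p]_x eratio (t x) (s x).
  by apply: integral_ge0 => x _; exact: eratio_ge0.
have [pr|pr] := pselect (p `<< r); last first.
  by rewrite [X in _ <= X + _]kl_not_dominates// addye ?leey// gt_eqF// (lt_le_trans _ ts0).
have [f fd] := dominates_has_density pr; have [mf f0 fE] := fd.
have mN := measurable_le0_set ms.
(* If [p] charges the zero set of [s], which is null for [q], then [eratio] is infinite on a set of
   positive mass. *)
have [ps|ps] := eqVneq (p [set x | (s x <= 0)%R]) 0; last first.
  have -> : \int[p]_x eratio (t x) (s x) = +oo.
    apply/eqP; rewrite -leye_eq.
    apply: (@le_trans _ _ (\int[p]_(x in [set x | (s x <= 0)%R]) eratio (t x) (s x))).
      rewrite (eq_integral (cst +oo)).
        rewrite integral_cst// gt0_mulye//.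
        by rewrite lt_neqAle eq_sym ps/=.
      by move=> x /set_mem /= sx; rewrite /eratio sx.
    by apply: ge0_subset_integral => // x _; exact: eratio_ge0.
  by rewrite addey ?leey// gt_eqF// (lt_le_trans _ (kl_ge0 p r)).
have fd' : has_density p m (fun x => (f x * t x)%R).
  split; [exact: measurable_funM| by move=> x; rewrite mulr_ge0|].
  move=> F mF; rewrite fE// (integral_has_density td mF);
    [|exact/measurable_EFinP|by move=> x; rewrite lee_fin].
  by apply: eq_integral.
have ud := has_density_rratio fd' sd ps.
set u := (fun x => rratio _ _) in ud; have [mu u0 uE] := ud.
have mln (h : T -> R) : measurable_fun [set: T] h ->
    measurable_fun [set: T] (fun x => (ln (h x))%:E).
  by move=> mh; apply/measurable_EFinP; apply: (measurableT_comp (@measurable_ln R)).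
have [->|] := eqVneq (kl p r) +oo.
  by rewrite addye ?leey// gt_eqF// (lt_le_trans _ ts0).
rewrite -ltey => klfin.
have [->|] := eqVneq (\int[p]_x eratio (t x) (s x)) +oo.
  by rewrite addey ?leey// gt_eqF// (lt_le_trans _ (kl_ge0 p r)).
rewrite -ltey => rfin.
have intf : p.-integrable setT (fun x => (ln (f x))%:E).
  apply/integrableP; split; first exact: mln.
  rewrite integral_fin_num_abs//; last first.
    exact: (measurableT_comp (@measurable_ln R)).
  by rewrite -(kl_has_density fd) ge0_fin_numE// kl_ge0.
have intr : p.-integrable setT (fun x => eratio (t x) (s x)).
  apply/integrableP; split => //.
  by under eq_integral do rewrite gee0_abs ?eratio_ge0//.
have int1 : p.-integrable setT (cst 1).
  exact: finite_measure_integrable_cst.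
have intr1 : p.-integrable setT (fun x => eratio (t x) (s x) - 1).
  exact: integrableB.
have H : kl p q <= kl p r + (\int[p]_x eratio (t x) (s x) - 1).
  rewrite (kl_has_density ud) (kl_has_density fd).
  have -> : \int[p]_x eratio (t x) (s x) - 1 =
            \int[p]_x (eratio (t x) (s x) - 1).
    rewrite integralB// integral_cst// mul1e.
    by rewrite [X in _ = _ - X](_ : _ = 1)//; exact: (probability_setT p).
  rewrite -integralD//; apply: ae_le_integral; first exact: mln.
    by apply: emeasurable_funD; [exact: mln|exact: emeasurable_funB].
  apply: filterS2 (has_density_gt0 fd) (has_density_gt0 ud) => x fx ux.
  have sx : (0 < s x)%R.
    by rewrite ltNge; apply: contraTN ux => sx; rewrite /u /rratio sx ltxx.
  have tx : (0 < t x)%R.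
    rewrite lt_neqAle eq_sym t0 andbT; apply: contraTN ux => /eqP tx.
    by rewrite /u /rratio leNgt sx/= tx mulr0 mul0r ltxx.
  rewrite /eratio /u /rratio (leNgt (s x)) sx/= -EFinB -EFinD lee_fin.
  rewrite lnM ?posrE ?mulr_gt0 ?expR_gt0// lnM ?posrE// expRK -addrA lerD2l.
  have := expR_ge1Dx (ln (t x) - ln (s x)).
  rewrite expRD lnK ?posrE// => ?; lra.
rewrite (le_trans (leeD2r 1 H))// -addeA subeK//.
Qed.

End three_points.

(** * Countable determining classes and densities of kernels *)

(** A countable pi-system that contains the whole space and generates the sigma-algebra: equality on
    it gives equality of finite measures, and countably many null sets can be united. *)
Definition determining d (T : measurableType d) (G : nat -> set T) :=
  [/\ forall n, measurable (G n), exists n, G n = setT,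
      setI_closed (range G) & forall F, measurable F -> <<s range G >> F].

Lemma determining_eq d (T : measurableType d) (R : realType) (G : nat -> set T)
    (m1 m2 : {measure set T -> \bar R}) :
  determining G -> m1 setT < +oo -> (forall n, m1 (G n) = m2 (G n)) ->
  forall F, measurable F -> m1 F = m2 F.
Proof.
move=> [mG [n0 Gn0] IG gG] m1T m12 F mF.
apply: (@g_sigma_algebra_measure_unique _ _ _ (range G) _ (fun=> setT)) => //.
- by move=> _ [n _ <-].
- by move=> _; exists n0.
- by rewrite bigcup_const//; exists 0%N.
- by move=> _ [n _ <-].
- exact: gG.
Qed.

Section density_measure.
Context d (T : measurableType d) (R : realType).
Variables (m : {measure set T -> \bar R}) (h : T -> \bar R).
Hypotheses (mh : measurable_fun [set: T] h) (h0 : forall x, 0 <= h x).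

(** The two proofs are arguments so that the measure structure can be attached to the term. *)
Definition density_measure (_ : measurable_fun [set: T] h)
    (_ : forall x, 0 <= h x) (F : set T) : \bar R := \int[m]_(x in F) h x.

Local Notation dm := (density_measure mh h0).

Let dm0 : dm set0 = 0. Proof. exact: integral_set0. Qed.

Let dm_ge0 F : 0 <= dm F. Proof. exact: integral_ge0. Qed.

Let dm_sigma_additive : semi_sigma_additive dm.
Proof.
move=> F mF tF mUF; rewrite /density_measure ge0_integral_bigcup//.
- by apply: is_cvg_nneseries => n _ _; exact: integral_ge0.
- exact: measurable_funTS.
Qed.

HB.instance Definition _ := isMeasure.Build _ _ _ dm dm0 dm_ge0 dm_sigma_additive.

End density_measure.

Section kernel_density.
Context d1 d2 (X : measurableType d1) (Y : measurableType d2) (R : realType).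
Variable G : nat -> set Y.
Hypothesis detG : determining G.

(** A density of the two joint measures is disintegrated. Integrating over E x G n for all E
    identifies [k x (G n)] for almost all x; the null set is then common to all n, and the class [G]
    determines [k x]. *)
Lemma kernel_has_density (mu : probability X R) (k k' : R.-pker X ~> Y) :
  semidirect mu k `<< semidirect mu k' ->
  exists f : X * Y -> R, [/\ measurable_fun setT f, forall z, (0 <= f z)%R &
    {ae mu, forall x, has_density (k x) (k' x) (fun y => f (x, y))}].
Proof.
move=> /dominates_has_density[f [mf f0 fE]]; exists f; split => //.
have [mG [n0 Gn0] _ _] := detG.
have mfx x : measurable_fun setT (fun y => f (x, y)) by exact: measurableT_comp.
have kE n : {ae mu, forall x,
    k x (G n) = \int[k' x]_(y in G n) (f (x, y))%:E}.
  have mfG : measurable_fun setT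
      (fun z : X * Y => ((f z)%:E * (\1_(G n) z.2)%:E)).
    apply: emeasurable_funM; first exact/measurable_EFinP.
    apply/measurable_EFinP; apply: measurableT_comp => //.
  have mI : measurable_fun setT (fun x => \int[k' x]_(y in G n) (f (x, y))%:E).
    rewrite (_ : (fun x => _) =
        fun x => \int[k' x]_y ((f (x, y))%:E * (\1_(G n) y)%:E)).
      apply: (measurable_fun_integral_finite_kernel
        (fun z : X * Y => ((f z)%:E * (\1_(G n) z.2)%:E)) k') => //.
      by move=> z; rewrite -EFinM lee_fin mulr_ge0.
    apply/funext => x; rewrite integral_mkcond; apply: eq_integral => y _.
    by rewrite epatch_indic.
  have : ae_eq mu setT (k ^~ (G n)) (fun x => \int[k' x]_(y in G n) (f (x, y))%:E).
    apply: integral_ae_eq => //.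
      apply/integrableP; split; first exact: measurable_kernel.
      rewrite (@le_lt_trans _ _ (\int[mu]_x (cst 1 x)))//.
        apply: ge0_le_integral => //.
        - by apply: measurableT_comp => //; exact: measurable_kernel.
        - by move=> x _; rewrite gee0_abs// (probability_le1 (kat k x)).
      by rewrite integral_cst// mul1e [X in X < _](_ : _ = 1) ?ltry//;
        exact: (probability_setT mu).
    move=> E _ mE; rewrite -semidirect_rect// fE; last exact: measurableX.
    rewrite [LHS]integral_mkcond [LHS]integral_semidirect; first last.
    - by apply/(measurable_restrictT _ _).1; [exact: measurableX|
        apply/measurable_EFinP; exact: measurable_funTS].
    - by move=> z; rewrite erestrict_ge0// => z' _; rewrite lee_fin.
    rewrite [RHS]integral_mkcond; apply: eq_integral => x _.
    rewrite [RHS]patchE; case: ifPn => xE.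
      rewrite [RHS]integral_mkcond; apply: eq_integral => y _.
      rewrite !patchE; congr (if _ then _ else _).
      by apply/idP/idP => /set_mem; [move=> [_ ?]|move=> ?]; apply/mem_set => //;
        split => //; exact/set_mem.
    apply: integral0_eq => y _; rewrite patchE ifF//.
    by apply/negP => /set_mem [/= /mem_set]; rewrite (negbTE xE).
  by apply: filterS => x /(_ I).
apply: filterS (ae_foralln kE) => x {}kE; split => // F mF.
have mfE := (measurable_EFinP _ _).2 (mfx x).
have fE0 y : 0 <= (f (x, y))%:E by rewrite lee_fin.
apply: (@determining_eq _ _ _ G (k x) (density_measure (k' x) mfE fE0)) => //.
by rewrite (_ : k x setT = 1) ?ltry//; exact: prob_kernel.
Qed.

End kernel_density.

Section mixture.
Context d1 d2 (X : measurableType d1) (Y : measurableType d2) (R : realType).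
Variables k1 k2 : R.-pker X ~> Y.

(** The midpoint dominates both kernels, hence supplies a reference measure even when neither [k1 x]
    nor [k2 x] dominates the other. *)
Definition kmix (x : X) : {measure set Y -> \bar R} :=
  mscale (2^-1)%:nng%R (measure_add (k1 x) (k2 x)).

Lemma kmixE x U : kmix x U = (2^-1)%:E * (k1 x U + k2 x U).
Proof. by rewrite /kmix /= /mscale /= -(measure_addE (k1 x) (k2 x)). Qed.

Let mkmix U : measurable U -> measurable_fun [set: X] (kmix ^~ U).
Proof.
move=> mU; under eq_fun do rewrite kmixE.
by apply: measurable_funeM; apply: emeasurable_funD; exact: measurable_kernel.
Qed.

HB.instance Definition _ := isKernel.Build _ _ _ _ _ kmix mkmix.

Let kmixT x : kmix x setT = 1.
Proof. by rewrite kmixE !prob_kernel -EFinD -EFinM mulVf. Qed.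

HB.instance Definition _ := Kernel_isProbability.Build _ _ _ _ _ kmix kmixT.

Lemma semidirect_kmix_dominates (mu : probability X R) :
  semidirect mu k1 `<< semidirect mu kmix /\
  semidirect mu k2 `<< semidirect mu kmix.
Proof.
have le1 x U : (2^-1)%:E * k1 x U <= kmix x U.
  by rewrite kmixE lee_pmul2l// leeDl.
have le2 x U : (2^-1)%:E * k2 x U <= kmix x U.
  by rewrite kmixE lee_pmul2l// leeDr.
suff dom (k : R.-pker X ~> Y) : (forall x U, (2^-1)%:E * k x U <= kmix x U) ->
  semidirect mu k `<< semidirect mu kmix by split; apply: dom.
move=> lek; apply/null_content_dominatesP => F mF F0.
have mxs (l : R.-pker X ~> Y) : measurable_fun setT (fun x => l x (xsection F x)).
  by apply: measurable_fun_xsection_finite_kernel; rewrite inE.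
have : (2^-1)%:E * semidirect mu k F <= 0.
  rewrite -[leRHS]F0 -ge0_integralZl_EFin//.
  apply: ge0_le_integral => //.
  exact: measurable_funeM.
rewrite pmule_rle0// => h; apply/eqP.
by rewrite eq_le h measure_ge0.
Qed.

End mixture.

Lemma common_density d1 d2 (X : measurableType d1) (Y : measurableType d2)
    (R : realType) (G : nat -> set Y) (mu : probability X R)
    (k1 k2 : R.-pker X ~> Y) : determining G ->
  exists f1 f2 : X * Y -> R, [/\ measurable_fun setT f1, measurable_fun setT f2,
    forall z, (0 <= f1 z)%R, forall z, (0 <= f2 z)%R &
    {ae mu, forall x,
      has_density (k1 x) (kmix k1 k2 x) (fun y => f1 (x, y)) /\
      has_density (k2 x) (kmix k1 k2 x) (fun y => f2 (x, y))}].
Proof.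
move=> detG; have [dom1 dom2] := semidirect_kmix_dominates k1 k2 mu.
have [f1 [mf1 f10 f1d]] := kernel_has_density detG dom1.
have [f2 [mf2 f20 f2d]] := kernel_has_density detG dom2.
by exists f1, f2; split => //; apply: filterS2 f1d f2d.
Qed.

Section lower_integral.
Import HBNNSimple.

(* [f] and [g] need not be measurable, the integral being that from below. *)
Lemma ae_le_lower_integral d (T : measurableType d) (R : realType)
    (m : {measure set T -> \bar R}) (f g : T -> \bar R) :
  (forall x, 0 <= f x) -> (forall x, 0 <= g x) ->
  {ae m, forall x, f x <= g x} -> \int[m]_x f x <= \int[m]_x g x.
Proof.
move=> f0 g0 [N [mN N0 fgN]]; rewrite !ge0_integralTE//.
apply: ge_ereal_sup => _ [h /= hf <-].
(* Cutting [h] off on the null set gives a simple function below [g] everywhere, with the same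
   integral. *)
pose h' := mul_nnsfun h (indic_nnsfun R (measurableC mN)).
apply: (@le_trans _ _ (sintegral m h')); last first.
  apply: ereal_sup_ubound; exists h' => // x /=.
  rewrite /mindic indicE; case: (boolP (x \in ~` N)) => xN; last by rewrite mulr0.
  rewrite mulr1 (le_trans (hf x))//; move/set_mem: xN; apply: contra_notT => fg.
  by apply: fgN => /=; exact/negP.
rewrite -!integralT_nnsfun.
have mh (u : {nnsfun T >-> R}) : measurable_fun setT (EFin \o u).
  exact/measurable_EFinP.
have h0 (u : {nnsfun T >-> R}) x : setT x -> 0 <= (u x)%:E by rewrite lee_fin.
rewrite (ge0_negligible_integral mN measurableT (mh h) (h0 h))//.
rewrite [leRHS](ge0_negligible_integral mN measurableT (mh h') (h0 h'))//.
rewrite le_eqVlt; apply/orP; left; apply/eqP; apply: eq_integral => x.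
by rewrite inE => -[_ xN] /=; rewrite /mindic indicE mem_set// mulr1.
Qed.

Lemma ae_eq_lower_integral d (T : measurableType d) (R : realType)
    (m : {measure set T -> \bar R}) (f g : T -> \bar R) :
  (forall x, 0 <= f x) -> (forall x, 0 <= g x) ->
  {ae m, forall x, f x = g x} -> \int[m]_x f x = \int[m]_x g x.
Proof.
move=> f0 g0 fg; apply/eqP; rewrite eq_le; apply/andP; split;
  by apply: ae_le_lower_integral => //; apply: filterS fg => x ->.
Qed.

End lower_integral.

Section kl_kernels.
Context d2 (Y : measurableType d2) (R : realType) (G : nat -> set Y).
Hypothesis detG : determining G.

(** Where the jointly measurable densities are correct, [kl] is an integral of the logarithm of
    their ratio, or +oo if [k1 x] charges the zeros of [f2]. Both expressions, and the condition
    that separates them, are measurable in x. *)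
Lemma kl_ae_measurable d1 (X : measurableType d1) (mu : probability X R)
    (k1 k2 : R.-pker X ~> Y) :
  exists g : X -> \bar R, [/\ measurable_fun setT g, forall x, 0 <= g x &
    {ae mu, forall x, kl (kat k1 x) (kat k2 x) = g x}].
Proof.
have [f1 [f2 [mf1 mf2 f10 f20 fd]]] := common_density mu k1 k2 detG.
pose h z := rratio (f1 z) (f2 z).
have mh : measurable_fun setT h by exact: measurable_rratio.
have mlnh : measurable_fun setT (fun z => (ln (h z))%:E).
  by apply/measurable_EFinP; apply: (measurableT_comp (@measurable_ln R)).
pose N : set (X * Y) := [set z | (f2 z <= 0)%R].
have mN : measurable N by exact: measurable_le0_set.
have mkN : measurable_fun setT (fun x => k1 x (xsection N x)).
  by apply: measurable_fun_xsection_finite_kernel; rewrite inE.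
(* The maximum with 0 makes [g] nonnegative on the exceptional null set; elsewhere it changes
   nothing, by [kl_ge0]. *)
pose g x := if k1 x (xsection N x) == 0
  then maxe (\int[k1 x]_y (ln (h (x, y)))%:E) 0 else +oo.
exists g; split.
- apply: measurable_fun_ifT => //; first exact: measurable_fun_eqe.
  apply: measurable_maxe => //.
  under eq_fun do rewrite integralE.
  apply: emeasurable_funB.
  + rewrite (_ : (fun x => _) = fun x => \int[k1 x]_y
        ((fun z : X * Y => (ln (h z))%:E)^\+ (x, y))); last first.
      by apply/funext => x; apply: eq_integral => y _; rewrite !funeposE.
    apply: (measurable_fun_integral_finite_kernel
      ((fun z : X * Y => (ln (h z))%:E)^\+) k1) => //.
    exact: measurable_funepos.
  + rewrite (_ : (fun x => _) = fun x => \int[k1 x]_y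
        ((fun z : X * Y => (ln (h z))%:E)^\- (x, y))); last first.
      by apply/funext => x; apply: eq_integral => y _; rewrite !funenegE.
    apply: (measurable_fun_integral_finite_kernel
      ((fun z : X * Y => (ln (h z))%:E)^\-) k1) => //.
    exact: measurable_funeneg.
- by move=> x; rewrite /g; case: ifP => // _; rewrite le_max lexx orbT.
- apply: filterS fd => x [fd1 fd2]; rewrite /g.
  have NE : xsection N x = [set y | (f2 (x, y) <= 0)%R].
    by rewrite xsectionE.
  case: ifPn => [/eqP k1N|k1N].
    rewrite NE in k1N.
    have hd := @has_density_rratio _ _ _ (kat k1 x) (kat k2 x)
      (kat (kmix k1 k2) x) _ _ fd1 fd2 k1N.
    rewrite (kl_has_density hd).
    have := kl_ge0 (kat k1 x) (kat k2 x).
    by rewrite (kl_has_density hd) => klge0; apply/esym/max_idPl.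
  apply: kl_not_dominates => /null_content_dominatesP k12.
  move/eqP: k1N; apply; rewrite NE; apply: k12.
    by rewrite -NE; exact: measurable_xsection.
  exact: (@has_density_le0 _ _ _ (kat k2 x) (kat (kmix k1 k2) x) _ fd2).
Qed.

(** The change of variables is made on a measurable version [g]; its exceptional set, null for [mu],
    pulls back to a null set of [P]. *)
Lemma integral_kl_law d1 d (X : measurableType d1) (W : measurableType d)
    (P : probability W R) (f : W -> X) (mu : probability X R)
    (k1 k2 : R.-pker X ~> Y) :
  measurable_fun setT f -> has_law P f mu ->
  \int[P]_w kl (kat k1 (f w)) (kat k2 (f w)) =
  \int[mu]_x kl (kat k1 x) (kat k2 x).
Proof.
move=> mf law; have [g [mg g0 klg]] := kl_ae_measurable mu k1 k2.
rewrite (@ae_eq_lower_integral _ _ _ mu _ g)//; last by move=> x; exact: kl_ge0.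
rewrite (integral_law mf law)//; apply: ae_eq_lower_integral => //.
  by move=> w; exact: kl_ge0.
exact: (ae_law (p := fun x => kl (kat k1 x) (kat k2 x) = g x) mf law klg).
Qed.

(* Integrate [kl_three_points]: the ratio of the densities of [r] and [k] has
   expectation at most 1, since the average of [q] given [z] is [k]. *)
Lemma kl_cond_dist_min d d1 (W : measurableType d) (Z : measurableType d1)
    (P : probability W R) (z : {mfun W >-> Z}) (q : R.-pker W ~> Y)
    (k r : R.-pker Z ~> Y) :
  (forall E F, measurable E -> measurable F ->
    \int[P]_(w in z @^-1` E) q w F = \int[P]_(w in z @^-1` E) k (z w) F) ->
  \int[P]_w kl (kat q w) (kat k (z w)) <= \int[P]_w kl (kat q w) (kat r (z w)).
Proof.
move=> qk; pose nu : probability Z R := distribution P z.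
have lawz : has_law P z nu by move=> U mU.
have [s [t [ms mt s0 t0 std]]] := common_density nu k r detG.
have mz : measurable_fun setT z by [].
pose e (zy : Z * Y) := eratio (t zy) (s zy).
have me : measurable_fun setT e by exact: measurable_eratio.
have e0 zy : 0 <= e zy by exact: eratio_ge0.
have [g1 [mg1 g10 klg1]] := kl_ae_measurable P q (kreindex k z).
have [g2 [mg2 g20 klg2]] := kl_ae_measurable P q (kreindex r z).
have {}klg1 : {ae P, forall w, kl (kat q w) (kat k (z w)) = g1 w}.
  by apply: filterS klg1 => w <-; exact: eq_kl.
have {}klg2 : {ae P, forall w, kl (kat q w) (kat r (z w)) = g2 w}.
  by apply: filterS klg2 => w <-; exact: eq_kl.
rewrite (ae_eq_lower_integral (fun w => kl_ge0 _ _) g10 klg1).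
rewrite (ae_eq_lower_integral (fun w => kl_ge0 _ _) g20 klg2).
pose D w := \int[q w]_y e (z w, y).
have D0 w : 0 <= D w by exact: integral_ge0.
have mD : measurable_fun setT D.
  apply: (measurable_fun_integral_finite_kernel
    (fun wy : W * Y => e (z wy.1, wy.2)) q) => //.
  apply: measurableT_comp => //; apply/measurable_fun_pair => //.
  exact: measurableT_comp.
have D1 : \int[P]_w D w <= 1.
  rewrite /D -(integral_semidirect P q (f := fun wy : W * Y => e (z wy.1, wy.2)))//;
    last first.
    apply: measurableT_comp => //; apply/measurable_fun_pair => //.
    exact: measurableT_comp.
  pose zid (wy : W * Y) := (z wy.1, wy.2).
  have mzid : measurable_fun setT zid.
    by apply/measurable_fun_pair => //; exact: measurableT_comp.
  pose zidf : {mfun (W * Y)%type >-> (Z * Y)%type} := HB.pack zid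
    (isMeasurableFun.Build _ _ _ _ zid mzid).
  (* By [qk], the pair (z, y) with y drawn from [q] has law [semidirect nu k]. *)
  rewrite -(@integral_law _ _ _ _ _ (semidirect P q) zid (semidirect nu k) e)//;
    last first.
    move=> U mU; apply: (@rect_generate R _ _ _ _
      (distribution (semidirect P q) zidf) (semidirect nu k)) => //.
      by rewrite [X in X < _](_ : _ = 1) ?ltry//; exact: probability_setT.
    move=> E F mE mF; rewrite [RHS]semidirect_rect//.
    rewrite /distribution /pushforward /=.
    rewrite (_ : zid @^-1` (E `*` F) = (z @^-1` E) `*` F)//.
    rewrite semidirect_rect//; last exact: measurable_preimage.
    rewrite qk// ge0_integral_pushforward//.
    by apply: measurable_funTS; exact: measurable_kernel.
  rewrite integral_semidirect//.
  apply: (@le_trans _ _ (\int[nu]_x cst 1 x)); last first.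
    by rewrite integral_cst// mul1e [X in X <= _](_ : _ = 1)//;
      exact: (probability_setT nu).
  apply: ae_ge0_le_integral => //.
  - by move=> x _; exact: integral_ge0.
  - exact: (measurable_fun_integral_finite_kernel e k).
  apply: filterS std => x [sd td] _.
  have msx : measurable_fun setT (fun y => s (x, y)) by exact: measurableT_comp.
  have mtx : measurable_fun setT (fun y => t (x, y)) by exact: measurableT_comp.
  rewrite (@integral_has_density _ _ _ (kat k x) (kat (kmix k r) x) _ _ _ sd)//;
    last exact: measurableT_comp.
  (* The bound 1 is the total mass of [r x]: the ratio multiplied by the density [s] of [k x] is at
     most the density [t] of [r x]. *)
  have <- : \int[kmix k r x]_y (t (x, y))%:E = 1.
    case: td => _ _ <-//; exact: prob_kernel.
  apply: ge0_le_integral => //.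
  - by move=> y _; rewrite mule_ge0// lee_fin.
  - by apply: emeasurable_funM; [exact: measurableT_comp|exact/measurable_EFinP].
  - exact/measurable_EFinP.
  - move=> y _; rewrite /e /eratio; case: ifPn => sxy.
      have -> : s (x, y) = 0%R by apply/eqP; rewrite eq_le sxy s0.
      by rewrite mule0 lee_fin.
    rewrite -EFinM lee_fin expRNln ?ltNge//.
    rewrite -mulrA mulVf ?mulr1// gt_eqF// ltNge//.
have key : \int[P]_w g1 w + 1 <= \int[P]_w g2 w + \int[P]_w D w.
  rewrite -[X in _ + X <= _](_ : \int[P]_w cst 1 w = 1); last first.
    by rewrite integral_cst// mul1e; exact: (probability_setT P).
  rewrite -!ge0_integralD//.
  apply: ae_ge0_le_integral => //.
  - by move=> w _; rewrite adde_ge0.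
  - exact: emeasurable_funD.
  - by move=> w _; rewrite adde_ge0.
  - exact: emeasurable_funD.
  have std' := ae_law (p := fun x => _) mz lawz std.
  apply: filterS3 klg1 klg2 std' => w <- <- [sd td] _.
  exact: (@kl_three_points _ _ _ (kat q w) (kat k (z w)) (kat r (z w))
    (kat (kmix k r) (z w)) _ _ sd td).
rewrite -(@leeD2rE _ 1)//; apply: (le_trans key).
exact: leeD2l.
Qed.

End kl_kernels.

(** * Regular conditional distributions on Polish spaces *)

Section ternary_code.
Context {R : realType}.
Implicit Types (b : nat -> bool) (r : R).
Local Open Scope ring_scope.

(** Digits 0 and 1 in base 3: the digits after a given one contribute at most half of its weight, so
    that a comparison with 1/3 recovers each digit. Base 2 expansions would be ambiguous. *)
Definition ternary_sum b (n : nat) : R := \sum_(k < n) (b k)%:R * 3^-1 ^+ k.+1.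
Definition ternary b : R := limn (ternary_sum b).
Definition ternary_shift r : R := 3 * r - (3^-1 <= r)%R%:R.
Definition ternary_digit (n : nat) r : bool := 3^-1 <= iter n ternary_shift r.

Lemma ternary_sum_ge0 b n : 0 <= ternary_sum b n.
Proof. by apply: sumr_ge0 => k _; rewrite mulr_ge0// exprn_ge0. Qed.

Lemma ternary_sum_le b n : ternary_sum b n <= 2^-1 * (1 - 3^-1 ^+ n).
Proof.
elim: n => [|n IH]; first by rewrite /ternary_sum big_ord0 expr0 subrr mulr0.
rewrite /ternary_sum big_ord_recr/= -/(ternary_sum b n) exprS.
have e0 : 0 <= 3^-1 ^+ n :> R by rewrite exprn_ge0.
have : (b n)%:R * (3^-1 * 3^-1 ^+ n) <= 3^-1 * 3^-1 ^+ n :> R.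
  by case: (b n); rewrite ?mul1r// mul0r mulr_ge0.
move: (3^-1 ^+ n) e0 IH => e e0 IH; set f := _ * _ => fe.
lra.
Qed.

Lemma is_cvg_ternary_sum b : cvgn (ternary_sum b).
Proof.
apply: nondecreasing_is_cvgn.
  apply/nondecreasing_seqP => n.
  by rewrite {2}/ternary_sum big_ord_recr/= lerDl mulr_ge0// exprn_ge0.
exists 2^-1 => _ [n _ <-]; apply: (le_trans (ternary_sum_le b n)).
have e0 : 0 <= 3^-1 ^+ n :> R by rewrite exprn_ge0.
by move: (3^-1 ^+ n) e0 => e e0; lra.
Qed.

Lemma ternary_ge0 b : 0 <= ternary b.
Proof.
apply: limr_ge; first exact: is_cvg_ternary_sum.
by apply: nearW => n; exact: ternary_sum_ge0.
Qed.

Lemma ternary_le b : ternary b <= 2^-1.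
Proof.
apply: limr_le; first exact: is_cvg_ternary_sum.
apply: nearW => n; apply: (le_trans (ternary_sum_le b n)).
have e0 : 0 <= 3^-1 ^+ n :> R by rewrite exprn_ge0.
by move: (3^-1 ^+ n) e0 => e e0; lra.
Qed.

Lemma ternaryS b :
  ternary b = (b 0%N)%:R * 3^-1 + 3^-1 * ternary (fun n => b n.+1).
Proof.
apply/cvg_lim => //; rewrite -cvg_shiftS.
have -> : (fun n => ternary_sum b n.+1) = fun n => (b 0%N)%:R * 3^-1 +
    3^-1 * ternary_sum (fun n => b n.+1) n.
  apply/funext => n; rewrite /ternary_sum big_ord_recl/= expr1; congr (_ + _).
  rewrite mulr_sumr; apply: eq_bigr => i _.
  rewrite /bump/= add1n [RHS]mulrCA -exprS//.
apply: cvgD; first exact: cvg_cst.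
by apply: cvgMl_tmp; exact: is_cvg_ternary_sum.
Qed.

Lemma ternary_shiftE b : ternary_shift (ternary b) = ternary (fun n => b n.+1).
Proof.
have t0 := ternary_ge0 (fun n => b n.+1).
have t1 := ternary_le (fun n => b n.+1).
rewrite /ternary_shift ternaryS; case: (b 0%N); case: lerP => /= ?; lra.
Qed.

End ternary_code.

Section ternary_digits.
Context {R : realType}.
Local Open Scope ring_scope.

Lemma ternary_digitE b n : ternary_digit n (ternary b : R) = b n.
Proof.
have -> : ternary_digit n (ternary b : R) =
    (3^-1 <= ternary (fun k => b (n + k)%N) :> R).
  rewrite /ternary_digit; congr (_ <= _).
  elim: n => [|n IH] //=; rewrite IH ternary_shiftE; congr ternary.
  by apply/funext => k; rewrite addnS addSn.
rewrite ternaryS addn0.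
have t0 := @ternary_ge0 R (fun m => b (n + m.+1)%N).
have t1 := @ternary_le R (fun m => b (n + m.+1)%N).
by case: (b n); [apply/idP|apply/negP]; rewrite ?mul1r ?mul0r; [lra|move=> ?; lra].
Qed.

Lemma measurable_ternary_digit n :
  measurable_fun [set: R] (ternary_digit n : R -> bool).
Proof.
apply: measurable_fun_ler => //; elim: n => [|n IH] /=; first exact: measurable_id.
apply: (measurableT_comp (f := @ternary_shift R)) IH.
apply: measurable_funB; first exact: measurable_funM.
have -> : (fun r : R => (3^-1 <= r)%R%:R) =
    (fun r : R => if 3^-1 <= r then 1 else 0 : R).
  by apply/funext => r; case: (_ <= _).
by apply: measurable_fun_ifT => //; exact: measurable_fun_ler.
Qed.

Lemma measurable_ternary d (T : measurableType d) (b : T -> nat -> bool) :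
  (forall n, measurable_fun [set: T] (b ^~ n)) ->
  measurable_fun [set: T] (fun x => ternary (b x) : R).
Proof.
move=> mb; apply: (@measurable_fun_cvg _ _ _ _ (fun n x => ternary_sum (b x) n)).
  move=> n; rewrite /ternary_sum; apply: measurable_sum => k.
  apply: measurable_funM => //.
  have -> : (fun x => (b x k)%:R) =
      (fun x : T => if b x k then 1 else 0 : R).
    by apply/funext => x; case: (b x k).
  by apply: measurable_fun_ifT.
by move=> x _; exact: is_cvg_ternary_sum.
Qed.

End ternary_digits.

Section polish_retract.
Context {R : realType} (T : completePseudoMetricType R).
Hypothesis polishT : polish T.

Let e (j : nat) : R := (2^-1 ^+ j)%R.

Let e_gt0 j : (0 < e j)%R. Proof. by rewrite exprn_gt0. Qed.

Let eS j : e j = (2 * e j.+1)%R.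
Proof. by rewrite /e exprS mulrA divff// mul1r. Qed.

Let e_small (x : R) : (0 < x)%R -> \forall n \near \oo, (e n < x)%R.
Proof.
move=> x0; have : (fun n => e n) @ \oo --> (0%R : R).
  by apply: cvg_expr; rewrite ger0_norm ?invf_lt1 ?invr_ge0// ltr1n.
move/cvgrPdist_lt => /(_ _ x0); apply: filterS => n.
by rewrite sub0r normrN ger0_norm// ltW.
Qed.

Lemma polish_dense_seq : exists d : nat -> T,
  forall (O : set T), open O -> O !=set0 -> exists k, O (d k).
Proof.
have [_ [D /countable_injP[f finj] dD]] := polishT.
exists (fun k => xget point [set x | D x /\ f x = k]) => O oO O0.
have [x [Ox Dx]] := dD _ O0 oO.
exists (f x); case: xgetP => [y _ [Dy fyx]|/(_ x)]; last by case.
by rewrite (finj y x) ?inE.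
Qed.

(** [c] records in ternary digits which balls around a dense sequence contain x in their interior.
    [g] picks one recorded center at each scale and takes the limit of these centers. Only a left
    inverse is required, so the image of [c] need not be described. *)
Lemma polish_retract : exists (c : borel T -> R) (g : R -> borel T),
  [/\ measurable_fun setT c, measurable_fun setT g & cancel c g].
Proof.
have [hT _] := polishT; have [d dP] := polish_dense_seq.
(* The index codes a scale and a center. Interiors are taken because balls of a pseudometric need
   not be open. *)
pose V (n : nat) : set T := if (unpickle n : option (nat * nat)) is Some jk
  then (ball (d jk.2) (e jk.1))^° else set0.
have oV n : open (V n).
  by rewrite /V; case: unpickle => [jk|]; [exact: open_interior|exact: open0].
pose b (x : borel T) n := `[< V n x >].
have mb n : measurable_fun setT (b ^~ n).
  apply: (measurable_fun_bool true); rewrite setTI.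
  rewrite (_ : _ @^-1` _ = V n); first by apply: sub_sigma_algebra; exact: oV.
  by apply/seteqP; split => x /=; [move=> /asboolP|move=> ?; exact/asboolP].
pose c (x : borel T) : R := ternary (b x).
(* [y j r] is the first center of the sequence [d] whose ball of radius [2^-j]
   contains, according to the digits of [r], the point coded by [r]. *)
have mc : measurable_fun setT c by exact: measurable_ternary.
pose dig (j k : nat) (r : R) : bool := ternary_digit (pickle (j, k)) r.
have digE j k x : dig j k (c x) = `[< (ball (d k) (e j))^° x >].
  by rewrite /dig ternary_digitE /b /V pickleK.
pose K j r := xget 0%N [set k | dig j k r /\ forall k', (k' < k)%N -> ~~ dig j k' r].
have KP j r k : dig j k r -> dig j (K j r) r.
  move=> djk; rewrite /K; case: xgetP => [k' _ []//|].
  have ex : exists k, dig j k r by exists k.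
  move/(_ (ex_minn ex)); case: ex_minnP => m djm mmin []; split => // k' k'm.
  by apply: contraTN k'm => /mmin; rewrite leqNgt.
have mdig j k : measurable [set r | dig j k r].
  rewrite (_ : [set _ | _] = dig j k @^-1` [set true])//.
  by apply: measurable_preimage => //; exact: measurable_ternary_digit.
have mK j k : measurable [set r | K j r = k].
  (* The event [K j r = k] is [L k], enlarged for k = 0 by the set [N] of those r with no digit at
     scale j, because 0 is the default of [xget]. *)
  pose L k := [set r | dig j k r] `&`
    \bigcap_(k' in [set k' | (k' < k)%N]) ~` [set r | dig j k' r].
  have mL k' : measurable (L k').
    apply: measurableI => //; apply: bigcap_measurableType => i _.
    exact: measurableC.
  pose N := \bigcap_(k' in [set: nat]) ~` [set r | dig j k' r].
  have mN : measurable N by apply: bigcap_measurableType => i _; exact: measurableC.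
  have LK k' r : L k' r -> K j r = k'.
    move=> [djk' lek']; have [] : L (K j r) r; last first.
      move=> djK leK; case: (ltngtP (K j r) k') => // lt.
        by have := lek' _ lt.
      by have := leK _ lt.
    rewrite /K; case: xgetP => [m _ [? lem]|/(_ k')]; last first.
      by case; split => // m mk'; apply/negP; exact: lek'.
    by split => // m' m'm; apply/negP; exact: lem.
  have NK r : N r -> K j r = 0%N.
    by move=> Nr; rewrite /K; case: xgetP => // m _ [djm _]; have := Nr m I.
  have LN r : N r \/ L (K j r) r.
    have [[k' djk']|nd] := pselect (exists k', dig j k' r); last first.
      by left => m _ /= djm; apply: nd; exists m.
    right; rewrite /K; case: xgetP => [m _ [? lem]|].
      by split => // m' m'm; apply/negP; exact: lem.
    have ex : exists k, dig j k r by exists k'.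
    move/(_ (ex_minn ex)); case: ex_minnP => m djm mmin []; split => // l lm.
    by apply: contraTN lm => /mmin; rewrite leqNgt.
  have -> : [set r | K j r = k] = L k `|` (if k == 0%N then N else set0).
    apply/seteqP; split => r /=.
      move=> Kr; have [Nr|] := LN r; last by rewrite Kr; left.
      by right; rewrite -Kr (NK r).
    case=> [/LK//|]; case: eqP => // ->; exact: NK.
  by apply: measurableU => //; case: ifP.
pose y j r : T := d (K j r).
have my j (U : set T) : measurable [set r | U (y j r)].
  rewrite (_ : [set _ | _] = \bigcup_(k in [set k | U (d k)]) [set r | K j r = k]).
    by apply: bigcup_measurable => k _; exact: mK.
  by apply/seteqP; split => r /= => [Uy|[k /= Uk Kr]]; [exists (K j r)|rewrite /y Kr].
(* If r is the code of a point, consecutive centers lie within e_j + e_(j+1), hence within 2 e_j, of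
   each other; this summable bound forces convergence and is a measurable condition on r. *)
pose C := [set r | forall j, ball (y j r) (2 * e j)%R (y j.+1 r)].
have mC : measurable C.
  rewrite (_ : C = \bigcap_j \bigcup_k ([set r | K j r = k] `&`
      [set r | ball (d k) (2 * e j)%R (y j.+1 r)])).
    apply: bigcapT_measurable => j; apply: bigcupT_measurable => k.
    by apply: measurableI => //; exact: my.
  apply/seteqP; split => r /=.
    by move=> Cr j _; exists (K j r) => //; split => //; exact: Cr.
  by move=> Cr j; have [k _ [/= Kr]] := Cr j I; rewrite /y Kr.
have Ccvg r : C r -> cvg (y j r @[j --> \oo]).
  move=> Cr; apply: cauchy_cvg; apply: cauchy_exP => eps eps0.
  have [N _ Neps] : \forall n \near \oo, (e n < eps / 5)%R.
    by apply: e_small; rewrite divr_gt0.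
  exists (y N r); exists N => //= j /subnK <-.
  (* The steps 2 e_j from N to m + N - 1 add up to 4 e_N - 4 e_(m+N); a further e_N keeps the radius
     positive at m = 0. Hence the choice eps / 5. *)
  have H m : ball (y N r) (5 * e N - 4 * e (m + N)%N)%R (y (m + N)%N r).
    elim: m => [|m IH].
      by rewrite add0n; apply: ballxx; have := e_gt0 N; lra.
    apply: le_ball (ball_triangle IH (Cr _)).
    by rewrite addSn; have := eS (m + N); lra.
  apply: le_ball (H _); have := Neps N (leqnn N).
  by have := e_gt0 (j - N + N); lra.
pose g (r : R) : borel T := if `[< C r >] then lim (y j r @[j --> \oo]) else point.
exists c, g; split => //.
- apply: (measurability _ (erefl (measurable : set (set (borel T))))).
  move=> _ [U oU <-]; rewrite setTI.
  (* The limit lies in the open set [U] iff, for some m, the ball of radius 2^-m around [y j r]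
     stays in [U] for all large j. [U' m] may be any set, as [y j] takes countably many values. *)
  pose U' (m : nat) : set T := [set z | ball z (e m) `<=` U].
  have -> : g @^-1` U = (C `&` \bigcup_m \bigcup_N \bigcap_(j in [set j | (N <= j)%N])
      [set r | U' m (y j r)]) `|` (~` C `&` [set r | U point]).
    apply/seteqP; split => r /=; rewrite /g.
      case: asboolP => Cr Ur; [left|by right]; split => //.
      have /nbhs_ballP[eps /= eps0 epsU] := open_nbhs_nbhs (conj oU Ur).
      have [m _ meps] : \forall n \near \oo, (e n < eps / 2)%R.
        by apply: e_small; rewrite divr_gt0.
      have /cvg_ballP/(_ (eps / 2)%R) := Ccvg _ Cr.
      rewrite divr_gt0// => /(_ isT)[N _ Ny].
      exists m => //; exists N => // j /= Nj z yz; apply: epsU.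
      rewrite [eps]splitr; apply: ball_triangle (Ny _ Nj) _.
      by apply: le_ball yz; exact/ltW/meps/leqnn.
    case=> [[Cr [m _ [N _ Nm]]]|[nCr Up]]; last by case: asboolP.
    case: asboolP => // _.
    have /cvg_ballP/(_ (e m) (e_gt0 m))[N' _ N'y] := Ccvg _ Cr.
    apply: (Nm (maxn N N') (leq_maxl _ _)); apply: ball_sym.
    by apply: N'y => /=; exact: leq_maxr.
  apply: measurableU.
    apply: measurableI => //; apply: bigcupT_measurable => m.
    apply: bigcupT_measurable => N; apply: bigcap_measurableType => j _.
    exact: my.
  apply: measurableI; first exact: measurableC.
  have [Up|nUp] := pselect (U point).
    by rewrite (_ : [set _ | _] = setT)//; apply/seteqP; split.
  by rewrite (_ : [set _ | _] = set0)//; apply/seteqP; split.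
- move=> x.
  have yx j : ball (y j (c x)) (e j) x.
    (* A center within half the radius of x has x in the interior of its ball, so at least one digit
       of scale j is set. *)
    pose O := (ball x (e j / 2)%R)°.
    have xO : O x by apply: nbhsx_ballx; rewrite divr_gt0.
    have [k Ok] := dP O (@open_interior _ _) (ex_intro _ x xO).
    have djk : dig j k (c x).
      rewrite digE; apply/asboolP; apply/nbhs_ballP; exists (e j / 2)%R => /=.
        by rewrite divr_gt0.
      move=> z xz; rewrite [e j]splitr; apply: ball_triangle xz.
      by apply: ball_sym; exact: interior_subset Ok.
    have := KP _ _ _ djk; rewrite digE => /asboolP; exact: interior_subset.
  have Cx : C (c x).
    move=> j; apply: le_ball (ball_triangle (yx j) (ball_sym (yx j.+1))).
    by have := eS j; have := e_gt0 j.+1; lra.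
  rewrite /g; case: asboolP => // _; apply: cvg_lim => //.
  apply/cvg_ballP => eps eps0; have [N _ Neps] := e_small eps0.
  exists N => // j /= Nj; apply: ball_sym.
  by apply: le_ball (yx j); exact/ltW/Neps.
Qed.

End polish_retract.

Section determining_retract.
Context {R : realType}.

Definition rat_seq (n : nat) : R := ratr (odflt 0%Q (unpickle n)).

(** Index 0 is the whole space, as [determining] demands. The rays live in the extended reals
    because the quantiles below are infima of sets that may be empty or unbounded. *)
Definition ray (n : nat) : set (\bar R) :=
  if n is n'.+1 then [set y | y < (rat_seq n')%:E] else setT.

Lemma rat_seqP (q : rat) : exists n, rat_seq n = ratr q.
Proof. by exists (pickle q); rewrite /rat_seq pickleK. Qed.

Lemma ereal_lt_rat (y z : \bar R) : y < z -> exists n, y < (rat_seq n)%:E < z.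
Proof.
move=> yz; have [r /andP[yr rz]] : exists r : R, y < r%:E < z.
  move: y z yz => [y| |] [z| |]//=.
  - by rewrite lte_fin => yz; exists ((y + z) / 2)%R; rewrite !lte_fin; lra.
  - by move=> _; exists (y + 1)%R; rewrite lte_fin ltrDl ltr01 ltry.
  - by move=> _; exists (z - 1)%R; rewrite lte_fin ltNyr ltrBlDr ltrDl ltr01.
  - by move=> _; exists 0%R; rewrite ltNyr ltry.
have [s /andP[rs sz]] : exists s : R, (r%:E < s%:E < z).
  move: z {yz} rz => [z| |]//.
  - by rewrite lte_fin => yz; exists ((r + z) / 2)%R; rewrite !lte_fin; lra.
  - by move=> _; exists (r + 1)%R; rewrite lte_fin ltrDl ltr01 ltry.
have /rat_in_itvoo[q] : (r < s)%R by rewrite -lte_fin.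
rewrite in_itv/= => /andP[rq qs]; have [n nq] := rat_seqP q.
by exists n; rewrite nq (lt_trans yr) ?lte_fin//= (lt_trans _ sz)// lte_fin.
Qed.

Lemma measurable_ray n : measurable (ray n).
Proof.
case: n => [|n] //=; rewrite -[X in measurable X]setTI.
by apply: measurable_lte => //; exact: measurable_id.
Qed.

(** Since g inverts c, every measurable F is the preimage under [c] of the preimage of F under [g];
    and the sigma-algebra generated by [c] is already generated by preimages of rational rays. *)
Lemma retract_determining d (T : measurableType d) (c : T -> \bar R)
    (g : \bar R -> T) : measurable_fun setT c -> measurable_fun setT g ->
  cancel c g -> determining (fun n => c @^-1` ray n).
Proof.
move=> mc mg cg; split.
- by move=> n; apply: measurable_preimage => //; exact: measurable_ray.
- by exists 0%N.
- move=> _ _ [m _ <-] [n _ <-]; rewrite -preimage_setI.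
  suff [k ->] : exists k, ray m `&` ray n = ray k by exists k.
  case: m n => [|m] [|n]; [exists 0%N|exists n.+1|exists m.+1|]; rewrite ?setTI ?setIT//.
  case: (leP (rat_seq m) (rat_seq n)) => mn; [exists m.+1|exists n.+1];
    apply/seteqP; split => y /=; [by case| |by case|].
  + by move=> ym; split => //; rewrite (lt_le_trans ym).
  + by move=> ym; split => //; rewrite (lt_trans ym).
- move=> F mF; pose H := range (fun n => c @^-1` ray n).
  pose c' : g_sigma_algebraType H -> \bar R := c.
  have mc' : measurable_fun setT c'.
    apply: (measurability _ (ErealGenInftyO.measurableE R)) => _ [_ [r ->] <-].
    rewrite setTI.
    rewrite (_ : _ @^-1` _ = \bigcup_(n in [set n | (rat_seq n <= r)%R])
        (c @^-1` ray n.+1)).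
      apply: bigcup_measurable => n _; apply: sub_sigma_algebra.
      by exists n.+1.
    apply/seteqP; split => x /=.
      rewrite in_itv/= => /ereal_lt_rat[n /andP[xn nr]].
      by exists n => //=; rewrite -lee_fin ltW.
    by move=> [n /= nr xn]; rewrite in_itv/= (lt_le_trans xn)// lee_fin.
  have : measurable (c' @^-1` (g @^-1` F)).
    by apply: measurable_preimage => //; exact: measurable_preimage.
  by congr (<<s H >> _); apply/seteqP; split => x /=; rewrite /c' cg.
Qed.

End determining_retract.

Section density_order.
Context d (T : measurableType d) (R : realType).

(** On the set where f' < f the hypothesis forces equal integrals over all measurable parts, hence f
    = f' almost everywhere there, so this set is null. *)
Lemma ae_le_density (Q : probability T R) (f f' : T -> R) :
  measurable_fun setT f -> measurable_fun setT f' ->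
  (forall x, (0 <= f x)%R) -> (forall x, (0 <= f' x)%R) ->
  Q.-integrable setT (EFin \o f') ->
  (forall E, measurable E -> \int[Q]_(x in E) (f x)%:E <= \int[Q]_(x in E) (f' x)%:E) ->
  {ae Q, forall x, (f x <= f' x)%R}.
Proof.
move=> mf mf' f0 f0' intf' lef.
pose D := [set x | (f' x < f x)%R].
have mD : measurable D.
  rewrite (_ : D = ~` [set x | (f x <= f' x)%R]).
    apply: measurableC; rewrite -[X in measurable X]setTI.
    exact: measurable_fun_le.
  by apply/seteqP; split => x /=; rewrite /D/= ltNge => /negP.
have mF : measurable_fun setT (EFin \o f) by exact/measurable_EFinP.
have mF' : measurable_fun setT (EFin \o f') by exact/measurable_EFinP.
have intf'D : Q.-integrable D (EFin \o f') by exact: integrableS intf'.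
have : ae_eq Q D (EFin \o f') (EFin \o f).
  apply: integral_ae_eq => //; first exact: measurable_funTS.
  move=> E ED mE; apply/eqP; rewrite eq_le lef// andbT.
  apply: ge0_le_integral => //; try exact: measurable_funTS.
  - by move=> x _; rewrite lee_fin.
  - by move=> x /ED /ltW; rewrite lee_fin.
apply: filterS => x ff'; rewrite leNgt; apply/negP => xD.
by have [] := ff' xD => ff; move: xD; rewrite ff ltxx.
Qed.

End density_order.

Section restricted_law.
Context d d1 (W : measurableType d) (T1 : measurableType d1) (R : realType).
Variables (P : probability W R) (U : {mfun W >-> T1}) (D : set W).
Hypothesis mD : measurable D.

(** Its density relative to the law of [U] is the conditional probability of [D] given [U]. The
    proof argument carries the measure structure. *)
Definition restricted_law (_ : measurable D) (E : set T1) := P (U @^-1` E `&` D).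

Local Notation rl := (restricted_law mD).

Let rl0 : rl set0 = 0.
Proof. by rewrite /restricted_law preimage_set0 set0I. Qed.

Let rl_ge0 E : 0 <= rl E. Proof. exact: measure_ge0. Qed.

Let rl_sigma_additive : semi_sigma_additive rl.
Proof.
move=> F mF tF mUF; rewrite /restricted_law preimage_bigcup setI_bigcupl.
apply: measure_semi_sigma_additive.
- by move=> n; apply: measurableI => //; exact: measurable_preimage.
- apply/trivIsetP => /= i j _ _ ij; rewrite setIACA setIid -preimage_setI.
  by move/trivIsetP : tF => /(_ _ _ _ _ ij) ->//; rewrite preimage_set0 set0I.
- rewrite -setI_bigcupl -preimage_bigcup; apply: measurableI => //.
  exact: measurable_preimage.
Qed.

HB.instance Definition _ := isMeasure.Build _ _ _ rl rl0 rl_ge0 rl_sigma_additive.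

Let rl_fin : fin_num_fun rl.
Proof.
move=> E mE; apply: fin_num_measure; apply: measurableI => //.
exact: measurable_preimage.
Qed.

HB.instance Definition _ := Measure_isFinite.Build _ _ _ rl rl_fin.

Lemma restricted_law_density :
  exists f : T1 -> R, has_density rl (distribution P U) f.
Proof.
apply: dominates_has_density; apply/null_content_dominatesP => E mE E0.
apply: (subset_measure0 (B := U @^-1` E)) => //.
- by apply: measurableI => //; exact: measurable_preimage.
- exact: measurable_preimage.
Qed.

End restricted_law.

Section random_map_kernel.
Context d1 d2 d3 (X : measurableType d1) (S : measurableType d2)
  (Y : measurableType d3) (R : realType).
Variables (la : probability S R) (f : X * S -> Y).
Hypothesis mf : measurable_fun [set: X * S] f.

(** The law of f (x, s) for s drawn from [la]; with a quantile function and a uniform [la], this is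
    inverse transform sampling. *)
Definition random_map_kernel (_ : measurable_fun [set: X * S] f) (x : X)
    (V : set Y) : \bar R := la [set s | V (f (x, s))].

Local Notation k := (random_map_kernel mf).

Let mfx x : measurable_fun setT (fun s => f (x, s)).
Proof. exact: measurableT_comp. Qed.

Let k0 x : k x set0 = 0. Proof. exact: measure0. Qed.

Let k_ge0 x V : 0 <= k x V. Proof. exact: measure_ge0. Qed.

Let k_sigma_additive x : semi_sigma_additive (k x).
Proof.
move=> V mV tV mUV; rewrite /random_map_kernel.
have -> : [set s | (\bigcup_n V n) (f (x, s))] = \bigcup_n [set s | V n (f (x, s))].
  by [].
apply: measure_semi_sigma_additive.
- by move=> n; exact: (measurable_preimage (mfx x)).
- apply/trivIsetP => /= i j _ _ ij; rewrite -[LHS]preimage_setI.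
  by move/trivIsetP : tV => /(_ _ _ _ _ ij) ->//; rewrite preimage_set0.
- exact: (measurable_preimage (mfx x) mUV).
Qed.

HB.instance Definition _ x := isMeasure.Build _ _ _ (k x) (k0 x) (k_ge0 x)
  (@k_sigma_additive x).

Definition mrandom_map_kernel : X -> {measure set Y -> \bar R} := k.

Let mk V : measurable V -> measurable_fun [set: X] (mrandom_map_kernel ^~ V).
Proof.
move=> mV; have mfV : measurable (f @^-1` V) by exact: measurable_preimage.
rewrite (_ : _ ^~ V = fun x => la (xsection (f @^-1` V) x)).
  exact: measurable_fun_xsection.
by apply/funext => x; rewrite xsectionE.
Qed.

HB.instance Definition _ := isKernel.Build _ _ _ _ _ mrandom_map_kernel mk.

Let kT x : mrandom_map_kernel x setT = 1.
Proof. exact: probability_setT. Qed.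

HB.instance Definition _ := Kernel_isProbability.Build _ _ _ _ _
  mrandom_map_kernel kT.

End random_map_kernel.

Lemma uniform_ray (R : realType) (y : R) : (0 <= y <= 1)%R ->
  uniform_prob (@ltr01 R) [set u | (u < y)%R] = y%:E.
Proof.
move=> /andP[y0 y1]; rewrite /uniform_prob integral_uniform_pdf.
rewrite (_ : _ `&` _ = `[0%R, y[%classic); last first.
  apply/seteqP; split => u /=; rewrite !in_itv/=.
    by move=> [-> /andP[-> _]].
  by move=> /andP[-> uy]; split => //; rewrite (le_trans (ltW uy)).
rewrite (eq_integral (cst 1)).
  rewrite integral_cst//= mul1e.
  apply: (etrans (lebesgue_measure_itv `[0%R, y[)); rewrite /= lte_fin.
  by case: ltP => [|yle0]; rewrite ?sube0//; congr EFin; apply/eqP; rewrite eq_le y0.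
move=> u /set_mem /=; rewrite in_itv/= => /andP[u0 uy].
by rewrite /uniform_pdf u0 (le_trans (ltW uy))//= subr0 invr1.
Qed.

Section ereal_cond_dist.
Context d d1 (W : measurableType d) (T1 : measurableType d1) (R : realType).
Variables (P : probability W R) (U : {mfun W >-> T1}) (v : {mfun W >-> \bar R}).

Let P1 : probability T1 R := distribution P U.

Let mv n : measurable (v @^-1` ray n).
Proof. by apply: measurable_preimage => //; exact: measurable_ray. Qed.

(** The kernel is the law of a quantile function at a uniform variable. It gives the ray below a
    rational the supremum of the conditional distribution function over smaller rationals, and
    continuity from below of [P] shows that this is the right mass after integration over E. *)
Lemma ereal_cond_dist_exists : exists k : R.-pker T1 ~> \bar R, is_cond_dist P U v k.
Proof.
pose rl n := restricted_law P U (mv n.+1).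
have /choice[f fd] : forall n, exists f, has_density (rl n) P1 f.
  by move=> n; exact: restricted_law_density.
have mf n : measurable_fun setT (f n) by case: (fd n).
have f0 n x : (0 <= f n x)%R by case: (fd n).
have fE n E : measurable E ->
    P (U @^-1` E `&` v @^-1` ray n.+1) = \int[P1]_(x in E) (f n x)%:E.
  by case: (fd n) => _ _; exact.
have fint n : P1.-integrable setT (EFin \o f n).
  apply/integrableP; split; first exact/measurable_EFinP.
  under eq_integral do rewrite gee0_abs ?lee_fin//.
  rewrite -fE// (le_lt_trans (probability_le1 P _)) ?ltry//.
  by apply: measurableI => //; exact: measurable_preimage.
pose S := measurableTypeR R.
(* [f n x] is [P(v < rat_seq n | U = x)], and [quant (x, _)] is the quantile
   function of that distribution function. *)
pose quant (z : T1 * S) : \bar R :=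
  ereal_inf [set (rat_seq n)%:E | n in [set n | (z.2 < f n z.1)%R]].
have quantE z t : quant z < t <-> exists n, (z.2 < f n z.1)%R /\ (rat_seq n)%:E < t.
  split; first by move=> /ereal_inf_lt[_ [n zn <-] nt]; exists n.
  move=> [n [zn nt]]; apply: le_lt_trans nt; apply: ereal_inf_lbound.
  by exists n.
have mquant : measurable_fun setT quant.
  apply: (measurability _ (ErealGenInftyO.measurableE R)) => _ [_ [r ->] <-].
  rewrite setTI (_ : _ @^-1` _ = \bigcup_(n in [set n | (rat_seq n < r)%R])
      [set z : T1 * S | (z.2 < f n z.1)%R]).
    apply: bigcup_measurable => n _.
    rewrite (_ : [set _ | _] = (fun z : T1 * S => (z.2 < f n z.1)%R) @^-1` [set true])//.
    apply: measurable_preimage => //; apply: measurable_fun_ltr.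
      exact: measurable_snd.
    exact: measurableT_comp.
  apply/seteqP; split => z /=; rewrite in_itv/=.
    by move/quantE => [n [zn nr]]; exists n.
  by move=> [n nr zn]; apply/quantE; exists n.
pose la : probability S R := uniform_prob (@ltr01 R).
pose k : R.-pker T1 ~> \bar R := mrandom_map_kernel la mquant.
exists k => E F mE mF.
have detR : determining (@ray R).
  by apply: (@retract_determining R _ _ id id) => //; exact: measurable_id.
(* For fixed E, both sides of the defining identity are finite measures in F: [m1] and [m2]. They
   are compared on rays. *)
pose m1 := restricted_law P v (measurable_preimage (@measurable_funPT _ _ _ _ U) mE).
pose sndf : {mfun (T1 * \bar R)%type >-> \bar R} := HB.pack (@snd T1 (\bar R))
  (isMeasurableFun.Build _ _ _ _ (@snd T1 (\bar R)) measurable_snd).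
have mET : measurable (E `*` [set: \bar R]) by exact: measurableX.
pose m2 := restricted_law (semidirect P1 k) sndf mET.
have m2E V : measurable V -> m2 V = \int[P1]_(x in E) k x V.
  move=> mV; apply: (etrans _ (semidirect_rect P1 k mE mV)); congr (semidirect P1 k _).
  by apply/seteqP; split => -[x y] /=; tauto.
rewrite (_ : \int[P]_(w in U @^-1` E) k (U w) F = m2 F); last first.
  rewrite m2E// ge0_integral_pushforward//.
  by apply: measurable_funTS; exact: measurable_kernel.
rewrite setIC -[LHS]/(m1 F).
apply: (determining_eq (m1 := m1) (m2 := m2) detR) => //.
  rewrite (le_lt_trans (probability_le1 P _)) ?ltry//.
  by apply: measurableI; exact: measurable_preimage.
case=> [|n].
  apply: (etrans _ (esym (m2E _ (measurable_ray _)))).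
  rewrite -[LHS]/(P (v @^-1` setT `&` U @^-1` E)) preimage_setT setTI.
  rewrite (eq_integral (cst 1)); last by move=> x _; rewrite prob_kernel.
  by rewrite integral_cst// mul1e.
pose q := odflt 0%Q (unpickle n).
(* Indices of rationals increasing strictly to [rat_seq n]; they turn the supremum over all smaller
   rationals into a monotone limit. *)
pose idx (j : nat) := pickle (q - j.+1%:R^-1)%R.
have idxE j : rat_seq (idx j) = (rat_seq n - j.+1%:R^-1)%R :> R.
  by rewrite /rat_seq pickleK/= rmorphB/= fmorphV/= rmorph_nat.
have idx_le i j : (i <= j)%N -> (rat_seq (idx i) <= rat_seq (idx j) :> R)%R.
  move=> ij; rewrite !idxE lerD2l lerN2 lef_pV2 ?posrE ?ltr0Sn//.
  by rewrite ler_nat.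
have idx_sup (m : nat) : (rat_seq m < rat_seq n :> R)%R ->
    exists j, (rat_seq m <= rat_seq (idx j) :> R)%R.
  rewrite -subr_gt0 => mn0.
  have [N _ HN] := near_infty_natSinv_lt (PosNum mn0).
  exists N; rewrite idxE lerBrDr -lerBrDl; exact/ltW/HN/leqnn.
(* Each [f n] is fixed only up to a null set, so the bound by 1 and the monotonicity hold off a
   single null set, which is removed from the integrals. *)
have good : {ae P1, forall x, forall j,
    (f (idx j) x <= 1)%R /\ forall m, (rat_seq m <= rat_seq (idx j) :> R)%R ->
      (f m x <= f (idx j) x)%R}.
  apply: ae_foralln => j; near=> x; split.
    near: x; apply: (@ae_le_density _ _ _ _ (f (idx j)) (cst 1%R)) => //.
      exact: finite_measure_integrable_cst.
    move=> E' mE'; rewrite -fE// (eq_integral (cst 1))// integral_cst// mul1e.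
    by apply: le_measure; rewrite ?inE//; [apply: measurableI|]; rewrite ?mv//;
      exact: measurable_preimage.
  near: x; apply: ae_foralln => m.
  have [mj|mj] := boolP (rat_seq m <= rat_seq (idx j) :> R)%R; last by apply: aeW.
  have : {ae P1, forall x, (f m x <= f (idx j) x)%R}.
    apply: ae_le_density => // E' mE'; rewrite -!fE//.
    apply: le_measure; rewrite ?inE//; try by apply: measurableI => //;
      exact: measurable_preimage.
    move=> w [? vm]; split => //; rewrite /= in vm *.
    by rewrite (lt_le_trans vm)// lee_fin.
  by apply: filterS => x.
have [N [mN N0 goodN]] := good.
have {}goodN x : (~` N) x -> forall j, (f (idx j) x <= 1)%R /\
    forall m, (rat_seq m <= rat_seq (idx j) :> R)%R -> (f m x <= f (idx j) x)%R.
  by move=> Nx; apply: contrapT => /goodN.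
have kE x : (~` N) x -> k x (ray n.+1) = limn (fun j => (f (idx j) x)%:E).
  move=> Nx; pose B j := [set u : S | (u < f (idx j) x)%R].
  have mB j : measurable (B j).
    rewrite (_ : B j = `]-oo, f (idx j) x[%classic); first exact: measurable_itv.
    by apply/seteqP; split => u /=; rewrite in_itv.
  have -> : k x (ray n.+1) = la (\bigcup_j B j).
    congr (la _); apply/seteqP; split => u /=.
      move=> /quantE[m /= [um]]; rewrite lte_fin => /idx_sup[j mj].
      by exists j => //; rewrite /B/= (lt_le_trans um)//; exact: (goodN x Nx j).2.
    move=> [j _ uj]; apply/quantE; exists (idx j); split => //.
    by rewrite lte_fin idxE ltrBlDr ltrDl invr_gt0 ltr0Sn.
  apply/esym/cvg_lim => //.
  have laB j : (f (idx j) x)%:E = la (B j).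
    by rewrite /la/= uniform_ray// f0; case: (goodN x Nx j).
  under eq_cvg do rewrite laB.
  apply: nondecreasing_cvg_mu => //; first exact: bigcup_measurable.
  move=> i j ij; apply/subsetPset => u; rewrite /B/= => ui.
  by rewrite (lt_le_trans ui)//; apply: (goodN x Nx j).2; exact: idx_le.
have limE : (\int[P1]_(x in E) (f (idx j) x)%:E @[j --> \oo] -->
    \int[P1]_(x in E) k x (ray n.+1)).
  have mkr : measurable_fun setT (fun x => k x (ray n.+1)).
    by apply: measurable_kernel; exact: measurable_ray.
  rewrite (ge0_negligible_integral mN mE (measurable_funTS mkr))//.
  rewrite (eq_integral (fun x => limn (fun j => (f (idx j) x)%:E))); last first.
    by move=> x /set_mem [_ Nx]; exact: kE.
  rewrite (_ : (fun j => _) = fun j => \int[P1]_(x in E `\` N) (f (idx j) x)%:E).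
    apply: cvg_monotone_convergence.
    - exact: measurableD.
    - by move=> j; apply/measurable_EFinP; exact: measurable_funTS.
    - by move=> j x _; rewrite lee_fin.
    - move=> x [_ Nx] i j ij; rewrite lee_fin; apply: (goodN x Nx j).2.
      exact: idx_le.
  apply/funext => j; rewrite (ge0_negligible_integral mN)//.
  - by apply/measurable_EFinP; exact: measurable_funTS.
  - by move=> x _; rewrite lee_fin.
apply: (etrans _ (esym (m2E _ (measurable_ray _)))).
rewrite -(cvg_lim _ limE)//.
have m1E : m1 (ray n.+1) = P (\bigcup_j (U @^-1` E `&` v @^-1` ray (idx j).+1)).
  congr (P _); apply/seteqP; split => w /=.
    move=> [+ Ew] => /ereal_lt_rat[m /andP[vm]]; rewrite lte_fin => /idx_sup[j mj].
    by exists j => //; split => //=; rewrite (lt_le_trans vm)// lee_fin.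
  move=> [j _ [Ew vj]]; split => //; rewrite /= in vj *.
  by rewrite (lt_trans vj)// lte_fin idxE ltrBlDr ltrDl invr_gt0 ltr0Sn.
have mEv j : measurable (U @^-1` E `&` v @^-1` ray (idx j).+1).
  by apply: measurableI => //; exact: measurable_preimage.
apply: (etrans m1E); apply/esym/cvg_lim => //.
under eq_cvg do rewrite -fE//.
apply: nondecreasing_cvg_mu => //; first exact: bigcup_measurable.
move=> i j ij; apply/subsetPset => w [Ew vi]; split => //; rewrite /= in vi *.
by rewrite (lt_le_trans vi)// lee_fin idx_le.
Unshelve. all: by end_near.
Qed.

End ereal_cond_dist.

Section image_kernel.
Context d1 d2 d3 (X : measurableType d1) (Y : measurableType d2)
  (Z : measurableType d3) (R : realType).
Variables (k : R.-pker X ~> Y) (f : {mfun Y >-> Z}).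

Definition kimage (x : X) : {measure set Z -> \bar R} := distribution (kat k x) f.

Let mkimage V : measurable V -> measurable_fun [set: X] (kimage ^~ V).
Proof.
move=> mV; rewrite (_ : kimage ^~ V = k ^~ (f @^-1` V))//.
by apply: measurable_kernel; exact: measurable_preimage.
Qed.

HB.instance Definition _ := isKernel.Build _ _ _ _ _ kimage mkimage.

Let kimageT x : kimage x setT = 1. Proof. exact: prob_kernel. Qed.

HB.instance Definition _ := Kernel_isProbability.Build _ _ _ _ _ kimage kimageT.

End image_kernel.

Section polish_kernels.
Context {R : realType} (T : completePseudoMetricType R).
Hypothesis polishT : polish T.

Lemma polish_ereal_retract : exists (c : borel T -> \bar R) (g : \bar R -> borel T),
  [/\ measurable_fun setT c, measurable_fun setT g & cancel c g].
Proof.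
have [c [g [mc mg cg]]] := polish_retract polishT.
exists (EFin \o c), (g \o fine); split; last by move=> x /=; rewrite cg.
- exact/measurable_EFinP.
- exact: measurableT_comp.
Qed.

Lemma polish_determining : exists G : nat -> set (borel T), determining G.
Proof.
have [c [g [mc mg cg]]] := polish_ereal_retract.
by eexists; exact: retract_determining mc mg cg.
Qed.

(** The conditional distribution of [c \o V] on the extended reals is pushed forward by [g]; as g
    inverts c, this is a conditional distribution of [V]. *)
Lemma polish_cond_dist d d1 (W : measurableType d) (T1 : measurableType d1)
    (P : probability W R) (U : W -> T1) (V : W -> borel T) :
  measurable_fun setT U -> measurable_fun setT V ->
  is_cond_dist P U V (cond_dist P U V).
Proof.
move=> mU mV; suff ex : exists k, is_cond_dist P U V k.
  by rewrite /cond_dist; case: pselect => // ex'; exact: projT2 (cid ex').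
have [c [g [mc mg cg]]] := polish_ereal_retract.
pose Uf : {mfun W >-> T1} := HB.pack U (isMeasurableFun.Build _ _ _ _ U mU).
have mcV : measurable_fun setT (c \o V) by exact: measurableT_comp.
pose cV : {mfun W >-> \bar R} := HB.pack (c \o V)
  (isMeasurableFun.Build _ _ _ _ (c \o V) mcV).
pose gf : {mfun \bar R >-> borel T} := HB.pack g
  (isMeasurableFun.Build _ _ _ _ g mg).
have [k kP] := ereal_cond_dist_exists P Uf cV.
exists (kimage k gf) => E F mE mF.
rewrite -(kP E (g @^-1` F))//; last exact: measurable_preimage.
congr (P (_ `&` _)); apply/seteqP; split => w /=; rewrite cg//.
Qed.

End polish_kernels.

Lemma cond_distP d d1 d2 (W : measurableType d) (T1 : measurableType d1)
    (T2 : measurableType d2) (R : realType) (P : probability W R)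
    (U : W -> T1) (V : W -> T2) k :
  is_cond_dist P U V k -> is_cond_dist P U V (cond_dist P U V).
Proof.
move=> kP; rewrite /cond_dist; case: pselect => [ex|[]]; last by exists k.
exact: projT2 (cid ex).
Qed.

Section cond_dist_theory.
Context d d1 d2 (W : measurableType d) (T1 : measurableType d1)
    (T2 : measurableType d2) (R : realType) (P : probability W R)
    (U : {mfun W >-> T1}).

Lemma is_cond_distE (V : W -> T2) (k : R.-pker T1 ~> T2) E F :
  is_cond_dist P U V k -> measurable E -> measurable F ->
  P (U @^-1` E `&` V @^-1` F) = \int[distribution P U]_(x in E) k x F.
Proof.
move=> kP mE mF; rewrite kP// ge0_integral_pushforward//.
by apply: measurable_funTS; exact: measurable_kernel.
Qed.

Lemma is_cond_dist_law (V : W -> T2) (k : R.-pker T1 ~> T2) :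
  measurable_fun setT V -> is_cond_dist P U V k ->
  has_law P (fun w => (U w, V w)) (semidirect (distribution P U) k).
Proof.
move=> mV kP; have mUV : measurable_fun setT (fun w => (U w, V w)).
  by apply/measurable_fun_pair.
pose UV : {mfun W >-> (T1 * T2)%type} := HB.pack (fun w => (U w, V w))
  (isMeasurableFun.Build _ _ _ _ _ mUV).
apply: (@rect_generate R _ _ _ _ (distribution P UV)
  (semidirect (distribution P U) k)).
  rewrite [X in X < _](_ : _ = 1) ?ltry//.
  exact: (probability_setT (distribution P UV)).
move=> E F mE mF; rewrite [RHS]semidirect_rect// -(is_cond_distE kP)//.
Qed.

(** The determining class puts the quantifier over F inside the almost-everywhere statement, as
    [eq_kl] requires. *)
Lemma ae_cond_dist_unique (G : nat -> set T2) (V : W -> T2)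
    (k k' : R.-pker T1 ~> T2) : determining G ->
  is_cond_dist P U V k -> is_cond_dist P U V k' ->
  {ae P, forall w, forall F, measurable F -> k (U w) F = k' (U w) F}.
Proof.
move=> detG kP k'P; have [mG _ _ _] := detG.
have kk' n : {ae distribution P U, forall x, k x (G n) = k' x (G n)}.
  have : ae_eq (distribution P U) setT (k ^~ (G n)) (k' ^~ (G n)).
    apply: integral_ae_eq => //.
    - apply/integrableP; split; first exact: measurable_kernel.
      rewrite (@le_lt_trans _ _ (\int[distribution P U]_x (cst 1 x)))//.
        apply: ge0_le_integral => //.
        - by apply: measurableT_comp => //; exact: measurable_kernel.
        - by move=> x _; rewrite gee0_abs// (probability_le1 (kat k x)).
      by rewrite integral_cst// mul1e [X in X < _](_ : _ = 1) ?ltry//;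
        exact: (probability_setT (distribution P U)).
    - exact: measurable_kernel.
    - by move=> E _ mE; rewrite -(is_cond_distE kP)// -(is_cond_distE k'P).
  by apply: filterS => x /(_ I).
have {}kk' : {ae distribution P U, forall x, forall n, k x (G n) = k' x (G n)}.
  exact: ae_foralln.
have mU : measurable_fun setT U by [].
have lawU : has_law P U (distribution P U) by [].
have := ae_law (p := fun x => forall n, k x (G n) = k' x (G n)) mU lawU kk'.
apply: filterS => w kkw; apply: (determining_eq detG) => //.
by rewrite (_ : k (U w) setT = 1) ?ltry//; exact: prob_kernel.
Qed.

End cond_dist_theory.

(** * Laws of trajectories *)

Section extend_theory.
Context {R : realType} {I : eqType} (X : I -> completePseudoMetricType R).

Lemma extend_eq (D D' : pred I) i (DD' : forall j, D' j -> j != i -> D j)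
    (x : traj X D) (y : borel (X i)) (D'i : D' i) :
  Defs.coord D'i (extend DD' x y) = y.
Proof.
rewrite /Defs.coord /extend /=; case: eqVneq => [e|ne]; last by exfalso; move: (ne); rewrite eqxx.
(* Proofs of equality in an [eqType] are unique, so the cast is trivial. *)
by rewrite (eq_irrelevance e erefl).
Qed.

Lemma extend_neq (D D' : pred I) i (DD' : forall j, D' j -> j != i -> D j)
    (x : traj X D) (y : borel (X i)) (j : {j | D' j}) (Dj : D (val j)) :
  val j != i -> extend DD' x y j = x (exist _ (val j) Dj).
Proof.
move=> ji; rewrite /extend; case: eqVneq => [e|ne]; first by rewrite e eqxx in ji.
by congr (x (exist _ _ _)); exact: bool_irrelevance.
Qed.

Lemma restr_comp (D D' D'' : pred I) (DD' : forall j, D' j -> D j)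
    (D'D'' : forall j, D'' j -> D' j) (DD'' : forall j, D'' j -> D j)
    (x : traj X D) : restr D'D'' (restr DD' x) = restr DD'' x.
Proof.
by apply: functional_extensionality_dep => j; rewrite /restr /=;
  congr (x (exist _ _ _)); exact: bool_irrelevance.
Qed.

Lemma restr_id (D : pred I) (DD : forall j, D j -> D j) (x : traj X D) :
  restr DD x = x.
Proof.
apply: functional_extensionality_dep => -[j Dj]; rewrite /restr /=.
by congr (x (exist _ _ _)); exact: bool_irrelevance.
Qed.

End extend_theory.

Section history.
Context {R : realType} (A : nat -> completePseudoMetricType R)
  (B : int -> completePseudoMetricType R).

Lemma pastB_snoc i (x : hist A B i * borel (A i) * borel (B i)) :
  pastB (snoc x) = x.1.1.2.
Proof.
apply: functional_extensionality_dep => -[j Dj]; rewrite /pastB /past_outs /restr /=.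
rewrite (@extend_neq _ _ _ _ _ _ _ _ _ _ Dj)//=.
by rewrite lt_eqF.
Qed.

Lemma lastA_snoc i (x : hist A B i * borel (A i) * borel (B i)) :
  lastA (snoc x) = x.1.2.
Proof. exact: extend_eq. Qed.

Lemma lastB_snoc i (x : hist A B i * borel (A i) * borel (B i)) :
  lastB (snoc x) = x.2.
Proof. exact: extend_eq. Qed.

Definition hprev i (w : hist A B i.+1) : hist A B i :=
  (restr (@ins_restr_subproof i i.+1 (leqnSn i)) w.1, pastB w).

Lemma hprev_snoc i (x : hist A B i * borel (A i) * borel (B i)) :
  hprev (snoc x) = x.1.1.
Proof.
rewrite /hprev pastB_snoc [RHS]surjective_pairing; congr pair.
apply: functional_extensionality_dep => -[j Dj]; rewrite /restr /=.
rewrite (@extend_neq _ _ _ _ _ _ _ _ _ _ Dj)//=.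
by rewrite ltn_eqF.
Qed.

Lemma measurable_hprev i : measurable_fun [set: hist A B i.+1] (@hprev i).
Proof.
apply/measurable_fun_pair; last exact: measurable_pastB.
by apply: (measurableT_comp (f := restr _)) => //; exact: measurable_restr.
Qed.

HB.instance Definition _ i :=
  isMeasurableFun.Build _ _ _ _ (@hprev i) (@measurable_hprev i).
HB.instance Definition _ i :=
  isMeasurableFun.Build _ _ _ _ (@pastB R A B i) (@measurable_pastB R A B i).
HB.instance Definition _ i :=
  isMeasurableFun.Build _ _ _ _ (@lastA R A B i) (@measurable_lastA R A B i).
HB.instance Definition _ i :=
  isMeasurableFun.Build _ _ _ _ (@lastB R A B i) (@measurable_lastB R A B i).

End history.

HB.instance Definition _ d1 d2 (X : measurableType d1) (Y : measurableType d2) :=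
  isMeasurableFun.Build _ _ _ _ (@fst X Y) measurable_fst.
HB.instance Definition _ d1 d2 (X : measurableType d1) (Y : measurableType d2) :=
  isMeasurableFun.Build _ _ _ _ (@snd X Y) measurable_snd.

Section law_transfer.
Context {R : realType}.

Lemma integral_law_in d1 d2 (W : measurableType d1) (Y : measurableType d2)
    (P : {measure set W -> \bar R}) (f : W -> Y) (nu : {measure set Y -> \bar R})
    (g : Y -> \bar R) (D : set Y) :
  measurable_fun [set: W] f -> has_law P f nu -> measurable D ->
  measurable_fun [set: Y] g -> (forall y, 0 <= g y) ->
  \int[nu]_(y in D) g y = \int[P]_(w in f @^-1` D) g (f w).
Proof.
move=> mf law mD mg g0; rewrite integral_mkcond (integral_law mf law).
- by rewrite [RHS]integral_mkcond.
- by apply/(measurable_restrictT _ _).1 => //; exact: measurable_funTS.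
- by move=> y; rewrite patchE; case: ifP.
Qed.

(** The null set must be common to all V: the set measured at x is the section of U, which varies
    with x. *)
Lemma eq_semidirect d1 d2 (X : measurableType d1) (Y : measurableType d2)
    (mu mu' : probability X R) (k k' : R.-pker X ~> Y) :
  (forall U, measurable U -> mu U = mu' U) ->
  {ae mu, forall x, forall V, measurable V -> k x V = k' x V} ->
  forall U, measurable U -> semidirect mu k U = semidirect mu' k' U.
Proof.
move=> mumu' kk' U mU; rewrite -[RHS](eq_integral_measure _ mumu').
apply: ae_eq_lower_integral => //; apply: filterS kk' => x; apply.
exact: measurable_xsection.
Qed.

Lemma semidirect_factor d1 d2 d3 (X : measurableType d1) (X' : measurableType d2)
    (Y : measurableType d3) (mu : probability X R) (k : R.-pker X ~> Y)
    (k' : R.-pker X' ~> Y) (s : {mfun X >-> X'}) :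
  (forall x V, measurable V -> k x V = k' (s x) V) ->
  has_law (semidirect mu k) (fun xy => (s xy.1, xy.2))
    (semidirect (distribution mu s) k').
Proof.
move=> kk'; pose f (xy : X * Y) := (s xy.1, xy.2).
have mf : measurable_fun setT f.
  by apply/measurable_fun_pair => //; exact: measurableT_comp.
pose ff : {mfun (X * Y)%type >-> (X' * Y)%type} := HB.pack f
  (isMeasurableFun.Build _ _ _ _ f mf).
apply: (@rect_generate R _ _ _ _ (distribution (semidirect mu k) ff)
  (semidirect (distribution mu s) k')).
  rewrite [X in X < _](_ : _ = 1) ?ltry//.
  exact: (probability_setT (distribution (semidirect mu k) ff)).
move=> E F mE mF; rewrite [RHS]semidirect_rect//.
rewrite -[LHS]/(semidirect mu k ((s @^-1` E) `*` F)).
rewrite semidirect_rect//; last exact: measurable_preimage.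
rewrite ge0_integral_pushforward//; last first.
  by apply: measurable_funTS; exact: measurable_kernel.
by apply: eq_integral => x _; rewrite kk'.
Qed.

End law_transfer.

Section kcomp_probability.
Context d1 d2 d3 (X : measurableType d1) (Y : measurableType d2)
  (Z : measurableType d3) (R : realType).
Variables (l : R.-pker X ~> Y) (k : R.-pker X * Y ~> Z).

Definition pkcomp (x : X) : {measure set Z -> \bar R} := kcomp l k x.

Let mpkcomp U : measurable U -> measurable_fun [set: X] (pkcomp ^~ U).
Proof.
move=> mU; apply: (measurable_fun_integral_finite_kernel (fun z => k z U) l) => //.
exact: measurable_kernel.
Qed.

HB.instance Definition _ := isKernel.Build _ _ _ _ _ pkcomp mpkcomp.

Let pkcompT x : pkcomp x setT = 1.
Proof.
rewrite /pkcomp /= /kcomp (eq_integral (cst 1)); last by move=> y _; rewrite prob_kernel.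
by rewrite integral_cst// mul1e prob_kernel.
Qed.

HB.instance Definition _ := Kernel_isProbability.Build _ _ _ _ _ pkcomp pkcompT.

End kcomp_probability.

Section joint_theory.
Context {R : realType} (A : nat -> completePseudoMetricType R)
  (B : int -> completePseudoMetricType R) (M : nat)
  (mu : probability (outs B 0) R)
  (Q : forall i : nat, R.-pker (win B i M * borel (A i)) ~> borel (B i)).
Implicit Types (P : policies A B).

Local Notation hist i := (hist A B i).
Local Notation joint := (joint mu Q).

Lemma eq_joint P P' i : (forall j, (j < i)%N -> P j = P' j) -> joint P i = joint P' i.
Proof.
elim: i => [//|i IH] PP' /=; rewrite IH ?PP'// => j ji.
by rewrite PP'// ltnW.
Qed.

Lemma ae_eq_joint P P' i :
  (forall j, (j < i)%N -> {ae joint P j, forall h,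
     forall U, measurable U -> P j h U = P' j h U}) ->
  forall U, measurable U -> joint P i U = joint P' i U.
Proof.
elim: i => [//|i IH] PP' U mU /=; apply: eq_semidirect.
- apply: eq_semidirect; last exact: PP'.
  by apply: IH => j ji; apply: PP'; exact: ltnW.
- by apply: aeW.
- by rewrite -[X in measurable X]/(@snoc R A B i @^-1` U); exact: measurable_preimage.
Qed.

Definition input_law P i : probability (hist i * borel (A i))%type R :=
  semidirect (joint P i) (P i).

Lemma law_input P i :
  has_law (joint P i.+1) (fun w => (hprev w, lastA w)) (input_law P i).
Proof.
move=> U mU; rewrite /= /distribution /pushforward.
rewrite (_ : _ @^-1` _ = U `*` setT).
  rewrite semidirect_rect//; rewrite (eq_integral (cst 1)).
    by rewrite integral_cst// mul1e.
  by move=> x _; rewrite prob_kernel.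
transitivity ((fun x : hist i * borel (A i) * borel (B i) =>
    (hprev (snoc x), lastA (snoc x))) @^-1` U); first by [].
rewrite (_ : (fun x => _) = fst); last first.
  by apply/funext => -[[h a] b]; rewrite hprev_snoc lastA_snoc.
by apply/seteqP; split => -[[h a] b] //= [].
Qed.

Lemma law_hprev P i : has_law (joint P i.+1) (@hprev R A B i) (joint P i).
Proof.
move=> U mU; have H := law_input P (measurableX mU measurableT).
transitivity (input_law P i (U `*` setT)).
  by rewrite -H; congr (joint P i.+1 _); apply/seteqP; split => w /= => [|[]].
rewrite -[LHS]/(semidirect (joint P i) (P i) (U `*` setT)) semidirect_rect//.
rewrite (eq_integral (cst 1)); last by move=> x _; rewrite prob_kernel.
by rewrite integral_cst// mul1e.
Qed.

(** Only the law [tau] of (s, A_i) enters, so the result serves both for a policy reading the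
    history through [s] and for an arbitrary policy whose conditional distribution of A_i given [s]
    is known. *)
Lemma law_factor P i d (S : measurableType d) (s : {mfun hist i >-> S})
    (tau : probability (S * borel (A i))%type R) (K : R.-pker S * borel (A i) ~> borel (B i)) :
  has_law (input_law P i) (fun x => (s x.1, x.2)) tau ->
  (forall h a V, measurable V -> Q i (window M h.2, a) V = K (s h, a) V) ->
  has_law (joint P i.+1) (fun w => ((s (hprev w), lastA w), lastB w))
    (semidirect tau K).
Proof.
move=> ltau QK U mU.
pose sA (x : hist i * borel (A i)) := (s x.1, x.2).
have msA : measurable_fun setT sA.
  by apply/measurable_fun_pair => //; exact: measurableT_comp.
pose sAf : {mfun (hist i * borel (A i))%type >-> (S * borel (A i))%type} :=
  HB.pack sA (isMeasurableFun.Build _ _ _ _ sA msA).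
have := @semidirect_factor R _ _ _ _ _ _ (input_law P i) (channel_law Q i) K sAf.
move=> /(_ (fun x V mV => QK x.1 x.2 V mV)) /(_ U mU) H.
apply: (etrans _ (eq_semidirect (mu := distribution (input_law P i) sAf) (k := K)
  ltau (aeW _ _) mU)); last by [].
rewrite -H /= /distribution /pushforward; congr (semidirect _ _ _).
transitivity ((fun x : hist i * borel (A i) * borel (B i) =>
  (s (hprev (snoc x)), lastA (snoc x), lastB (snoc x))) @^-1` U); first by [].
congr (_ @^-1` U); apply/funext => x.
by rewrite hprev_snoc lastA_snoc lastB_snoc.
Qed.

Lemma law_policy_factor P i d (S : measurableType d) (s : {mfun hist i >-> S})
    (pi : R.-pker S ~> borel (A i)) :
  (forall h V, measurable V -> P i h V = pi (s h) V) ->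
  has_law (input_law P i) (fun x => (s x.1, x.2))
    (semidirect (distribution (joint P i) s) pi).
Proof. exact: semidirect_factor. Qed.

Lemma law_cond_factor P i d (S : measurableType d) (s : {mfun hist i >-> S})
    (pi : R.-pker S ~> borel (A i)) :
  is_cond_dist (joint P i.+1) (fun w => s (hprev w)) lastA pi ->
  has_law (input_law P i) (fun x => (s x.1, x.2))
    (semidirect (distribution (joint P i) s) pi).
Proof.
move=> cd U mU.
have msp : measurable_fun setT (fun w : hist i.+1 => s (hprev w)).
  exact: measurableT_comp.
pose sp : {mfun hist i.+1 >-> S} := HB.pack (fun w : hist i.+1 => s (hprev w))
  (isMeasurableFun.Build _ _ _ _ _ msp).
have := @is_cond_dist_law _ _ _ _ _ _ _ (joint P i.+1) sp lastA pi
  (@measurable_lastA _ _ _ _) cd U mU.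
have -> : semidirect (distribution (joint P i.+1) sp) pi U =
          semidirect (distribution (joint P i) s) pi U.
  apply: eq_semidirect => //; last by apply: aeW.
  move=> V mV; rewrite -[LHS]/(joint P i.+1 (hprev (i:=i) @^-1` (s @^-1` V))).
  by rewrite law_hprev//; exact: measurable_preimage.
move=> <-; rewrite -law_input//.
rewrite -[X in measurable X]/((fun x : hist i * borel (A i) => (s x.1, x.2)) @^-1` U).
apply: measurable_preimage => //; apply/measurable_fun_pair => //.
exact: measurableT_comp.
Qed.

(** Conditioning on any function of the history and the input that still determines the channel law
    returns the channel. *)
Lemma channel_cond_dist P i d (Z : measurableType d)
    (g : hist i * borel (A i) -> Z) (r : R.-pker Z ~> borel (B i)) :
  measurable_fun setT g ->
  (forall x V, measurable V -> Q i (hist_input_window M x) V = r (g x) V) ->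
  is_cond_dist (joint P i.+1) (fun w => g (hprev w, lastA w)) lastB r.
Proof.
move=> mg Qr E F mE mF.
have mpl : measurable_fun setT (fun w : hist i.+1 => (hprev w, lastA w)).
  by apply/measurable_fun_pair => //; exact: measurable_lastA.
have mgE : measurable (g @^-1` E) by exact: measurable_preimage.
rewrite -(integral_law_in (g := fun x => r (g x) F) mpl (@law_input P i) mgE)//;
  last exact: (measurableT_comp (measurable_kernel r F mF) mg).
rewrite (eq_integral (channel_law Q i ^~ F)); last first.
  by move=> x _; rewrite -Qr.
apply: (etrans _ (semidirect_rect (input_law P i) (channel_law Q i) mgE mF)).
rewrite /= /distribution /pushforward; congr (semidirect _ _ _).
transitivity ((fun x : hist i * borel (A i) * borel (B i) =>
  (g (hprev (snoc x), lastA (snoc x)), lastB (snoc x))) @^-1` (E `*` F)); first by [].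
rewrite (_ : (fun x => _) = fun x : hist i * borel (A i) * borel (B i) => (g x.1, x.2)).
  by apply/seteqP; split => -[[h a] b].
by apply/funext => -[[h a] b]; rewrite hprev_snoc lastA_snoc lastB_snoc.
Qed.

(** The channel averaged over the input kernel is the law of B_i given the history; if it depends on
    the history through [t] only, it is also the law given [t]. *)
Lemma output_cond_dist P i d (Z : measurableType d)
    (t : hist i -> Z) (r : R.-pker Z ~> borel (B i)) :
  measurable_fun setT t ->
  (forall h V, measurable V ->
     \int[P i h]_a Q i (window M h.2, a) V = r (t h) V) ->
  is_cond_dist (joint P i.+1) (fun w => t (hprev w)) lastB r.
Proof.
move=> mt Pr E F mE mF.
have mtE : measurable (t @^-1` E) by exact: measurable_preimage.
have mprev : measurable_fun setT (@hprev R A B i) by exact: measurable_hprev.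
rewrite -(integral_law_in (g := fun h => r (t h) F) mprev (@law_hprev P i) mtE)//;
  last exact: (measurableT_comp (measurable_kernel r F mF) mt).
rewrite [LHS](_ : _ = semidirect (input_law P i) (channel_law Q i)
    ((t @^-1` E `*` setT) `*` F)); last first.
  rewrite /= /distribution /pushforward; congr (semidirect _ _ _).
  transitivity ((fun x : hist i * borel (A i) * borel (B i) =>
    (t (hprev (snoc x)), lastB (snoc x))) @^-1` (E `*` F)); first by [].
  rewrite (_ : (fun x => _) =
      fun x : hist i * borel (A i) * borel (B i) => (t x.1.1, x.2)).
    by apply/seteqP; split => -[[h a] b] /= => [[]|[[]]].
  by apply/funext => -[[h a] b]; rewrite hprev_snoc lastB_snoc.
rewrite semidirect_rect//; last exact: measurableX.
have mQ : measurable_fun setT (channel_law Q i ^~ F) by exact: measurable_kernel.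
rewrite /input_law [LHS]integral_mkcond [LHS]integral_semidirect; first last.
- by apply/(measurable_restrictT _ _).1; [exact: measurableX|exact: measurable_funTS].
- by move=> x; rewrite patchE; case: ifP.
rewrite [RHS]integral_mkcond; apply: eq_integral => h _.
rewrite [RHS]patchE; case: ifPn => hE.
  rewrite -Pr//; apply: eq_integral => a _; rewrite patchE ifT//.
  by rewrite inE /=; split => //; exact: set_mem hE.
apply: integral0_eq => a _; rewrite patchE ifF//.
by apply/negP; rewrite inE => -[/= hE' _]; move/negP: hE; apply; rewrite inE.
Qed.

End joint_theory.

(** * Expectation of a sum of two variables from their marginal laws *)

Section clamp.
Context {R : realType}.
Local Open Scope ring_scope.

Definition clamp (k x : R) : R := Num.max (- k) (Num.min k x).

Lemma clamp_bound (k x : R) : 0 <= k -> - k <= clamp k x <= k.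
Proof.
move=> k0; rewrite /clamp le_max lexx/= ge_max ge_min lexx/= andbT; lra.
Qed.

Lemma clamp_id (k x : R) : `|x| <= k -> clamp k x = x.
Proof.
rewrite ler_norml => /andP[kx xk]; rewrite /clamp min_r//; exact: max_r.
Qed.

Lemma clamp_cases (k x : R) : 0 <= k ->
  [\/ x <= - k /\ clamp k x = - k, - k <= x <= k /\ clamp k x = x |
      k <= x /\ clamp k x = k].
Proof.
move=> k0; rewrite /clamp; case: (leP k x) => kx.
  by constructor 3; split => //; apply: max_r; lra.
case: (leP (- k) x) => xk; last by constructor 1; split => //; exact: ltW.
by constructor 2; split => //; rewrite (ltW kx).
Qed.

(** A negative summand is compensated by the other one, which is at least as large in absolute value
    and thus reaches the truncation level no later. Three summands break this: 2, -1, -1 truncated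
    at 1 add up to -1. *)
Lemma clamp_mono (k k' x y : R) : 0 <= k -> k <= k' -> 0 <= x + y ->
  clamp k x + clamp k y <= clamp k' x + clamp k' y.
Proof.
move=> k0 kk' xy; have k'0 := le_trans k0 kk'.
case: (clamp_cases x k0) => -[? ->]; case: (clamp_cases y k0) => -[? ->];
  case: (clamp_cases x k'0) => -[? ->]; case: (clamp_cases y k'0) => -[? ->]; lra.
Qed.

Lemma clamp_ge0 (k x y : R) : 0 <= k -> 0 <= x + y -> 0 <= clamp k x + clamp k y.
Proof.
move=> k0 xy.
case: (clamp_cases x k0) => -[? ->]; case: (clamp_cases y k0) => -[? ->]; lra.
Qed.

Lemma measurable_clamp k : measurable_fun [set: R] (clamp k).
Proof. by apply: measurable_maxr => //; exact: measurable_minr. Qed.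

End clamp.

Section simons.
Context d (W : measurableType d) (R : realType).
Implicit Types (P : probability W R) (X Y : W -> R).

(** Adding k to each truncation makes the integrands nonnegative, so that additivity of nonnegative
    integrals applies; the two shifts account for 2k. *)
Lemma integral_clamp P X Y (k : nat) :
  measurable_fun setT X -> measurable_fun setT Y -> (forall w, (0 <= X w + Y w)%R) ->
  \int[P]_w (clamp k%:R (X w) + clamp k%:R (Y w))%:E + (2 * k%:R)%:E =
  \int[P]_w (clamp k%:R (X w) + k%:R)%:E + \int[P]_w (clamp k%:R (Y w) + k%:R)%:E.
Proof.
move=> mX mY XY.
have mc (Z : W -> R) : measurable_fun setT Z ->
    measurable_fun setT (fun w => clamp k%:R (Z w)).
  by move=> mZ; exact: (measurableT_comp (measurable_clamp _)).
have mck (Z : W -> R) : measurable_fun setT Z ->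
    measurable_fun setT (fun w => (clamp k%:R (Z w) + k%:R)%:E).
  by move=> mZ; apply/measurable_EFinP; apply: measurable_funD => //; exact: mc.
have ck0 (Z : W -> R) w : 0 <= (clamp k%:R (Z w) + k%:R)%:E.
  by rewrite lee_fin; have /andP[] := clamp_bound (Z w) (ler0n R k) => ? ?; lra.
rewrite -[X in _ + X = _](_ : \int[P]_w (2 * k%:R)%:E = _); last first.
  by rewrite integral_cst// [X in _ * X](_ : _ = 1) ?mule1//; exact: (probability_setT P).
rewrite -!ge0_integralD//; [|exact: mck|exact: mck| |].
- by apply: eq_integral => w _; rewrite -!EFinD; congr EFin; lra.
- by move=> w _; rewrite lee_fin clamp_ge0.
- by apply/measurable_EFinP; apply: measurable_funD; exact: mc.
Qed.

(* Neither [X] nor [Y] need be integrable; their truncations are, and the sum of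
   the truncations increases to [X + Y] by [clamp_mono]. *)
Lemma integral_sum_marginal (P1 P2 : probability W R) X Y :
  measurable_fun setT X -> measurable_fun setT Y -> (forall w, (0 <= X w + Y w)%R) ->
  (forall V, measurable V -> P1 (X @^-1` V) = P2 (X @^-1` V)) ->
  (forall V, measurable V -> P1 (Y @^-1` V) = P2 (Y @^-1` V)) ->
  \int[P1]_w (X w + Y w)%:E = \int[P2]_w (X w + Y w)%:E.
Proof.
move=> mX mY XY lawX lawY.
have marg (Z : W -> R) (k : nat) : measurable_fun setT Z ->
    (forall V, measurable V -> P1 (Z @^-1` V) = P2 (Z @^-1` V)) ->
    \int[P1]_w (clamp k%:R (Z w) + k%:R)%:E = \int[P2]_w (clamp k%:R (Z w) + k%:R)%:E.
  move=> mZ lawZ; pose Zf : {mfun W >-> R} := HB.pack Z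
    (isMeasurableFun.Build _ _ _ _ Z mZ).
  have mg : measurable_fun [set: R] (fun z => (clamp k%:R z + k%:R)%:E).
    by apply/measurable_EFinP; apply: measurable_funD => //; exact: measurable_clamp.
  have g0 (z : R) : 0 <= (clamp k%:R z + k%:R)%:E.
    by rewrite lee_fin; have /andP[] := clamp_bound z (ler0n R k) => ? ?; lra.
  have h1 : has_law P1 Z (distribution P1 Zf) by [].
  have h2 : has_law P2 Z (distribution P1 Zf).
    by move=> V mV; rewrite -lawZ.
  by rewrite -(integral_law mZ h1 mg g0) -(integral_law mZ h2 mg g0).
pose F P k := \int[P]_w (clamp k%:R (X w) + clamp k%:R (Y w))%:E.
have FE k : F P1 k = F P2 k.
  have := integral_clamp P1 k mX mY XY.
  rewrite (marg X k mX lawX) (marg Y k mY lawY) -(integral_clamp P2 k mX mY XY).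
  move/eqP; rewrite eq_le => /andP[h1 h2]; apply/eqP; rewrite eq_le.
  by move: h1 h2; rewrite !leeD2rE// => -> ->.
have limF P : \int[P]_w (X w + Y w)%:E = limn (F P).
  rewrite /F -monotone_convergence//.
  - apply: eq_integral => w _; apply/esym/cvg_lim => //.
    have [m Xm] : exists m : nat, (Num.max `|X w| `|Y w| <= m%:R)%R.
      exists (Num.bound (Num.max `|X w| `|Y w|)%R).
      by apply/ltW/archi_boundP; rewrite le_max normr_ge0.
    apply: cvg_near_cst; exists m => // j /= mj; congr EFin.
    move: Xm; rewrite ge_max => /andP[Xm Ym].
    by rewrite !clamp_id// (le_trans _ (_ : m%:R <= j%:R)%R)// ler_nat.
  - move=> j; apply/measurable_EFinP; apply: measurable_funD;
      exact: (measurableT_comp (measurable_clamp _)).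
  - by move=> j w _; rewrite lee_fin clamp_ge0.
  - move=> w _ i j ij; rewrite lee_fin clamp_mono// ler_nat//.
by rewrite !limF; congr (limn _); apply/funext.
Qed.

End simons.

(** * Averaged policies *)

Section directed_information.
Context {R : realType} (A : nat -> completePseudoMetricType R)
  (B : int -> completePseudoMetricType R) (M : nat)
  (mu : probability (outs B 0) R)
  (Q : forall i : nat, R.-pker (win B i M * borel (A i)) ~> borel (B i)).
Hypothesis polishB : forall j, polish (B j).
Implicit Types (P : policies A B).

Local Notation hist i := (hist A B i).
Local Notation joint := (joint mu Q).

Lemma ins_extendE i (w : hist i.+1) :
  w.1 = extend (@ins_extend_subproof i) (hprev w).1 (lastA w).
Proof.
apply: functional_extensionality_dep => -[j Dj].
have [ji|ji] := eqVneq j i.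
  subst j; have := extend_eq (@ins_extend_subproof i) (hprev w).1 (lastA w) Dj.
  rewrite /Defs.coord => ->; rewrite /lastA /input /Defs.coord.
  by congr (w.1 (exist _ _ _)); exact: bool_irrelevance.
have ji' : (j < i)%N by exact: ins_extend_subproof ji.
rewrite (@extend_neq _ _ _ _ _ _ _ _ _ _ ji')//=.
by rewrite /restr /=; congr (w.1 (exist _ _ _)); exact: bool_irrelevance.
Qed.

Definition channel_stat i (x : outs B i * ins A i.+1) : win B i M * borel (A i) :=
  (window M x.1, input (ltnSn i) x.2).

Lemma measurable_channel_stat i : measurable_fun setT (@channel_stat i).
Proof.
apply/measurable_fun_pair.
  by apply: (measurableT_comp (f := window M)) => //; exact: measurable_restr.
by apply: (measurableT_comp (f := input (ltnSn i))) => //; exact: measurable_coord.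
Qed.

HB.instance Definition _ i :=
  isMeasurableFun.Build _ _ _ _ (@channel_stat i) (@measurable_channel_stat i).

Definition past_input i (w : hist i.+1) : outs B i * ins A i.+1 := (pastB w, w.1).

Lemma measurable_past_input i : measurable_fun setT (@past_input i).
Proof. by apply/measurable_fun_pair => //; exact: measurable_pastB. Qed.

HB.instance Definition _ i :=
  isMeasurableFun.Build _ _ _ _ (@past_input i) (@measurable_past_input i).

Lemma past_input_cond_dist P i :
  is_cond_dist (joint P i.+1) (@past_input i) lastB (kreindex (Q i) (@channel_stat i)).
Proof.
pose g (x : hist i * borel (A i)) : outs B i * ins A i.+1 :=
  (x.1.2, extend (@ins_extend_subproof i) x.1.1 x.2).
have -> : @past_input i = fun w => g (hprev w, lastA w).
  by apply/funext => w; rewrite /past_input [in LHS]ins_extendE.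
apply: channel_cond_dist.
  apply/measurable_fun_pair; first exact: measurableT_comp.
  by apply: measurable_extend => //; exact: measurableT_comp.
move=> [[a b] x] V mV; rewrite /g /kreindex /= /channel_stat /hist_input_window /=.
congr (Q i (_, _) V).
exact: (esym (extend_eq (@ins_extend_subproof i) a x (ltnSn i))).
Qed.

(** [cond_mutual_info] is built on chosen versions of the conditional distributions; the one given
    (B^{i-1}, A^i) agrees almost surely with the channel. *)
Lemma cond_mutual_info_past P i :
  cond_mutual_info (joint P i.+1) fst (@lastB R A B i) (@pastB R A B i) =
  \int[joint P i.+1]_w kl (kat (Q i) (winB M w, lastA w))
    (kat (output_law mu Q P i) (pastB w)).
Proof.
have [G detG] := polish_determining (polishB i%:Z).
have H := @ae_cond_dist_unique _ _ _ _ _ _ _ (joint P i.+1) (@past_input i) G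
  lastB _ _ detG (cond_distP (@past_input_cond_dist P i)) (@past_input_cond_dist P i).
apply: ae_eq_lower_integral; [by move=> w; exact: kl_ge0|by move=> w; exact: kl_ge0|].
by apply: filterS H => w H; exact: eq_kl.
Qed.

Lemma directed_infoE n P : directed_info mu Q n P =
  log_density_sum mu Q n P (fun i w => kat (output_law mu Q P i) (pastB w)).
Proof. by apply: eq_bigr => i _; exact: cond_mutual_info_past. Qed.

(* [st] is a statistic of the past outputs which can be updated from the last
   output and determines the channel: a window of length at least M, or the whole
   past. *)
Section statistic.
Context (dS : nat -> measure_display) (S : forall i, measurableType (dS i)).
Variables (st : forall i, {mfun outs B i >-> S i})
  (stH : forall i, {mfun hist i >-> S i})
  (upd : forall i, {mfun (S i * borel (B i))%type >-> S i.+1})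
  (K : forall i, R.-pker (S i * borel (A i)) ~> borel (B i)).
Hypothesis stHE : forall i h, stH i h = st i h.2.
Hypothesis stS : forall i (w : hist i.+1),
  stH i.+1 w = upd i (stH i (hprev w), lastB w).
Hypothesis KE : forall i (b : outs B i) a V, measurable V ->
  Q i (window M b, a) V = K i (st i b, a) V.

Definition stat_policies := forall i, R.-pker (S i) ~> borel (A i).

Definition policy_of_stat (pi : stat_policies) : policies A B :=
  fun i => kreindex (pi i) (stH i).

Definition stat_output_law (pi : stat_policies) i : R.-pker (S i) ~> borel (B i) :=
  pkcomp (pi i) (K i).

Definition last_stat i (w : hist i.+1) : S i := stH i (hprev w).

Lemma measurable_last_stat i : measurable_fun setT (@last_stat i).
Proof. exact: measurableT_comp. Qed.

HB.instance Definition _ i :=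
  isMeasurableFun.Build _ _ _ _ (@last_stat i) (@measurable_last_stat i).

Definition last_stat_input i (w : hist i.+1) : S i * borel (A i) :=
  (last_stat w, lastA w).

Lemma measurable_last_stat_input i : measurable_fun setT (@last_stat_input i).
Proof.
apply/measurable_fun_pair; first exact: measurable_last_stat.
exact: measurable_lastA.
Qed.

HB.instance Definition _ i := isMeasurableFun.Build _ _ _ _
  (@last_stat_input i) (@measurable_last_stat_input i).

Lemma stat_channelE i (w : hist i.+1) V : measurable V ->
  K i (last_stat_input w) V = Q i (winB M w, lastA w) V.
Proof. by move=> mV; rewrite /last_stat_input /last_stat stHE -KE. Qed.

Lemma stat_channel P i :
  is_cond_dist (joint P i.+1) (@last_stat_input i) lastB (K i).
Proof.
apply: (@channel_cond_dist _ _ _ _ _ _ _ _ _ _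
  (fun x => (stH i x.1, x.2))).
  by apply/measurable_fun_pair => //; exact: measurableT_comp.
by move=> x V mV; rewrite stHE KE.
Qed.

Lemma policy_output_integral pi i h V : measurable V ->
  \int[policy_of_stat pi i h]_a Q i (window M h.2, a) V =
  stat_output_law pi i (stH i h) V.
Proof. by move=> mV; apply: eq_integral => a _; rewrite stHE KE. Qed.

Lemma stat_output pi i :
  is_cond_dist (joint (policy_of_stat pi) i.+1) (@last_stat i) lastB
    (stat_output_law pi i).
Proof.
by apply: output_cond_dist => // h V mV; exact: policy_output_integral.
Qed.

(** Policy and channel both read the past outputs through the statistic, so conditioning on the
    whole past gives the same law as conditioning on the statistic. *)
Lemma past_output pi i :
  is_cond_dist (joint (policy_of_stat pi) i.+1) (@pastB R A B i) lastB
    (kreindex (stat_output_law pi i) (st i)).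
Proof.
apply: (@output_cond_dist _ _ _ _ _ _ _ _ _ _ (@snd _ _)) => // h V mV.
by rewrite policy_output_integral// stHE.
Qed.

Lemma ae_output_law pi i : {ae joint (policy_of_stat pi) i.+1, forall w,
  forall V, measurable V ->
    output_law mu Q (policy_of_stat pi) i (pastB w) V =
    stat_output_law pi i (last_stat w) V}.
Proof.
have [G detG] := polish_determining (polishB i%:Z).
have := @ae_cond_dist_unique _ _ _ _ _ _ _ _ (@pastB R A B i) G lastB _ _ detG
  (cond_distP (@past_output pi i)) (@past_output pi i).
by apply: filterS => w H V mV; rewrite /output_law H//= /kreindex/= /last_stat stHE.
Qed.

Lemma directed_info_policy n pi : directed_info mu Q n (policy_of_stat pi) =
  log_density_sum mu Q n (policy_of_stat pi)
    (fun i w => kat (stat_output_law pi i) (last_stat w)).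
Proof.
rewrite directed_infoE; apply: eq_bigr => i _.
apply: ae_eq_lower_integral; [by move=> w; exact: kl_ge0|by move=> w; exact: kl_ge0|].
apply: filterS (ae_output_law pi i) => w H; exact: eq_kl.
Qed.

Lemma stat_cond_mutual_info pi i :
  cond_mutual_info (joint (policy_of_stat pi) i.+1) lastA lastB (@last_stat i) =
  \int[joint (policy_of_stat pi) i.+1]_w kl (kat (Q i) (winB M w, lastA w))
    (kat (stat_output_law pi i) (last_stat w)).
Proof.
have [G detG] := polish_determining (polishB i%:Z).
have H1 := @ae_cond_dist_unique _ _ _ _ _ _ _ _ (@last_stat_input i) G lastB _ _ detG
  (cond_distP (@stat_channel (policy_of_stat pi) i)) (@stat_channel (policy_of_stat pi) i).
have H2 := @ae_cond_dist_unique _ _ _ _ _ _ _ _ (@last_stat i) G lastB _ _ detG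
  (cond_distP (@stat_output pi i)) (@stat_output pi i).
apply: ae_eq_lower_integral; [by move=> w; exact: kl_ge0|by move=> w; exact: kl_ge0|].
apply: filterS2 H1 H2 => w H1 H2; apply: eq_kl => // V mV.
exact: (etrans (H1 V mV) (stat_channelE w mV)).
Qed.

Lemma stat_triple_law P i pi :
  has_law (input_law mu Q P i) (fun x => (stH i x.1, x.2))
    (semidirect (distribution (joint P i) (stH i)) pi) ->
  has_law (joint P i.+1) (fun w => (last_stat_input w, lastB w))
    (semidirect (semidirect (distribution (joint P i) (stH i)) pi) (K i)).
Proof.
by move=> /law_factor; apply => h a V mV; rewrite stHE KE.
Qed.

Lemma policy_triple_law pi i :
  has_law (joint (policy_of_stat pi) i.+1) (fun w => (last_stat_input w, lastB w))
    (semidirect (semidirect (distribution (joint (policy_of_stat pi) i) (stH i))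
      (pi i)) (K i)).
Proof. by apply: stat_triple_law; exact: law_policy_factor. Qed.

Hypothesis polishA : forall i, polish (A i).

Definition averaged_policy P : stat_policies :=
  fun i => cond_dist (joint P i.+1) (@last_stat i) (@lastA R A B i).

Lemma averaged_triple_law P i :
  has_law (joint P i.+1) (fun w => (last_stat_input w, lastB w))
    (semidirect (semidirect (distribution (joint P i) (stH i))
      (averaged_policy P i)) (K i)).
Proof.
apply: stat_triple_law; apply: law_cond_factor; apply: polish_cond_dist => //.
exact: measurable_last_stat.
Qed.

(** [upd] makes S_(i+1) a function of (S_i, B_i), and under both policies the triple law is built
    from the law of S_i by the same two kernels. *)
Lemma averaged_stat_law P i U : measurable U ->
  joint P i (stH i @^-1` U) =
  joint (policy_of_stat (averaged_policy P)) i (stH i @^-1` U).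
Proof.
elim: i U => [//|i IH] U mU.
pose u (x : S i * borel (A i) * borel (B i)) := upd i (x.1.1, x.2).
have mu' : measurable_fun setT u.
  apply: (measurableT_comp (f := upd i)) => //; apply/measurable_fun_pair => //.
  by do 2?apply: measurableT_comp.
have mUu : measurable (u @^-1` U) by exact: measurable_preimage.
have stE : stH i.+1 @^-1` U =
    (fun w : hist i.+1 => (last_stat_input w, lastB w)) @^-1` (u @^-1` U).
  by apply/seteqP; split => w /=; rewrite stS.
rewrite stE; apply: (etrans (averaged_triple_law P mUu)).
apply: (etrans _ (esym (policy_triple_law _ mUu))).
apply: (eq_semidirect _ _ mUu); last by apply: aeW.
move=> V mV; apply: (eq_semidirect _ _ mV); last by apply: aeW.
by move=> V' mV'; exact: IH.
Qed.

Lemma eq_averaged_triple_law P i U : measurable U ->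
  joint P i.+1 ((fun w => (last_stat_input w, lastB w)) @^-1` U) =
  joint (policy_of_stat (averaged_policy P)) i.+1
    ((fun w => (last_stat_input w, lastB w)) @^-1` U).
Proof.
move=> mU; apply: (etrans (averaged_triple_law P mU)).
apply: (etrans _ (esym (policy_triple_law _ mU))).
apply: (eq_semidirect _ _ mU); last by apply: aeW.
move=> V mV; apply: (eq_semidirect _ _ mV); last by apply: aeW.
by move=> V' mV'; exact: averaged_stat_law.
Qed.

Lemma directed_info_averaged_le n P : directed_info mu Q n P <=
  directed_info mu Q n (policy_of_stat (averaged_policy P)).
Proof.
set pi := averaged_policy P; rewrite directed_infoE directed_info_policy.
apply: lee_sum => i _.
have [G detG] := polish_determining (polishB i%:Z).
pose q : R.-pker (hist i.+1) ~> borel (B i) := kreindex (K i) (@last_stat_input i).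
have qE w : forall V, measurable V -> Q i (winB M w, lastA w) V = q w V.
  by move=> V mV; exact: (esym (stat_channelE w mV)).
(* The competitor in the minimization: the output law of the averaged policy, evaluated on the past
   outputs under [P]. *)
pose r : R.-pker (outs B i) ~> borel (B i) := kreindex (stat_output_law pi i) (st i).
have mout : is_cond_dist (joint P i.+1) (@pastB R A B i) lastB (output_law mu Q P i).
  exact: polish_cond_dist.
have qcd E F : measurable E -> measurable F ->
    \int[joint P i.+1]_(w in (@pastB R A B i) @^-1` E) q w F =
    \int[joint P i.+1]_(w in (@pastB R A B i) @^-1` E) output_law mu Q P i (pastB w) F.
  move=> mE mF; rewrite -mout//.
  have := @past_input_cond_dist P i (E `*` setT) F (measurableX mE measurableT) mF.
  rewrite (_ : _ @^-1` (E `*` setT) = (@pastB R A B i) @^-1` E).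
    move=> ->; apply: eq_integral => w _; rewrite -qE//.
  by apply/seteqP; split => w /= => [[]|].
have := kl_cond_dist_min detG (P := joint P i.+1) (z := @pastB R A B i) (q := q)
  (k := output_law mu Q P i) r qcd.
move=> H; apply: (@le_trans _ _ (\int[joint P i.+1]_w kl (kat q w) (kat r (pastB w)))).
  apply: le_trans H; rewrite le_eqVlt; apply/orP; left; apply/eqP.
  by apply: eq_integral => w _; apply: eq_kl => // V mV; exact: qE.
(* Both arguments of the remaining relative entropy are kernels in (S_i, A_i), whose law is the same
   under the two policies. *)
pose kr : R.-pker (S i * borel (A i)) ~> borel (B i) :=
  kreindex (stat_output_law pi i) (@fst (S i) (borel (A i))).
have toK P' : \int[joint P' i.+1]_w kl (kat (Q i) (winB M w, lastA w))
    (kat (stat_output_law pi i) (last_stat w)) =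
    \int[distribution (joint P' i.+1) (@last_stat_input i)]_x kl (kat (K i) x) (kat kr x).
  have law : has_law (joint P' i.+1) (@last_stat_input i)
      (distribution (joint P' i.+1) (@last_stat_input i)) by [].
  apply: (etrans _ (integral_kl_law detG (K i) kr (@measurable_last_stat_input i) law)).
  by apply: eq_integral => w _; apply: eq_kl => // V mV; exact: qE.
have eq_le (x y : \bar R) : x = y -> x <= y by move=> ->.
apply: eq_le; transitivity (\int[joint P i.+1]_w
    kl (kat (Q i) (winB M w, lastA w)) (kat (stat_output_law pi i) (last_stat w))).
  apply: eq_integral => w _; apply: eq_kl => V mV; first exact: (esym (qE w V mV)).
  by rewrite /r /= /kat /kreindex/= /last_stat stHE.
apply: (etrans (toK P)); apply: (etrans _ (esym (toK _))).
apply: eq_integral_measure => U mU.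
have := @eq_averaged_triple_law P i (U `*` setT) (measurableX mU measurableT).
have triple P' : joint P' i.+1 ((fun w => (last_stat_input w, lastB w)) @^-1`
    (U `*` setT)) = joint P' i.+1 ((@last_stat_input i) @^-1` U).
  by congr (joint P' i.+1 _); apply/seteqP; split => w /= => [[]|].
by move=> tl; apply: (etrans (esym (triple P))); apply: (etrans tl); exact: triple.
Qed.

Lemma follows_joint n P (pi : stat_policies) :
  (forall i, (i <= n)%N -> {ae joint P i, forall h,
     forall U, measurable U -> P i h U = pi i (stH i h) U}) ->
  forall U, measurable U -> joint P n.+1 U = joint (policy_of_stat pi) n.+1 U.
Proof. by move=> Ppi; apply: ae_eq_joint => j; rewrite ltnS; exact: Ppi. Qed.

(** * Equality of the expected costs *)

Definition stage_costs := forall i, borel (A i) * S i -> R.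

Section cost.
Variable gamma : stage_costs.
Arguments gamma : clear implicits.
Hypothesis mgamma : forall i, measurable_fun setT (gamma i).

(** The predicate selects stages; it will be the stages before k, those from k on, or all of
    them. *)
Definition partial_cost (p : pred nat) i (h : hist i) : R :=
  (\sum_(j < i | p j)
    gamma j (input (ltn_ord j) h.1, st j (past_outs (ltnW (ltn_ord j)) h.2)))%R.

Lemma partial_costS p i (w : hist i.+1) : partial_cost p w =
  (partial_cost p (hprev w) + (if p i then gamma i (lastA w, last_stat w) else 0))%R.
Proof.
rewrite /partial_cost big_mkcond big_ord_recr/= [in RHS]big_mkcond/=.
congr (_ + _)%R; last first.
  case: ifP => // _; congr (gamma i (_, _)).
    by congr (w.1 (exist _ _ _)); exact: bool_irrelevance.
  rewrite /last_stat stHE; congr (st i _); rewrite /hprev/= /pastB.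
  by congr (past_outs _ w.2); exact: bool_irrelevance.
apply: eq_bigr => j _; case: ifP => // _; congr (gamma j (_, _)).
  by congr (w.1 (exist _ _ _)); exact: bool_irrelevance.
by congr (st j _); rewrite /past_outs /hprev/= /pastB /past_outs; apply/esym/restr_comp.
Qed.

Lemma measurable_partial_cost p i : measurable_fun setT (@partial_cost p i).
Proof.
elim: i => [|i IH].
  rewrite (_ : @partial_cost p 0%N = cst 0%R)//.
  by apply/funext => h; rewrite /partial_cost big_ord0.
rewrite (_ : @partial_cost p i.+1 = fun w => (partial_cost p (hprev w) +
    (if p i then gamma i (lastA w, last_stat w) else 0))%R); last first.
  by apply/funext => w; rewrite partial_costS.
have mAS : measurable_fun setT (fun w : hist i.+1 => (lastA w, last_stat w)).
  by apply/measurable_fun_pair; [exact: measurable_lastA|exact: measurable_last_stat].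
have mgAS := measurableT_comp (@mgamma i) mAS.
apply: measurable_funD.
  by apply: measurableT_comp IH _; exact: measurable_hprev.
by case: (p i).
Qed.

Variable P : policies A B.
Let pi := averaged_policy P.

(* Passing from [hybrid_policy k] to [hybrid_policy k.+1] changes neither the law
   of the cost of the times before [k] nor that of the times from [k] on; their
   joint law may change. *)
Definition hybrid_policy k : policies A B :=
  fun j => if (j < k)%N then P j else policy_of_stat pi j.

Lemma joint_hybrid k i : (i <= k)%N -> joint (hybrid_policy k) i = joint P i.
Proof.
by move=> ik; apply: eq_joint => j ji; rewrite /hybrid_policy (leq_trans ji ik).
Qed.

(** The two hybrids have the same kernels before k, and later kernels do not alter the law of
    earlier variables. *)
Lemma hybrid_past_law k i U : measurable U ->
  joint (hybrid_policy k) i (@partial_cost (fun j => (j < k)%N) i @^-1` U) =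
  joint (hybrid_policy k.+1) i (@partial_cost (fun j => (j < k)%N) i @^-1` U).
Proof.
elim: i U => [|i IH] U mU; first by rewrite !joint_hybrid.
have [ik|ki] := ltnP i k; first by rewrite !joint_hybrid// ltnW.
have mV : measurable (@partial_cost (fun j => (j < k)%N) i @^-1` U).
  by apply: measurable_preimage => //; exact: measurable_partial_cost.
have -> : @partial_cost (fun j => (j < k)%N) i.+1 @^-1` U =
    @hprev R A B i @^-1` (@partial_cost (fun j => (j < k)%N) i @^-1` U).
  by apply/seteqP; split => w /=; rewrite partial_costS ltnNge ki/= addr0.
apply: (etrans (law_hprev mu Q _ mV)); apply: (etrans (IH U mU)).
exact: (esym (law_hprev mu Q _ mV)).
Qed.

(** The statistic enlarged by the accumulated cost is again updated from itself and the last input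
    and output, so its law can be propagated in time. *)
Definition stat_cost (p : pred nat) i (h : hist i) : S i * R :=
  (stH i h, partial_cost p h).

Lemma measurable_stat_cost p i : measurable_fun setT (@stat_cost p i).
Proof. by apply/measurable_fun_pair => //; exact: measurable_partial_cost. Qed.

HB.instance Definition _ p i :=
  isMeasurableFun.Build _ _ _ _ (@stat_cost p i) (@measurable_stat_cost p i).

Definition drop_cost i (x : (S i * R) * borel (A i)) : S i * borel (A i) :=
  (x.1.1, x.2).

Lemma measurable_drop_cost i : measurable_fun setT (@drop_cost i).
Proof. by apply/measurable_fun_pair => //; do 2?apply: measurableT_comp. Qed.

HB.instance Definition _ i :=
  isMeasurableFun.Build _ _ _ _ (@drop_cost i) (@measurable_drop_cost i).

Lemma hybrid_triple_law k :
  has_law (joint (hybrid_policy k) k.+1) (fun w => (last_stat_input w, lastB w))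
    (semidirect (semidirect (distribution (joint P k) (stH k)) (pi k)) (K k)).
Proof.
rewrite -(@joint_hybrid k k)//; apply: stat_triple_law; apply: law_policy_factor.
by move=> h V mV; rewrite /hybrid_policy ltnn.
Qed.

(** Before k nothing has been accumulated and the hybrids agree. At k one uses [P] and the other its
    average, with the same law of (S_k, A_k, B_k). After k both use the averaged kernels, which
    propagate the enlarged statistic alike. *)
Lemma hybrid_future_law k i U : measurable U ->
  joint (hybrid_policy k) i (@stat_cost (leq k) i @^-1` U) =
  joint (hybrid_policy k.+1) i (@stat_cost (leq k) i @^-1` U).
Proof.
elim: i U => [|i IH] U mU; first by rewrite !joint_hybrid.
have mupd3 d0 (T : measurableType d0) (f : T -> S i * borel (B i)) :
    measurable_fun setT f -> measurable_fun setT (fun x => upd i (f x)).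
  exact: measurableT_comp.
case: (ltngtP i k) => [ik|ki|e]; first by rewrite !joint_hybrid// ltnW.
  pose s : {mfun hist i >-> (S i * R)%type} := @stat_cost (leq k) i.
  pose pi' := kreindex (pi i) (@fst (S i) R).
  pose K' := kreindex (K i) (@drop_cost i).
  have law H : H i = policy_of_stat pi i ->
      has_law (joint H i.+1) (fun w => ((s (hprev w), lastA w), lastB w))
        (semidirect (semidirect (distribution (joint H i) s) pi') K').
    move=> Hi; apply: law_factor; last first.
      by move=> h a V mV; rewrite KE// -stHE.
    by apply: law_policy_factor => h V mV; rewrite Hi.
  have lawH := law (hybrid_policy k); rewrite {1}/hybrid_policy ltnNge (ltnW ki)/= in lawH.
  have lawH' := law (hybrid_policy k.+1); rewrite {1}/hybrid_policy ltnNge ki/= in lawH'.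
  pose u (x : (S i * R) * borel (A i) * borel (B i)) : S i.+1 * R :=
    (upd i (x.1.1.1, x.2), (x.1.1.2 + gamma i (x.1.2, x.1.1.1))%R).
  have mu' : measurable_fun setT u.
    apply/measurable_fun_pair.
      apply: mupd3; apply/measurable_fun_pair => //.
      by do 3?apply: measurableT_comp.
    apply: measurable_funD; first by do 3?apply: measurableT_comp.
    apply: (measurableT_comp (@mgamma i)); apply/measurable_fun_pair.
      by do 2?apply: measurableT_comp.
    by do 3?apply: measurableT_comp.
  have mUu : measurable (u @^-1` U) by exact: measurable_preimage.
  have -> : @stat_cost (leq k) i.+1 @^-1` U =
      (fun w => ((s (hprev w), lastA w), lastB w)) @^-1` (u @^-1` U).
    apply/seteqP; split => w /=.
      by rewrite /stat_cost partial_costS (ltnW ki) stS.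
    by rewrite /u/= /stat_cost partial_costS (ltnW ki) stS.
  apply: (etrans (lawH erefl _ mUu)); apply: (etrans _ (esym (lawH' erefl _ mUu))).
  apply: (eq_semidirect _ _ mUu); last by apply: aeW.
  move=> V mV; apply: (eq_semidirect _ _ mV); last by apply: aeW.
  by move=> V' mV'; exact: IH.
subst i.
pose u (x : (S k * borel (A k)) * borel (B k)) : S k.+1 * R :=
  (upd k (x.1.1, x.2), gamma k (x.1.2, x.1.1)).
have mu' : measurable_fun setT u.
  apply/measurable_fun_pair.
    apply: mupd3; apply/measurable_fun_pair => //.
    by do 2?apply: measurableT_comp.
  apply: (measurableT_comp (@mgamma k)); apply/measurable_fun_pair.
    by do 2?apply: measurableT_comp.
  by do 2?apply: measurableT_comp.
have mUu : measurable (u @^-1` U) by exact: measurable_preimage.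
have -> : @stat_cost (leq k) k.+1 @^-1` U =
    (fun w => (last_stat_input w, lastB w)) @^-1` (u @^-1` U).
  have E (w : hist k.+1) : stat_cost (leq k) w = u (last_stat_input w, lastB w).
    rewrite /stat_cost partial_costS leqnn stS /u/=; congr (_, _).
    by rewrite /partial_cost big1 ?add0r// => j; rewrite leqNgt ltn_ord.
  by apply/seteqP; split => w /=; rewrite E.
apply: (etrans (hybrid_triple_law mUu)); apply: (etrans (esym (averaged_triple_law P mUu))).
by rewrite joint_hybrid.
Qed.

(** The stages before k and those from k on have costs without sign but a nonnegative sum, and each
    block keeps its law from one hybrid to the next: the situation of [integral_sum_marginal]. The
    hybrids lead from the averaged policy at k = 0 to [P] at k = n + 1. *)
Lemma expected_cost_averaged n (c : ins A n.+1 * outs B n -> R) :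
  (forall x, (0 <= c x)%R) ->
  (forall w : hist n.+1, c (w.1, pastB w) = partial_cost predT w) ->
  expected_cost mu Q c P = expected_cost mu Q c (policy_of_stat pi).
Proof.
move=> c0 cE.
have splitc k (w : hist n.+1) : c (w.1, pastB w) =
    (partial_cost (fun j => (j < k)%N) w + partial_cost (leq k) w)%R.
  rewrite cE /partial_cost (bigID (fun j : 'I_n.+1 => (j < k)%N))/=.
  by congr (_ + _)%R; apply: eq_bigl => j; rewrite -leqNgt.
have step k : expected_cost mu Q c (hybrid_policy k) =
              expected_cost mu Q c (hybrid_policy k.+1).
  have toXY P' : expected_cost mu Q c P' = \int[joint P' n.+1]_w
      (partial_cost (fun j => (j < k)%N) w + partial_cost (leq k) w)%:E.
    by apply: eq_integral => w _; rewrite (splitc k).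
  apply: (etrans (toXY _)); apply: (etrans _ (esym (toXY _))).
  apply: integral_sum_marginal; [exact: measurable_partial_cost|
    exact: measurable_partial_cost| | |].
  - by move=> w; rewrite -(splitc k).
  - by move=> V mV; exact: hybrid_past_law.
  - move=> V mV; have := @hybrid_future_law k n.+1 (setT `*` V) (measurableX measurableT mV).
    rewrite (_ : _ @^-1` _ = @partial_cost (leq k) n.+1 @^-1` V)//.
    by apply/seteqP; split => w /= => [[]|].
have -> : policy_of_stat pi = hybrid_policy 0 by apply: functional_extensionality_dep.
have -> : expected_cost mu Q c P = expected_cost mu Q c (hybrid_policy n.+1).
  by rewrite /expected_cost joint_hybrid.
suff H k : expected_cost mu Q c (hybrid_policy k) =
    expected_cost mu Q c (hybrid_policy 0) by exact: H.
elim: k => [|k IH]; first reflexivity.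
exact: (etrans (esym (step k)) IH).
Qed.

End cost.
End statistic.
End directed_information.

(** * Windows and complete pasts *)

HB.instance Definition _ (R : realType) (B : int -> completePseudoMetricType R) i m :=
  isMeasurableFun.Build _ _ _ _ (@window R B i m) (measurable_restr _).

Section window_policies.
Context {R : realType} (A : nat -> completePseudoMetricType R)
  (B : int -> completePseudoMetricType R) (M : nat)
  (mu : probability (outs B 0) R)
  (Q : forall i : nat, R.-pker (win B i M * borel (A i)) ~> borel (B i)).
Hypotheses (polishA : forall i, polish (A i)) (polishB : forall j, polish (B j)).

Local Notation joint := (joint mu Q).

Lemma win_extend_subproof (i m : nat) (j : int) :
  (i.+1%:Z - m%:Z <= j < i.+1%:Z)%R -> j != i%:Z -> (i%:Z - m%:Z <= j < i%:Z)%R.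
Proof. by move=> /andP[ij ji] ne; apply/andP; split; lia. Qed.

(** The coordinate that leaves the sliding window is simply not read; for m = 0 the window is empty
    and the new output is dropped as well. *)
Definition window_step i m (x : win B i m * borel (B i)) : win B i.+1 m :=
  extend (@win_extend_subproof i m) x.1 x.2.

Lemma measurable_window_step i m : measurable_fun setT (@window_step i m).
Proof. exact: measurable_extend. Qed.

HB.instance Definition _ i m :=
  isMeasurableFun.Build _ _ _ _ (@window_step i m) (@measurable_window_step i m).

Lemma hist_windowS i m (w : hist A B i.+1) :
  @hist_window R A B i.+1 m w =
    window_step (@hist_window R A B i m (hprev w), lastB w).
Proof.
apply: functional_extensionality_dep => -[j Dj].
have [ji|ji] := eqVneq j i%:Z.
  subst j; have := extend_eq (@win_extend_subproof i m)
    (@hist_window R A B i m (hprev w)) (lastB w) Dj.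
  rewrite /Defs.coord /window_step /= => ->.
  by rewrite /lastB /output /Defs.coord; congr (w.2 (exist _ _ _)); exact: bool_irrelevance.
have ji' := win_extend_subproof Dj ji.
rewrite /window_step (@extend_neq _ _ _ _ _ _ _ _ _ _ ji')//=.
by congr (w.2 (exist _ _ _)); exact: bool_irrelevance.
Qed.

Section longer_window.
Variables (m : nat) (le_Mm : (M <= m)%N).
Variable K : forall i, R.-pker (win B i m * borel (A i)) ~> borel (B i).
Hypothesis KE : forall i x a V, measurable V ->
  Q i (subwindow le_Mm x, a) V = K i (x, a) V.

Let KE' i (b : outs B i) a V : measurable V ->
  Q i (window M b, a) V = K i (window m b, a) V.
Proof.
move=> mV; rewrite -KE//; congr (Q i (_, a) V).
by rewrite /window /subwindow; apply/esym/restr_comp.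
Qed.

Let st i : {mfun outs B i >-> win B i m} := @window R B i m.
Let stH i : {mfun hist A B i >-> win B i m} := @hist_window R A B i m.
Let upd i : {mfun (win B i m * borel (B i))%type >-> win B i.+1 m} := @window_step i m.

Let stHE i (h : hist A B i) : stH i h = st i h.2. Proof. by []. Qed.

Let stS i (w : hist A B i.+1) : stH i.+1 w = upd i (stH i (hprev w), lastB w).
Proof. exact: hist_windowS. Qed.

(** [v] is left abstract so that the statement covers both [vlaw], with m = M, and [nulaw], with a
    longer window. *)
Lemma directed_info_window n (pi : win_policies A B m)
    (v : forall i, win B i m -> probability (borel (B i)) R) :
  (forall i x U, v i x U = kcomp (pi i) (K i) x U) ->
  directed_info mu Q n (policy_of pi) =
  log_density_sum mu Q n (policy_of pi) (fun i w => v i (winB m w)).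
Proof.
move=> vE.
apply: (etrans (directed_info_policy mu polishB stHE KE' n pi)).
apply: eq_bigr => i _; apply: eq_integral => w _; apply: eq_kl => // V mV.
by rewrite vE.
Qed.

Lemma cond_mutual_info_window (pi : win_policies A B m)
    (v : forall i, win B i m -> probability (borel (B i)) R) i :
  (forall i x U, v i x U = kcomp (pi i) (K i) x U) ->
  cond_mutual_info (joint (policy_of pi) i.+1) lastA lastB (winB m) =
  \int[joint (policy_of pi) i.+1]_w
    kl (kat (Q i) (winB M w, lastA w)) (v i (winB m w)).
Proof.
move=> vE.
apply: (etrans (stat_cond_mutual_info mu polishB stHE KE' pi i)).
by apply: eq_integral => w _; apply: eq_kl => // V mV; rewrite vE.
Qed.

Lemma window_joint_lawP (pi : win_policies A B m) i : window_joint_law mu Q pi (K i).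
Proof.
move=> U mU; apply: (etrans (policy_triple_law mu stHE KE' pi mU)).
apply: (eq_semidirect _ _ mU); last by apply: aeW.
move=> V mV; apply: (eq_semidirect _ _ mV); last by apply: aeW.
move=> V' mV'; apply/esym; apply: (law_hprev mu Q).
exact: (measurable_preimage (@measurable_hist_window R A B i m)).
Qed.

Lemma follows_win_joint n (P : policies A B) (pi : win_policies A B m) :
  follows_win mu Q n P pi ->
  forall U, measurable U -> joint P n.+1 U = joint (policy_of pi) n.+1 U.
Proof. exact: (follows_joint (stH := stH)). Qed.

Lemma follows_policy_of n (pi : win_policies A B m) :
  follows_win mu Q n (policy_of pi) pi.
Proof. by move=> i _; apply: aeW. Qed.

(** One policy serves all costs of this form, being constructed from [P] without reference to any
    cost. *)
Lemma exists_window_policy n (P : policies A B) : exists pi : win_policies A B m,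
  directed_info mu Q n P <= directed_info mu Q n (policy_of pi) /\
  forall (gamma : forall i : nat, borel (A i) * win B i m -> R)
    (c : ins A n.+1 * outs B n -> R),
    (forall i, measurable_fun setT (gamma i)) -> (forall x, (0 <= c x)%R) ->
    (forall a b, c (a, b) = \sum_(i < n.+1)
      gamma i (input (ltn_ord i) a, window m (past_outs (leq_ord i) b)))%R ->
    expected_cost mu Q c P = expected_cost mu Q c (policy_of pi).
Proof.
exists (averaged_policy mu Q stH P); split.
  exact: (directed_info_averaged_le mu polishB stHE stS KE' polishA).
move=> gamma c mgamma c0 cE.
apply: (expected_cost_averaged mu stHE stS KE' polishA mgamma P c0) => w.
rewrite cE; apply: eq_bigr => j _; congr (gamma j (_, _)).
by congr (window m _); rewrite /past_outs /pastB; apply: restr_comp.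
Qed.

End longer_window.
End window_policies.

Section output_policies.
Context {R : realType} (A : nat -> completePseudoMetricType R)
  (B : int -> completePseudoMetricType R) (M : nat)
  (mu : probability (outs B 0) R)
  (Q : forall i : nat, R.-pker (win B i M * borel (A i)) ~> borel (B i)).
Hypotheses (polishA : forall i, polish (A i)) (polishB : forall j, polish (B j)).

Definition outs_step i (x : outs B i * borel (B i)) : outs B i.+1 :=
  extend (@outs_extend_subproof i) x.1 x.2.

Lemma measurable_outs_step i : measurable_fun setT (@outs_step i).
Proof. exact: measurable_extend. Qed.

HB.instance Definition _ i :=
  isMeasurableFun.Build _ _ _ _ (@outs_step i) (@measurable_outs_step i).

Definition window_input i (x : outs B i * borel (A i)) : win B i M * borel (A i) :=
  (window M x.1, x.2).

Lemma measurable_window_input i : measurable_fun setT (@window_input i).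
Proof.
by apply/measurable_fun_pair => //; apply: (measurableT_comp (f := window M)).
Qed.

HB.instance Definition _ i :=
  isMeasurableFun.Build _ _ _ _ (@window_input i) (@measurable_window_input i).

Lemma outs_stepE i (w : hist A B i.+1) : w.2 = outs_step ((hprev w).2, lastB w).
Proof.
apply: functional_extensionality_dep => -[j Dj].
have [ji|ji] := eqVneq j i%:Z.
  subst j; have := extend_eq (@outs_extend_subproof i) (hprev w).2 (lastB w) Dj.
  rewrite /Defs.coord /outs_step /= => ->.
  by rewrite /lastB /output /Defs.coord; congr (w.2 (exist _ _ _)); exact: bool_irrelevance.
have ji' := outs_extend_subproof Dj ji.
rewrite /outs_step (@extend_neq _ _ _ _ _ _ _ _ _ _ ji')//=.
by congr (w.2 (exist _ _ _)); exact: bool_irrelevance.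
Qed.

(** A named identity, able to carry the structure of a measurable function. *)
Let idouts i (b : outs B i) := b.

Let measurable_idouts i : measurable_fun setT (@idouts i).
Proof. exact: measurable_id. Qed.

HB.instance Definition _ i :=
  isMeasurableFun.Build _ _ _ _ (@idouts i) (@measurable_idouts i).

Let st i : {mfun outs B i >-> outs B i} := @idouts i.
Let stH i : {mfun hist A B i >-> outs B i} := @snd (ins A i) (outs B i).
Let upd i : {mfun (outs B i * borel (B i))%type >-> outs B i.+1} := @outs_step i.
Let K i : R.-pker (outs B i * borel (A i)) ~> borel (B i) :=
  kreindex (Q i) (@window_input i).

Lemma exists_output_policy n (P : policies A B) :
  exists (pi : out_policies A B) (P' : policies A B),
    [/\ follows_out mu Q n P' pi, directed_info mu Q n P <= directed_info mu Q n P' &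
    forall (gamma : forall i : nat, borel (A i) * outs B i -> R)
      (c : ins A n.+1 * outs B n -> R),
      (forall i, measurable_fun setT (gamma i)) -> (forall x, (0 <= c x)%R) ->
      (forall a b, c (a, b) = \sum_(i < n.+1)
        gamma i (input (ltn_ord i) a, past_outs (leq_ord i) b))%R ->
      expected_cost mu Q c P = expected_cost mu Q c P'].
Proof.
have stHE i (h : hist A B i) : stH i h = st i h.2 by [].
have stS i (w : hist A B i.+1) : stH i.+1 w = upd i (stH i (hprev w), lastB w).
  exact: outs_stepE.
have KE i (b : outs B i) a V : measurable V ->
    Q i (window M b, a) V = K i (st i b, a) V by [].
exists (averaged_policy mu Q stH P).
exists (policy_of_stat stH (averaged_policy mu Q stH P)); split.
- by move=> i _; apply: aeW.
- exact: (directed_info_averaged_le mu polishB stHE stS KE polishA).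
- move=> gamma c mgamma c0 cE.
  apply: (expected_cost_averaged mu stHE stS KE polishA mgamma P c0) => w.
  rewrite cE; apply: eq_bigr => j _; congr (gamma j (_, _)).
  by rewrite /past_outs /pastB; apply: restr_comp.
Qed.

End output_policies.

(** * Comparison of the suprema and the three parts of the theorem *)

Lemma eq_ereal_sup_image (R : realType) (T1 T2 : Type) (A1 : set T1) (A2 : set T2)
    (f1 : T1 -> \bar R) (f2 : T2 -> \bar R) :
  (forall x, A1 x -> exists2 y, A2 y & f1 x <= f2 y) ->
  (forall y, A2 y -> exists2 x, A1 x & f2 y <= f1 x) ->
  ereal_sup [set f1 x | x in A1] = ereal_sup [set f2 y | y in A2].
Proof.
move=> h12 h21; apply/eqP; rewrite eq_le; apply/andP; split;
  apply: ge_ereal_sup => _ [x Ax <-].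
  have [y Ay xy] := h12 x Ax; apply: (le_trans xy).
  by apply: ereal_sup_ubound; exists y.
have [y Ay xy] := h21 x Ax; apply: (le_trans xy).
by apply: ereal_sup_ubound; exists y.
Qed.

Theorem mainTheorem2 (R : realType)
    (A : nat -> completePseudoMetricType R)
    (B : int -> completePseudoMetricType R)
    (polishA : forall i, polish (A i)) (polishB : forall j, polish (B j))
    (n M K : nat)
    (mu : probability (outs B 0) R)
    (Q : forall i : nat, R.-pker (win B i M * borel (A i)) ~> borel (B i)) :
  (forall P : policies A B,
     directed_info mu Q n P =
     log_density_sum mu Q n P
       (fun i w => kat (output_law mu Q P i) (pastB w)))
  /\
  (* Part A *)
  [/\ ereal_sup [set directed_info mu Q n P | P in
        [set P | exists pi : win_policies A B M, follows_win mu Q n P pi]] =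
      ereal_sup [set directed_info mu Q n P | P in [set: policies A B]],
      ereal_sup [set directed_info mu Q n P | P in [set: policies A B]] =
      ereal_sup [set log_density_sum mu Q n (policy_of pi)
          (fun i w => vlaw Q pi i (winB M w))
        | pi in [set: win_policies A B M]],
      ereal_sup [set log_density_sum mu Q n (policy_of pi)
          (fun i w => vlaw Q pi i (winB M w))
        | pi in [set: win_policies A B M]] =
      ereal_sup [set \sum_(i < n.+1)
          cond_mutual_info (joint mu Q (policy_of pi) i.+1)
            lastA lastB (winB M)
        | pi in [set: win_policies A B M]] &
      forall (pi : win_policies A B M) (i : nat), (i <= n)%N ->
        window_joint_law mu Q pi (Q i)]
  /\
  (* Part B *)
  (forall (c : ins A n.+1 * outs B n -> R)
     (gamma : forall i : nat, borel (A i) * win B i K -> R) (kappa : R),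
     measurable_fun setT c -> (forall x, 0 <= c x)%R ->
     (forall i, measurable_fun setT (gamma i)) ->
     (forall a b, c (a, b) = \sum_(i < n.+1)
        gamma i (input (ltn_ord i) a, window K (past_outs (leq_ord i) b)))%R ->
     (0 <= kappa)%R ->
     lagrangian_duality mu Q c kappa ->
     let J := maxn M K in
     let restricted := [set P | exists pi : win_policies A B J,
       follows_win mu Q n P pi /\ admissible mu Q c kappa (policy_of pi)] in
     [/\ restricted `<=` admissible mu Q c kappa,
         ereal_sup [set directed_info mu Q n P | P in restricted] =
         ereal_sup [set directed_info mu Q n P
           | P in admissible mu Q c kappa],
         ereal_sup [set directed_info mu Q n P
           | P in admissible mu Q c kappa] =
         ereal_sup [set log_density_sum mu Q n (policy_of pi)
             (fun i w => nulaw Q (leq_maxl M K) pi i (winB J w))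
           | pi in [set pi : win_policies A B J |
               admissible mu Q c kappa (policy_of pi)]] &
         forall (pi : win_policies A B J) (i : nat), (i <= n)%N ->
           window_joint_law mu Q pi
             (kreindex (Q i) (subwindow_input (leq_maxl M K)))])
  /\
  (* Part C *)
  (forall (c : ins A n.+1 * outs B n -> R)
     (gamma : forall i : nat, borel (A i) * outs B i -> R) (kappa : R),
     measurable_fun setT c -> (forall x, 0 <= c x)%R ->
     (forall i, measurable_fun setT (gamma i)) ->
     (forall a b, c (a, b) = \sum_(i < n.+1)
        gamma i (input (ltn_ord i) a, past_outs (leq_ord i) b))%R ->
     (0 <= kappa)%R ->
     lagrangian_duality mu Q c kappa ->
     ereal_sup [set directed_info mu Q n P | P in
       [set P | exists pi : out_policies A B, follows_out mu Q n P pi]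
       `&` admissible mu Q c kappa] =
     ereal_sup [set directed_info mu Q n P
       | P in admissible mu Q c kappa]).
Proof.
(* Part A is the case m = M, where the subwindow map is the identity, though only
   propositionally. *)
have KE i (x : win B i M) a V : measurable V ->
    Q i (subwindow (leqnn M) x, a) V = Q i (x, a) V.
  by move=> _; rewrite /subwindow restr_id.
have vE (pi : win_policies A B M) i x U : vlaw Q pi i x U = kcomp (pi i) (Q i) x U by [].
have eq_le (x y : \bar R) : x = y -> x <= y by move=> ->.
have dirE pi := directed_info_window mu polishB KE n (vE pi).
have mutE pi i := cond_mutual_info_window mu polishB KE i (vE pi).
have avg := exists_window_policy mu polishA polishB KE n.
split; first exact: directed_infoE.
split.
  split.
  - apply: eq_ereal_sup_image => P _; first by exists P.
    have [pi [le_pi _]] := avg P; exists (policy_of pi) => //.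
    by exists pi; exact: follows_policy_of.
  - apply: eq_ereal_sup_image => [P _|pi _].
      have [pi [le_pi _]] := avg P; exists pi; first exact: I.
      exact: (le_trans le_pi (eq_le _ _ (dirE pi))).
    exists (policy_of pi); first by [].
    exact: (eq_le _ _ (esym (dirE pi))).
  - congr ereal_sup; apply: eq_imagel => pi _; apply: eq_bigr => i _.
    exact: (esym (mutE pi i)).
  - by move=> pi i _; exact: (window_joint_lawP mu KE).
split.
  move=> c gamma kappa mc c0 mgamma cE kappa0 _ J restricted.
  have KJ i (x : win B i J) a V : measurable V ->
      Q i (subwindow (leq_maxl M K) x, a) V =
      kreindex (Q i) (subwindow_input (leq_maxl M K)) (x, a) V by [].
  have nuE (pi : win_policies A B J) i x U : nulaw Q (leq_maxl M K) pi i x U =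
    kcomp (pi i) (kreindex (Q i) (subwindow_input (leq_maxl M K))) x U by [].
  have dirJ pi := directed_info_window mu polishB KJ n (nuE pi).
  (* The stage costs read their window of length K inside the longer window of length J, which then
     serves both the channel and the cost. *)
  pose gammaJ i (x : borel (A i) * win B i J) : R :=
    gamma i (x.1, subwindow (leq_maxr M K) x.2).
  have mgammaJ i : measurable_fun setT (gammaJ i).
    apply: (measurableT_comp (mgamma i)); apply/measurable_fun_pair => //.
    exact: measurableT_comp.
  have cJ a b : c (a, b) = (\sum_(i < n.+1)
      gammaJ i (input (ltn_ord i) a, window J (past_outs (leq_ord i) b)))%R.
    rewrite cE; apply: eq_bigr => i _; congr (gamma i (_, _)).
    by rewrite /subwindow /window/=; apply/esym/restr_comp.
  have avgJ P : exists2 pi : win_policies A B J,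
      directed_info mu Q n P <= directed_info mu Q n (policy_of pi) &
      expected_cost mu Q c P = expected_cost mu Q c (policy_of pi).
    have [pi [le_pi costE]] := exists_window_policy mu polishA polishB KJ n P.
    by exists pi; [exact: le_pi|exact: costE mgammaJ c0 cJ].
  have adm P P' : expected_cost mu Q c P = expected_cost mu Q c P' ->
      admissible mu Q c kappa P -> admissible mu Q c kappa P'.
    by rewrite /admissible/= => ->.
  have sub : restricted `<=` admissible mu Q c kappa.
    move=> P [pi [Ppi]]; apply: adm; apply/esym.
    apply: eq_integral_measure => U mU; exact: follows_win_joint Ppi _ mU.
  split => //.
  - apply: eq_ereal_sup_image => P admP; first by exists P => //; exact: sub.
    have [pi le_pi costE] := avgJ P; exists (policy_of pi); last exact: le_pi.
    by exists pi; split; [exact: follows_policy_of|exact: adm admP].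
  - apply: eq_ereal_sup_image => [P admP|pi admpi].
      have [pi le_pi costE] := avgJ P.
      exists pi; first exact: adm admP.
      exact: (le_trans le_pi (eq_le _ _ (dirJ pi))).
    exists (policy_of pi); first by [].
    exact: (eq_le _ _ (esym (dirJ pi))).
  - by move=> pi i _; exact: (window_joint_lawP mu KJ).
move=> c gamma kappa mc c0 mgamma cE kappa0 _.
apply: eq_ereal_sup_image => P; first by move=> [_ admP]; exists P.
move=> admP; have [pi [P' [P'pi le_P' costE]]] := exists_output_policy mu Q polishA polishB n P.
exists P'; last exact: le_P'.
split; first by exists pi; exact: P'pi.
by move: admP; rewrite /admissible/= (costE gamma c mgamma c0 cE).
Qed.
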